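(* Let $h=(h_i)_{i\ge 0}$ be a probability distribution on $\{0,1,2,\dots\}$ with $0<m_h:=\sum_{k\ge 1} k h_k<1$, and suppose that there exists $c>0$ such that $\sum_{l\ge k} h_l\le \exp\{-ck\}$ for each $k\in\mathbb{N}$. Let $\nu$ be a probability distribution on $(1,\infty)$ whose support is contained in $[q,Q]$ for some $Q>q>1$. Then, for all $t>0$, $$\Big(\mathbb{P}_{h,\nu,u}\times\mathbb{P}^{\phi}_{T,\beta,\mathcal{DE}}\Big)\left(\frac{H_\phi}{\mathbb{E}^{\phi}_{T,\beta,\mathcal{DE}}(H_\phi)}>t\right)\to \exp\{-t\}\qquad\text{as } u\to\infty .$$
   Context: Trees: let $\mathcal{U}=\bigcup_{n\ge 0}\mathbb{N}^n$ with $\mathbb{N}=\{1,2,\dots\}$ and $\mathbb{N}^0=\{\emptyset\}$. A finite rooted ordered tree $T$ is a finite subset of $\mathcal{U}$ that contains $\emptyset$ (the root, denoted $\phi$), contains $u_1\dots u_{n-1}$ (the parent) whenever it contains $u_1\dots u_n$ with $n\ge1$, and is such that each $u\in T$ has an integer $k_u\ge 0$ with $uj\in T$ if and only if $1\le j\le k_u$ (these $uj$ are the offspring of $u$). Edges join each non-root vertex to its parent. The tree is weighted if each edge $e$ carries a bias $\beta_e>1$. For $v\in V(T)$, $\omega(v)$ is the product of the biases along the simple path from $\phi$ to $v$ (so $\omega(\phi)=1$), and $\omega(T)=\sum_{v\in V(T)}\omega(v)$. The vertex $v_{\rm base}$ is the lexicographically minimal vertex among those at maximal distance from $\phi$. Laws: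 $\mathbb{P}_{h,\nu}$ is the law of a Galton-Watson tree with offspring distribution $h$, with edge biases that, given the tree, are i.i.d. with law $\nu$. For $u>0$, $\mathbb{P}_{h,\nu,u}=\mathbb{P}_{h,\nu}(\,\cdot\mid\omega(T)>u)$. Walk: given a weighted tree $T$, the $\beta$-biased walk $(X_n)$ is the Markov chain on $V(T)$ with the following transitions. From $v\ne\phi$ with offspring $v_1,\dots,v_k$, it jumps to the parent of $v$ with probability $\frac{1}{1+\sum_{i}\beta_{v,v_i}}$ and to $v_j$ with probability $\frac{\beta_{v,v_j}}{1+\sum_{i}\beta_{v,v_i}}$. From $\phi$ with offspring $\phi_1,\dots,\phi_k$, it jumps to $\phi_j$ with probability $\frac{\beta_{\phi,\phi_j}}{\sum_i\beta_{\phi,\phi_i}}$. $\mathbb{P}^v_{T,\beta}$, $\mathbb{E}^v_{T,\beta}$ denote law and expectation for the walk started at $v$. Set $H_\phi=\inf\{n\ge1:X_n=\phi\}$, $H_{v_{\rm base}}=\inf\{n\ge0:X_n=v_{\rm base}\}$, and let $\mathcal{DE}=\{H_{v_{\rm base}}<H_\phi\}$ be the deep excursion event. $\mathbb{P}^{\phi}_{T,\beta,\mathcal{DE}}=\mathbb{P}^\phi_{T,\beta}(\,\cdot\mid\mathcal{DE})$, with expectation $\mathbb{E}^\phi_{T,\beta,\mathcal{DE}}$. The notation $\mathbb{P}_{h,\nu,u}\times\mathbb{P}^{\phi}_{T,\beta,\mathcal{DE}}$ denotes the joint law obtained by sampling the weighted tree under $\mathbb{P}_{h,\nu,u}$ and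 then, given the tree, running the walk under $\mathbb{P}^{\phi}_{T,\beta,\mathcal{DE}}$. (For $u\ge 1$ the condition $\omega(T)>u$ forces $T$ to have at least one edge, so these objects are defined.) *)

(* Defs.v *)
From HB Require Import structures.
From mathcomp Require Import all_boot all_order all_algebra.
From mathcomp Require Import all_classical all_reals all_analysis.

Set Implicit Arguments.
Unset Strict Implicit.
Unset Printing Implicit Defensive.

Import Order.TTheory GRing.Theory Num.Theory.
Import numFieldNormedType.Exports.

Local Open Scope classical_set_scope.
Local Open Scope ring_scope.

(* Words over {1, 2, ...}; that all letters of the words of a tree are
   positive follows from [is_tree] below. *)
Notation vertex := (seq nat).
Notation phi := ([::] : vertex).

HB.instance Definition _ := isPointed.Build (seq nat) [::].

Definition parent (v : vertex) : vertex := take (size v).-1 v.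

Definition is_tree (T : set vertex) : Prop :=
  [/\ finite_set T,
      T phi,
      forall u j, T (rcons u j) -> T u &
      forall u, T u -> exists k : nat, forall j, T (rcons u j) <-> (1 <= j <= k)%N].

(* The bias of the edge joining v <> phi to its parent is [bias w v]; the
   values of [bias w] elsewhere are irrelevant. *)
Record wtree (R : realType) := WTree {
  tree : set vertex ;
  bias : vertex -> R }.

Definition is_wtree (R : realType) (w : wtree R) : Prop :=
  is_tree (tree w) /\ forall v, tree w v -> v != phi -> 1 < bias w v.

Definition has_edge (R : realType) (w : wtree R) : Prop :=
  exists2 v, tree w v & v != phi.

Definition vertex_weight (R : realType) (w : wtree R) (v : vertex) : R :=
  \prod_(i < size v) bias w (take i.+1 v).

Definition total_weight (R : realType) (w : wtree R) : R :=
  \sum_(v \in tree w) vertex_weight w v.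

Definition is_vbase (T : set vertex) (v : vertex) : Prop :=
  [/\ T v,
      forall u, T u -> (size u <= size v)%N &
      forall u, T u -> size u = size v -> ((v : seqlexi nat) <= u)%O].

Definition vbase (T : set vertex) : vertex := xget phi [set v | is_vbase T v].

Definition step_norm (R : realType) (w : wtree R) (v : vertex) : R :=
  (v != phi)%:R + \sum_(j \in [set j | tree w (rcons v j)]) bias w (rcons v j).

Definition step (R : realType) (w : wtree R) (v v' : vertex) : R :=
  if (v' \in tree w) && (v' != phi) && (parent v' == v)
  then bias w v' / step_norm w v
  else if (v != phi) && (v' == parent v) then (step_norm w v)^-1
  else 0.

Definition coordinate_events : set (set (nat -> vertex)) :=
  [set A | exists n v, A = [set x | x n = v]].

Notation trajectory := (g_sigma_algebraType coordinate_events).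

(* Q is the law of the biased walk on w started at v. *)
Definition is_walk_law (R : realType) (w : wtree R) (v : vertex)
    (Q : probability trajectory R) : Prop :=
  Q [set x : trajectory | x 0%N = v] = 1%E /\
  forall (n : nat) (y : nat -> vertex),
    Q [set x : trajectory | forall i, (i <= n.+1)%N -> x i = y i] =
    (Q [set x : trajectory | forall i, (i <= n)%N -> x i = y i] *
     (step w (y n) (y n.+1))%:E)%E.

(* inf {n >= m : x n = v}, with inf of the empty set equal to +oo. *)
Definition hitting_time (R : realType) (m : nat) (v : vertex)
    (x : trajectory) : \bar R :=
  ereal_inf [set (n%:R)%:E | n in [set n | (m <= n)%N /\ x n = v]].

Definition return_time (R : realType) : trajectory -> \bar R :=
  hitting_time R 1 phi.

Definition deep_excursion (R : realType) (w : wtree R) : set trajectory :=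
  [set x | (hitting_time R 0 (vbase (tree w)) x < return_time R x)%E].

Definition cond_prob (d : measure_display) (Omega : measurableType d)
    (R : realType) (P : probability Omega R) (D A : set Omega) : \bar R :=
  (P (A `&` D) / P D)%E.

Definition cond_expect (d : measure_display) (Omega : measurableType d)
    (R : realType) (P : probability Omega R) (D : set Omega)
    (f : Omega -> \bar R) : \bar R :=
  ((\int[P]_(o in D) f o) / P D)%E.

(* The Ulam-Harris construction of the Galton-Watson tree from the offspring
   numbers [k v] of all the words v. *)
Definition gw_tree (k : vertex -> nat) : set vertex :=
  [set v | forall i, (i < size v)%N ->
     (1 <= nth 0%N v i <= k (take i v))%N].

Definition gw_wtree (d : measure_display) (Omega : measurableType d)
    (R : realType) (P : probability Omega R)
    (K : vertex -> {RV P >-> nat}) (B : vertex -> {RV P >-> measurableTypeR R})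
    (o : Omega) : wtree R :=
  WTree (gw_tree (fun v => K v o)) (fun v => B v o).

(* All the variables [K v] and [B v] are mutually independent, the [K v] having
   law h and the [B v] law nu.  Then [gw_wtree K B] is a Galton-Watson tree whose
   edge biases are i.i.d. given the tree. *)
Definition gw_family (d : measure_display) (Omega : measurableType d)
    (R : realType) (h : probability nat R)
    (nu : probability (measurableTypeR R) R) (P : probability Omega R)
    (K : vertex -> {RV P >-> nat})
    (B : vertex -> {RV P >-> measurableTypeR R}) : Prop :=
  forall (s : seq vertex) (a : vertex -> set nat)
    (b : vertex -> set (measurableTypeR R)),
    uniq s -> (forall v, measurable (b v)) ->
    P (\bigcap_(v in [set` s]) (K v @^-1` a v `&` B v @^-1` b v)) =
    (\prod_(v <- s) (h (a v) * nu (b v)))%E.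

(* The joint law: the weighted tree W is sampled conditionally on its total
   weight exceeding u, then the walk is run under the law Q of the tree given
   the deep excursion event.  [A w] is the section at w of the event measured.
   Requiring [is_wtree] removes only a null set (infinite trees) when W is
   a subcritical Galton-Watson tree with biases above 1. *)
Definition joint_prob (d : measure_display) (Omega : measurableType d)
    (R : realType) (P : probability Omega R) (W : Omega -> wtree R)
    (Q : wtree R -> probability trajectory R) (u : R)
    (A : wtree R -> set trajectory) : \bar R :=
  cond_expect P [set o | is_wtree (W o) /\ u < total_weight (W o)]
    (fun o => cond_prob (Q (W o)) (deep_excursion (W o)) (A (W o))).

Definition mean_return_time (R : realType) (Q : wtree R -> probability trajectory R)
    (w : wtree R) : \bar R :=
  cond_expect (Q w) (deep_excursion w) (return_time R).

Definition measure_support (R : realType)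
    (nu : probability (measurableTypeR R) R) : set R :=
  [set x | forall e : R, 0 < e -> (0 < nu (ball x e))%E].

(* Main.v *)
Require Import Defs.
From HB Require Import structures.
From mathcomp Require Import all_boot all_order all_algebra.
From mathcomp Require Import all_classical all_reals all_analysis.
From mathcomp Require Import measurable_realfun ring lra zify.

(** Why the theorem holds.

    Quenched part. Fix a finite tree whose biases are at least q > 1, and let [top]
    be the kid of the root on the path to the base. A deep excursion steps to
    [top] and reaches the base before returning to the root. The walk is
    reversible, so that if it starts in the subtree above [top] from the
    normalized reversible measure, the probability of being alive (not yet back
    at the root) satisfies the exact identity [mean_aliveS]: one step loses the
    probability [alive n top] that the walk started at [top] is alive,
    multiplied by the weight of [top] over the mass of the subtree. Now suppose
    that the mass of the subtree is concentrated far up the path to the base.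
    Then from anywhere the walk soon either returns to the root or visits the
    base, and after visiting the base it forgets where it started: [alive n x]
    is close to [harm x * alive n vb], where [harm] is the probability of
    reaching the base first. Summed over all times, the error is at most the
    expected time to reach one of the two ends, which the explicit function
    [exit_bound] controls. Hence the identity says that the probability of
    being alive is nearly geometric ([mean_alive_exp]). The tail of the return
    time on the deep excursion event is thereby known up to a small error in
    its partial sums ([tail_sums]), and since it is nonincreasing it is known
    itself ([tail_of_partial_sums]). The sum of the tail is the mean, so that
    the limit has mean one ([tree_exponential]).

    Annealed part. It remains to see that, given a large total weight, the tree is
    concentrated with high probability ([concentration]). The probability p(u)
    that the weight exceeds u decays at most polynomially, because one heavy
    subtree at a kid makes the tree heavier by the factor q
    ([heavy_prob_scaling]). Follow the heaviest kid for k generations. All but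
    a small part of the weight stays above the path unless two kids of the same
    vertex have exceptionally heavy or tall subtrees ([fork]); by the branching
    property the probability of this is p(u) times something small ([mu_fork]),
    where all the moments of the offspring number are available to pay for
    polynomial factors. The base lies above the path too, since a subtree that
    is heavy without being tall ([stout]) has a probability smaller than any
    negative power of its weight ([mu_stout]).

    Averaging. Given the conditioning, the quenched probability is close to exp(-t)
    off an event of small probability and at most one on it, which bounds its
    average on both sides ([lower_average]). *)

Set Implicit Arguments.
Unset Strict Implicit.
Unset Printing Implicit Defensive.

Import Order.TTheory GRing.Theory Num.Theory.
Import numFieldNormedType.Exports.

Local Open Scope classical_set_scope.
Local Open Scope ring_scope.

(** * Elementary estimates on sums and powers *)

(** Bounded partial sums make some [f n] arbitrarily small. *)
Lemma le_of_summable (R : realType) (f : nat -> R) (a c B : R) :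
  (forall N, \sum_(n < N) f n <= B) -> (forall n, a <= c + f n) -> a <= c.
Proof.
move=> sB ac; rewrite leNgt; apply/negP => ca.
have d0 : 0 < a - c by rewrite subr_gt0.
pose N := (Num.truncn (B / (a - c))).+1.
have : N%:R * (a - c) <= B.
  apply: le_trans (sB N); rewrite mulr_natl -[N in _ *+ N]card_ord -sumr_const.
  by apply: ler_sum => i _; have := ac i; lra.
by rewrite -ler_pdivlMr // leNgt truncnS_gt.
Qed.

Lemma geometric_le (R : realType) (x : R) n : 0 <= x < 1 -> \sum_(i < n) x ^+ i <= (1 - x)^-1.
Proof.
move=> /andP[x0 x1]; have d0 : 0 < 1 - x by rewrite subr_gt0.
rewrite -(ler_pM2l d0) divff ?gt_eqF //.
suff -> : (1 - x) * \sum_(i < n) x ^+ i = 1 - x ^+ n by rewrite lerBlDr lerDl exprn_ge0.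
elim: n => [|n IH]; first by rewrite big_ord0 mulr0 expr0 subrr.
by rewrite big_ord_recr /= mulrDr IH exprS; ring.
Qed.

Lemma sum_expN (R : realType) (x : R) N : 0 < x ->
  \sum_(n < N) expR (- (x * n%:R)) <= (1 - expR (- x))^-1.
Proof.
move=> x0; have := @geometric_le R (expR (- x)) N.
rewrite expR_ge0 expR_lt1 oppr_lt0 x0 => /(_ isT); apply: le_trans.
by apply: ler_sum => n _; rewrite -mulNr expRM_natr.
Qed.

Lemma bernoulli_ge (R : realType) (x : R) n : 0 <= x -> 1 + n%:R * x <= (1 + x) ^+ n.
Proof.
move=> x0; elim: n => [|n IH]; first by rewrite mul0r addr0.
rewrite exprS -natr1; apply: (@le_trans _ _ ((1 + x) * (1 + n%:R * x))).
  have : 0 <= n%:R * x * x by rewrite !mulr_ge0.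
  lra.
by rewrite ler_wpM2l // addr_ge0.
Qed.

Lemma expn_unbounded (R : realType) (x y : R) : 1 < x -> exists n, y <= x ^+ n.
Proof.
move=> x1; exists (Num.truncn (y / (x - 1))).+1; have d0 : 0 < x - 1 by rewrite subr_gt0.
have := bernoulli_ge (Num.truncn (y / (x - 1))).+1 (ltW d0).
have -> : 1 + (x - 1) = x by rewrite addrC subrK.
apply: le_trans; have := truncnS_gt (y / (x - 1)); rewrite ltr_pdivrMr //; lra.
Qed.

Lemma expn_small (R : realType) (x eps : R) : 0 <= x < 1 -> 0 < eps -> exists n, x ^+ n <= eps.
Proof.
move=> x01 e0; apply: contrapT => no.
suff : eps <= 0 by rewrite leNgt e0.
apply: (@le_of_summable _ (fun n => x ^+ n) _ _ (1 - x)^-1) => n.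
  exact: geometric_le.
rewrite add0r leNgt; apply/negP => hn; apply: no; exists n; exact: ltW.
Qed.

(** * From partial sums to exponential tails *)

Lemma expRN_le_quad (R : realType) (x : R) : 0 <= x -> expR (- x) <= 1 - x + x ^+ 2.
Proof.
move=> x0; have e := expR_ge1Dx x.
have h := expRxMexpNx_1 x; have e0 := expR_ge0 (- x).
nra.
Qed.

Lemma expR_le_quad (R : realType) (x : R) : 0 <= x <= 2^-1 -> expR x <= 1 + x + 2 * x ^+ 2.
Proof.
move=> /andP[x0 x1]; have e := expR_ge1Dx (- x).
have e0 := expR_ge0 x.
have h : expR x * (1 - x) <= 1 by have := expRxMexpNx_1 x; nra.
suff : expR x * (1 - x) <= (1 + x + 2 * x ^+ 2) * (1 - x).
  by rewrite ler_pM2r //; lra.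
apply: (le_trans h); nra.
Qed.

Lemma expRN_lip (R : realType) (x y : R) : 0 <= x -> 0 <= y ->
  `|expR (- x) - expR (- y)| <= `|x - y|.
Proof.
have main (a b : R) : 0 <= a -> a <= b -> `|expR (- a) - expR (- b)| <= b - a.
  move=> a0 ab.
  have -> : - b = - a + - (b - a) by ring.
  rewrite expRD.
  have e1 := expR_ge1Dx (- (b - a)).
  have e2 : expR (- (b - a)) <= 1 by rewrite -[leRHS]expR0 ler_expR; lra.
  have e3 : expR (- a) <= 1 by rewrite -[leRHS]expR0 ler_expR; lra.
  have e4 := expR_gt0 (- a).
  rewrite ger0_norm; nra.
move=> x0 y0; case: (leP x y) => xy.
  by rewrite [leRHS]distrC [leRHS]ger0_norm ?subr_ge0 //; apply: main.
by rewrite distrC [leRHS]ger0_norm ?subr_ge0 ?(ltW xy) //; apply: main => //; exact: ltW.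
Qed.

(** If [z n = g * a n] and [b n = gb * a n] held exactly, [b] would be
    geometric with ratio [1 - lam * g / gb]. The two defects are nonnegative
    and the recurrence contracts, so that they matter only through their sums
    over all times, at most [rho]. In the application [b] is the probability of
    being alive, averaged over the starting point, and [a], [z] the same from
    the base and from the bottom of the subtree. *)
Lemma perturbed_geometric (R : realType) (lam g gb rho : R) (a b z : nat -> R) :
  0 < lam -> 0 <= g <= 1 -> 2^-1 <= gb <= 1 ->
  0 < lam * g <= 2^-1 ->
  b 0%N = 1 -> (forall n, b n.+1 = b n - lam * z n) ->
  (forall n, g * a n <= z n) -> (forall n, gb * a n <= b n) ->
  (forall N, \sum_(n < N) (z n - g * a n) <= rho) ->
  (forall N, \sum_(n < N) (b n - gb * a n) <= rho) ->
  forall N, `|b N - expR (- (lam * g * N%:R))| <=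
     3 * (lam * rho) + 2 * (lam * g) + 4 * (1 - gb).
Proof.
move=> lam0 /andP[g0 g1] /andP[gb0 gb1] /andP[th0 th1] b0 bS za ba sz sb N.
set th := lam * g in th0 th1 *.
pose c n := expR (- (th * n%:R)).
pose r := th / gb.
have gbp : 0 < gb by lra.
have rgb : r * gb = th by rewrite /r divfK // gt_eqF.
have r0 : 0 <= r by rewrite divr_ge0 // ltW.
have r1 : r <= 1 by rewrite /r ler_pdivrMr //; lra.
have rth : th <= r by rewrite -rgb ler_piMr.
have rth2 : r - th <= 2 * th * (1 - gb).
  have : (r - th) * gb <= 2 * th * (1 - gb) * gb; last by rewrite ler_pM2r.
  have h1 : 0 <= 1 - gb by lra.
  have h2 : th * (1 - gb) * (2 * gb - 1) >= 0.
    by rewrite mulr_ge0 ?mulr_ge0 ?(ltW th0) //; lra.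
  rewrite mulrBl rgb; lra.
have cS n : c n.+1 = c n * expR (- th).
  by rewrite /c -expRD; congr expR; rewrite -natr1; ring.
have c0 n : 0 <= c n by exact: expR_ge0.
have eth := expRN_le_quad (ltW th0); have eth' := expR_ge1Dx (- th).
(* b n.+1 = (1 - r) b n up to the defects, and e is the error made on replacing
   1 - r by the ratio expR (- th) of the exponential. *)
pose e := expR (- th) - 1 + r.
have e0 : 0 <= e by rewrite /e; lra.
have ee : e <= th ^+ 2 + 2 * th * (1 - gb) by rewrite /e; lra.
have main : `|b N - c N| <= lam * (\sum_(n < N) (z n - g * a n))
   + lam * (g / gb) * (\sum_(n < N) (b n - gb * a n)) + e * \sum_(n < N) c n.
  elim: N => [|N IH].
    by rewrite !big_ord0 !mulr0 !addr0 b0 /c mulr0 oppr0 expR0 subrr normr0.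
  rewrite !big_ord_recr /= bS cS.
  have zN : 0 <= z N - g * a N by rewrite subr_ge0.
  have bN : 0 <= b N - gb * a N by rewrite subr_ge0.
  have gg : 0 <= lam * (g / gb) by rewrite mulr_ge0 ?divr_ge0 ?(ltW lam0) ?(ltW gbp).
  have -> : b N - lam * z N - c N * expR (- th) =
    (1 - r) * (b N - c N) - lam * (z N - g * a N)
     + lam * (g / gb) * (b N - gb * a N) - c N * e.
    rewrite /e /r /th; field.
    by rewrite gt_eqF.
  set A := (1 - r) * _; set B := lam * (z N - _); set C := lam * (g / gb) * (b N - _).
  have hA : `|A| <= `|b N - c N|.
    by rewrite normrM ler_piMl // ger0_norm; lra.
  have hB : `|B| = B by rewrite ger0_norm // mulr_ge0 // ltW.
  have hC : `|C| = C by rewrite ger0_norm // mulr_ge0.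
  have hD : `|c N * e| = c N * e by rewrite ger0_norm // mulr_ge0.
  have h1 := ler_normB (A - B + C) (c N * e).
  have h2 := ler_normD (A - B) C.
  have h3 := ler_normB A B.
  rewrite (mulrDr lam (\sum_(_ < _) _)) (mulrDr (lam * _) (\sum_(_ < _) _)).
  rewrite (mulrDr e (\sum_(_ < _) _)) -/B -/C (mulrC e (c N)).
  rewrite hD in h1; rewrite hC in h2; rewrite hB in h3.
  lra.
apply: (le_trans main).
(* The errors e c n add up to at most a constant times e / th, which is small
   because e is of order th (th + (1 - gb)). *)
have sc : (1 - expR (- th)) * \sum_(n < N) c n = 1 - c N.
  elim: N {main} => [|N IH].
    by rewrite big_ord0 mulr0 /c mulr0 oppr0 expR0 subrr.
  by rewrite big_ord_recr /= mulrDr IH cS; ring.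
have s0 : 0 <= \sum_(n < N) c n by apply: sumr_ge0.
have cN0 := c0 N.
have hs : th * \sum_(n < N) c n <= 2.
  have : (1 - expR (- th)) * \sum_(n < N) c n >= th / 2 * \sum_(n < N) c n.
    apply: ler_wpM2r => //.
    have : 0 <= th * (1 - 2 * th) by rewrite mulr_ge0 ?(ltW th0) //; lra.
    move: eth; rewrite expr2; lra.
  rewrite sc; lra.
have t1 : lam * (\sum_(n < N) (z n - g * a n)) <= lam * rho by rewrite ler_pM2l.
have t2 : lam * (g / gb) * (\sum_(n < N) (b n - gb * a n)) <= 2 * (lam * rho).
  have rho0 : 0 <= rho by have := sb 0%N; rewrite big_ord0.
  have gg0 : 0 <= g / gb by rewrite divr_ge0 // ltW.
  have gg1 : g / gb <= 2 by rewrite ler_pdivrMr //; lra.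
  rewrite -mulrA mulrCA; apply: (@le_trans _ _ (g / gb * (lam * rho))).
    by apply: ler_wpM2l => //; rewrite ler_pM2l.
  apply: ler_wpM2r => //; by rewrite mulr_ge0 // ltW.
have t3 : e * \sum_(n < N) c n <= 2 * th + 4 * (1 - gb).
  apply: (@le_trans _ _ ((th ^+ 2 + 2 * th * (1 - gb)) * \sum_(n < N) c n)).
    by apply: ler_wpM2r.
  have -> : (th ^+ 2 + 2 * th * (1 - gb)) * \sum_(n < N) c n =
    (th + 2 * (1 - gb)) * (th * \sum_(n < N) c n) by ring.
  have : (th + 2 * (1 - gb)) * (th * \sum_(n < N) c n) <= (th + 2 * (1 - gb)) * 2.
    apply: ler_wpM2l => //; lra.
  lra.
lra.
Qed.

Lemma sum_nonincr_lb (R : realType) (y : nat -> R) (m L : nat) :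
  (forall n, y n.+1 <= y n) ->
  \sum_(n < m + L) y n - \sum_(n < m) y n <= L%:R * y m.
Proof.
move=> yd; have yd' i : y (m + i)%N <= y m.
  elim: i => [|i IH]; first by rewrite addn0.
  by rewrite addnS; apply: le_trans IH.
elim: L => [|L IH]; first by rewrite addn0 subrr mul0r.
rewrite addnS big_ord_recr /= -natr1 mulrDl mul1r.
have := yd' L; lra.
Qed.

Lemma sum_nonincr_ub (R : realType) (y : nat -> R) (m L : nat) :
  (forall n, y n.+1 <= y n) ->
  L%:R * y (m + L).-1 <= \sum_(n < m + L) y n - \sum_(n < m) y n.
Proof.
move=> yd; elim: L => [|L IH]; first by rewrite addn0 subrr mul0r.
rewrite addnS big_ord_recr /= -natr1 mulrDl mul1r.
have h1 : y (m + L)%N <= y (m + L).-1 by case: (m + L)%N.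
have h2 : L%:R * y (m + L)%N <= L%:R * y (m + L).-1 by apply: ler_wpM2l.
lra.
Qed.

(** The tail [y n] = P(H > n.+1) of a positive integer time H of mean [M] is
    compared with the exponential law of rate [th]; then H > t M means
    H > m.+1 with m.+1 the integer part of t M. *)
Definition tail_modulus (R : realType) (t eps del : R) : Prop :=
  forall (y : nat -> R) (th M : R) (m : nat),
  0 < th <= del -> (forall n, y n.+1 <= y n) ->
  (forall N, `|th * \sum_(n < N) y n - (1 - expR (- (th * N%:R)))| <= del) ->
  `|th * M - 1| <= del ->
  m.+1%:R <= t * M -> t * M < m.+2%:R ->
  `|y m - expR (- t)| <= eps.

Lemma tail_modulus_le (R : realType) (t eps del del' : R) : del' <= del ->
  tail_modulus t eps del -> tail_modulus t eps del'.
Proof.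
move=> dd mod y th M m /andP[th0 th1] yd yS yM.
apply: (mod y th M m) => //; first by rewrite th0 (le_trans th1 dd).
  by move=> N; exact: le_trans (yS N) dd.
exact: le_trans yM dd.
Qed.

(** A nonincreasing sequence is squeezed between its averages over the windows
    of length [L] before and after [m], which the partial sums determine.  With
    th L of the order of [eta], the window is long enough for the error [del]
    of the partial sums, at most [eta ^+ 2], to be negligible, and short enough
    for the exponential to be nearly constant over it. *)
Lemma tail_of_partial_sums (R : realType) (t eps : R) : 0 < t -> 0 < eps ->
  exists2 del : R, 0 < del & tail_modulus t eps del.
Proof.
move=> t0 eps0.
pose eta := Num.min (Num.min (eps / 16) (t / 8)) 4^-1.
have eta0 : 0 < eta by rewrite !lt_min; lra.
have [e1 e2 e3] : [/\ eta <= eps / 16, eta <= t / 8 & eta <= 4^-1].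
  by rewrite /eta !ge_min !lexx ?orbT.
pose del := Num.min (Num.min (eta ^+ 2) (eps / (16 * (t + 1)))) (eta / 2).
have sq0 : 0 < eta ^+ 2 by rewrite exprn_gt0.
have t16 : 0 < 16 * (t + 1) by lra.
have e16 : 0 < eps / (16 * (t + 1)) by rewrite divr_gt0.
have del0 : 0 < del by rewrite !lt_min sq0 e16; lra.
have [d1 d2 d3] : [/\ del <= eta ^+ 2, del <= eps / (16 * (t + 1)) & del <= eta / 2].
  by rewrite /del !ge_min !lexx ?orbT.
rewrite ler_pdivlMr // in d2.
clearbody del eta.
exists del => // y th M m /andP[th0 thd] yd hS hM m1 m2.
rewrite ler_norml in hM; case/andP: hM => hM1 hM2.
have thm1 : th * m%:R <= t + t * del.
  apply: (@le_trans _ _ (th * (t * M))).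
    rewrite ler_pM2l //; apply: le_trans m1; by rewrite ler_nat.
  have : t * (th * M - 1) <= t * del by rewrite ler_pM2l //; lra.
  lra.
have thm2 : t - t * del <= th * m%:R + 2 * del.
  have : th * (t * M) <= th * m.+2%:R by rewrite ler_pM2l // ltW.
  rewrite mulrCA -addn2 natrD mulrDr => h.
  have : t * (th * M) >= t * (1 - del) by rewrite ler_pM2l //; lra.
  lra.
have lip : `|expR (- (th * m%:R)) - expR (- t)| <= t * del + 2 * del.
  apply: (le_trans (expRN_lip _ _)); [by rewrite mulr_ge0 // ltW|exact: ltW|].
  have td0 : 0 <= t * del by rewrite mulr_ge0 // ltW.
  rewrite ler_norml; apply/andP; split; lra.
pose L := (Num.truncn (eta / th)).+1.
have [L1 L2] : eta <= th * L%:R /\ th * L%:R <= 2 * eta.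
  have et0 : 0 <= eta / th by rewrite divr_ge0 // ltW.
  have /andP[a1 a2] := truncn_itv et0.
  rewrite ler_pdivlMr // in a1; rewrite ltr_pdivrMr // in a2.
  rewrite /L; split; first by rewrite mulrC ltW.
  rewrite -natr1 mulrDr mulr1; lra.
have LE : (L <= m.+1)%N.
  rewrite -(ler_nat R) -(ler_pM2l th0) -natr1 mulrDr mulr1.
  apply: (le_trans L2).
  have : t * del <= t / 8 by rewrite ler_pM2l //; lra.
  lra.
clearbody L; set x := th * L%:R in L1 L2.
have em1 : expR (- (th * m%:R)) <= 1 by rewrite -[leRHS]expR0 ler_expR oppr_le0 mulr_ge0 // ltW.
have em0 := expR_gt0 (- (th * m%:R)).
have x0 : 0 < x by lra.
have dx : del <= x * eta.
  by apply: (le_trans d1); rewrite expr2 ler_pM2r.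
(* The window that ends at m bounds y m above, the one that starts there bounds
   it below. *)
have up : y m <= expR (- (th * m%:R)) + 8 * eta.
  have h3 := sum_nonincr_ub (m.+1 - L) L yd; rewrite subnK //= in h3.
  have := hS m.+1; have := hS (m.+1 - L)%N; rewrite !ler_norml => /andP[q1 q2] /andP[q3 q4].
  have q5 : x * y m <= expR (- (th * (m.+1 - L)%:R)) - expR (- (th * m.+1%:R)) + 2 * del.
    have : th * (L%:R * y m) <= th * (\sum_(n < m.+1) y n - \sum_(n < m.+1 - L) y n) by rewrite ler_pM2l.
    rewrite mulrA -/x mulrBr; lra.
  have q6 : expR (- (th * (m.+1 - L)%:R)) = expR (- (th * m.+1%:R)) * expR x.
    by rewrite -expRD natrB //; congr expR; rewrite /x; ring.
  have q7 : expR x <= 1 + x + 2 * x ^+ 2 by apply: expR_le_quad; lra.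
  have q8 : expR (- (th * m.+1%:R)) <= expR (- (th * m%:R)).
    by rewrite ler_expR lerN2 ler_pM2l // ler_nat.
  rewrite q6 in q5.
  have q9 : expR (- (th * m.+1%:R)) * (expR x - 1) <= expR (- (th * m%:R)) * (x + 2 * x ^+ 2).
    apply: ler_pM; rewrite ?expR_ge0 //; last by lra.
    by rewrite subr_ge0 -expR0 ler_expR ltW.
  have q10 : x * y m <= x * (expR (- (th * m%:R)) + 8 * eta).
    have q11 : x * (x * expR (- (th * m%:R))) <= x * (2 * eta).
      rewrite ler_pM2l //; apply: le_trans L2; exact: ler_piMr (ltW x0) em1.
    rewrite expr2 in q9; lra.
  by rewrite ler_pM2l in q10.
have lo : expR (- (th * m%:R)) - 8 * eta <= y m.
  have h3 := sum_nonincr_lb m L yd.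
  have := hS m; have := hS (m + L)%N; rewrite !ler_norml => /andP[q1 q2] /andP[q3 q4].
  have q5 : expR (- (th * m%:R)) - expR (- (th * (m + L)%:R)) - 2 * del <= x * y m.
    have : th * (\sum_(n < m + L) y n - \sum_(n < m) y n) <= th * (L%:R * y m) by rewrite ler_pM2l.
    rewrite mulrA -/x mulrBr; lra.
  have q6 : expR (- (th * (m + L)%:R)) = expR (- (th * m%:R)) * expR (- x).
    by rewrite -expRD natrD; congr expR; rewrite /x; ring.
  have q7 := expRN_le_quad (ltW x0).
  rewrite q6 in q5.
  have q10 : x * (expR (- (th * m%:R)) - 8 * eta) <= x * y m.
    have q11 : x * (x * expR (- (th * m%:R))) <= x * (2 * eta).
      rewrite ler_pM2l //; apply: le_trans L2; exact: ler_piMr (ltW x0) em1.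
    have q12 : expR (- (th * m%:R)) * expR (- x) <= expR (- (th * m%:R)) * (1 - x + x ^+ 2).
      by rewrite ler_pM2l.
    rewrite expr2 in q12; lra.
  by rewrite ler_pM2l in q10.
rewrite ler_norml in lip; case/andP: lip => l1 l2.
have d4 : t * del + 2 * del <= eps / 4 by lra.
rewrite ler_norml; apply/andP; split; lra.
Qed.

(** * Real-valued probabilities *)

Section RealProbability.
Variables (d : measure_display) (T : measurableType d) (R : realType) (P : probability T R).
Implicit Types A B : set T.

Definition pr A : R := fine (P A).

Lemma prE A : measurable A -> P A = (pr A)%:E.
Proof. by move=> mA; rewrite /pr fineK // fin_num_measure. Qed.

Lemma pr_ge0 A : 0 <= pr A.
Proof. by rewrite /pr fine_ge0. Qed.

Lemma pr_le A B : measurable A -> measurable B -> A `<=` B -> pr A <= pr B.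
Proof. by move=> mA mB AB; rewrite -lee_fin -!prE // le_measure ?inE. Qed.

Lemma prT : pr setT = 1.
Proof. by rewrite /pr probability_setT. Qed.

Lemma pr_le1 A : measurable A -> pr A <= 1.
Proof. by move=> mA; rewrite -prT; apply: pr_le. Qed.

Lemma pr_set0 : pr set0 = 0.
Proof. by rewrite /pr measure0. Qed.

Lemma pr_split A B : measurable A -> measurable B ->
  pr A = pr (A `&` B) + pr (A `&` ~` B).
Proof.
move=> mA mB; have mI := measurableI _ _ mA mB; have mC := measurableI _ _ mA (measurableC mB).
apply: EFin_inj; rewrite EFinD -!prE //.
by rewrite -setDE addeC; exact: measureDI.
Qed.

Lemma prU_le A B : measurable A -> measurable B -> pr (A `|` B) <= pr A + pr B.
Proof.
move=> mA mB; have mU := measurableU _ _ mA mB; rewrite (pr_split mU mA); apply: lerD.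
  exact: pr_le (measurableI _ _ mU mA) mA (@subIsetr _ _ _).
by apply: pr_le (measurableI _ _ mU (measurableC mA)) mB _ => x [[]].
Qed.

Lemma prIr A B : measurable A -> measurable B -> pr B = 1 -> pr (A `&` B) = pr A.
Proof.
move=> mA mB B1; rewrite [RHS](pr_split mA mB).
suff -> : pr (A `&` ~` B) = 0 by rewrite addr0.
have := pr_split measurableT mB; rewrite prT !setTI B1 => /eqP.
rewrite -subr_eq0 opprD addrA subrr add0r oppr_eq0 => /eqP h.
have mC := measurableC mB.
apply/eqP; rewrite eq_le pr_ge0 andbT -h.
exact: pr_le (measurableI _ _ mA mC) mC (@subIsetr _ _ _).
Qed.

Lemma pr_bigcup_le (F : nat -> set T) c : (forall n, measurable (F n)) ->
  (forall n, \sum_(i < n) pr (F i) <= c) -> pr (\bigcup_n F n) <= c.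
Proof.
move=> mF Fc; have mU := bigcup_measurable (fun k (_ : setT k) => mF k).
rewrite -lee_fin -prE //.
apply: le_trans (generalized_Boole_inequality P mF mU) _.
apply: lime_le; first exact: is_cvg_nneseries.
apply: nearW => n; rewrite big_mkord.
have -> : (\sum_(i < n) P (F i) = (\sum_(i < n) pr (F i))%:E)%E.
  by rewrite -sumEFin; apply: eq_bigr => i _; rewrite prE.
by rewrite lee_fin.
Qed.

Lemma pr_bigsetU_le (I : Type) (r : seq I) (F : I -> set T) :
  (forall i, measurable (F i)) -> pr (\big[setU/set0]_(i <- r) F i) <= \sum_(i <- r) pr (F i).
Proof.
move=> mF; elim: r => [|i r IH]; first by rewrite !big_nil pr_set0.
rewrite !big_cons; apply: (le_trans (prU_le (mF i) _)); last by rewrite lerD2l.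
exact: bigsetU_measurable.
Qed.

Lemma pr_fibers (I : eqType) (f : T -> I) (r : seq I) A : uniq r -> measurable A ->
  (forall b, measurable [set x | f x = b]) ->
  pr (A `&` [set x | f x \in r]) = \sum_(b <- r) pr (A `&` [set x | f x = b]).
Proof.
move=> + mA mf; have consE b l : [set x | f x \in b :: l] = [set x | f x = b] `|` [set x | f x \in l].
  apply/seteqP; split => x /=; rewrite in_cons; first by case/orP => [/eqP|]; [left|right].
  by case=> [->|->]; rewrite ?eqxx ?orbT.
have mr (l : seq I) : measurable [set x | f x \in l].
  elim: l => [|b l IH]; first by rewrite (_ : [set _ | _] = set0) // -subset0 => x.
  by rewrite consE; exact: measurableU.
elim: r => [|b r IH] /=.
  by move=> _; rewrite big_nil (_ : _ `&` _ = set0) ?pr_set0 // -subset0 => x [].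
move=> /andP[br ur]; rewrite big_cons -IH // (@pr_split _ [set x | f x = b]) //; last first.
  exact: measurableI.
congr (pr _ + pr _); apply/seteqP; split => x /=.
- by case=> [[? _] ?].
- by case=> [? ->]; rewrite in_cons eqxx.
- by case=> [[? h] /eqP/negbTE n]; move: h; rewrite in_cons n.
- by case=> [? h]; rewrite in_cons h orbT; split=> // e; rewrite e (negbTE br) in h.
Qed.

Lemma pr_bigcup_ge (F : nat -> set T) n : (forall k, measurable (F k)) ->
  trivIset setT F -> \sum_(i < n) pr (F i) <= pr (\bigcup_k F k).
Proof.
move=> mF tF; have mU := bigcup_measurable (fun k (_ : setT k) => mF k).
rewrite -lee_fin -(prE mU) measure_semi_bigcup //.
apply: le_trans (nneseries_lim_ge n _) => //.
rewrite big_mkord -sumEFin le_eqVlt; apply/orP; left; apply/eqP.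
by apply: eq_bigr => i _; rewrite -prE.
Qed.

End RealProbability.

Lemma nneseries_bounded (R : realType) (f : nat -> R) (B : R) :
  (forall n, 0 <= f n) -> (forall N, \sum_(n < N) f n <= B) ->
  exists M : R, [/\ (\sum_(0 <= n <oo) (f n)%:E = M%:E)%E,
    forall N, \sum_(n < N) f n <= M &
    forall c, (forall N, \sum_(n < N) f n <= c) -> M <= c].
Proof.
move=> f0 fB; have f0' n : (0 <= n)%N -> true -> (0 <= (f n)%:E)%E by rewrite lee_fin.
have ps N : (\sum_(0 <= n < N) (f n)%:E = (\sum_(n < N) f n)%:E)%E.
  by rewrite big_mkord sumEFin.
have up c : (forall N, \sum_(n < N) f n <= c) -> (\sum_(0 <= n <oo) (f n)%:E <= c%:E)%E.
  move=> fc; apply: lime_le; first by apply: is_cvg_nneseries => n _ _; rewrite lee_fin.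
  by apply: nearW => N; rewrite ps lee_fin.
have fin : (\sum_(0 <= n <oo) (f n)%:E)%E \is a fin_num.
  rewrite ge0_fin_numE; first exact: le_lt_trans (up _ fB) (ltry _).
  by apply: nneseries_ge0 => n _ _; rewrite lee_fin.
exists (fine (\sum_(0 <= n <oo) (f n)%:E)%E); split; first by rewrite fineK.
- by move=> N; rewrite -lee_fin fineK // -ps; exact: nneseries_lim_ge.
- by move=> c fc; rewrite -lee_fin fineK // up.
Qed.

(** Countable subadditivity on one side and superadditivity over disjoint
    events on the other; this is the step for disjoint unions in Dynkin
    inductions. *)
Lemma pr_bigcup_scale (d1 d2 : measure_display) (T1 : measurableType d1) (T2 : measurableType d2)
  (R : realType) (P1 : probability T1 R) (P2 : probability T2 R)
  (F : nat -> set T1) (G : nat -> set T2) (c : R) : 0 <= c ->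
  (forall n, measurable (F n)) -> (forall n, measurable (G n)) ->
  trivIset setT F -> trivIset setT G ->
  (forall n, pr P1 (F n) = c * pr P2 (G n)) ->
  pr P1 (\bigcup_n F n) = c * pr P2 (\bigcup_n G n).
Proof.
move=> c0 mF mG tF tG FG; apply/eqP; rewrite eq_le; apply/andP; split.
  apply: pr_bigcup_le => // n; rewrite (eq_bigr (fun i : 'I_n => c * pr P2 (G i))) //.
  by rewrite -mulr_sumr ler_wpM2l // pr_bigcup_ge.
have [->|cn] := eqVneq c 0; first by rewrite mul0r pr_ge0.
have cp : 0 < c by rewrite lt_neqAle eq_sym cn.
rewrite -ler_pdivlMl //; apply: pr_bigcup_le => // n; rewrite ler_pdivlMl // mulr_sumr.
rewrite (eq_bigr (fun i : 'I_n => pr P1 (F i))); last by move=> i _; rewrite FG.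
exact: pr_bigcup_ge.
Qed.

(** * Potential theory of the walk on a finite tree *)

Lemma sumr_D1 (V : nmodType) (I : eqType) (r : seq I) (P : pred I) (F : I -> V) a :
  uniq r -> a \in r -> P a ->
  \sum_(i <- r | P i) F i = F a + \sum_(i <- r | P i && (i != a)) F i.
Proof.
move=> ur ar Pa; rewrite big_mkcond (bigD1_seq a) //= Pa; congr (_ + _).
rewrite [RHS]big_mkcond [LHS]big_mkcond; apply: eq_bigr => i _ /=.
by case: (P i); case: (i == a).
Qed.

Lemma sumr_only (V : nmodType) (I : eqType) (r : seq I) (P : pred I) (F : I -> V) a :
  uniq r -> a \in r -> (forall i, i \in r -> P i = (i == a)) ->
  \sum_(i <- r | P i) F i = F a.
Proof.
move=> ur ar Pa; rewrite (sumr_D1 F ur ar) ?Pa ?eqxx //.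
rewrite big_seq_cond big1 ?addr0 // => i /andP[ir]; rewrite Pa //.
by case: eqP.
Qed.

Section FiniteTree.
Variables (R : realType) (w : wtree R) (s : seq vertex) (q : R).
Hypothesis us : uniq s.
Hypothesis sphi : phi \in s.
Hypothesis sparent : forall u j, rcons u j \in s -> u \in s.
Hypothesis sP : forall v, tree w v <-> v \in s.
Hypothesis q1 : 1 < q.
Hypothesis bq : forall v, v \in s -> v != phi -> q <= bias w v.

Local Notation om := (vertex_weight w).
Definition kid (x y : vertex) := (y != phi) && (parent y == x).

Lemma parent_rcons (u : vertex) j : parent (rcons u j) = u.
Proof. by rewrite /parent size_rcons /= -cats1 take_size_cat. Qed.

Lemma prefix_rconsE (z u : vertex) j :
  prefix z (rcons u j) = prefix z u || (z == rcons u j).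
Proof.
apply/idP/orP => [/prefixP[t]|].
  case: (lastP t) => [|t' j'].
    by rewrite cats0 => ->; right.
  rewrite -rcons_cat => /rcons_inj[-> _]; left; exact: prefix_prefix.
case=> [|/eqP ->]; last exact: prefix_refl.
move=> zu; apply: (prefix_trans zu); exact: prefix_rcons.
Qed.

Lemma kid_rcons x u j : kid x (rcons u j) = (u == x).
Proof. by rewrite /kid parent_rcons; case: u. Qed.

Lemma kidP x y : reflect (exists j, y = rcons x j) (kid x y).
Proof.
apply: (iffP idP) => [|[j ->]]; last by rewrite kid_rcons.
by case: (lastP y) => [//|u j]; rewrite kid_rcons => /eqP <-; exists j.
Qed.

Lemma prefix_mem z x : prefix z x -> x \in s -> z \in s.
Proof.
elim/last_ind: x z => [|x j IH] z; first by rewrite prefixs0 => /eqP ->.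
rewrite prefix_rconsE => /orP[zx|/eqP -> //] xs.
by apply: (IH _ zx); apply: sparent xs.
Qed.

Lemma kid_prefix_take x v : prefix x v -> x != v ->
  kid x (take (size x).+1 v) /\ prefix (take (size x).+1 v) v.
Proof.
move=> /prefixP[[|a t] ->]; first by rewrite cats0 eqxx.
move=> _; have -> : take (size x).+1 (x ++ a :: t) = rcons x a.
  by rewrite take_cat ltnNge leqnSn /= subSnn /= take0 cats1.
split; first by rewrite kid_rcons.
by rewrite -cat_rcons prefix_prefix.
Qed.

Lemma kid_prefix_uniq x y v : kid x y -> prefix y v ->
  [/\ prefix x v, x != v & y = take (size x).+1 v].
Proof.
move=> /kidP[a ->] /prefixP[t ->]; rewrite cat_rcons; split.
- exact: prefix_prefix.
- by apply/eqP => /(congr1 size); rewrite size_cat /=; lia.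
- by rewrite take_cat ltnNge leqnSn /= subSnn /= take0 cats1.
Qed.

Lemma sum_subtree (F : vertex -> R) x : x \in s ->
  \sum_(v <- s | prefix x v) F v =
  F x + \sum_(y <- s | kid x y) \sum_(v <- s | prefix y v) F v.
Proof.
move=> xs; rewrite (sumr_D1 _ us xs) ?prefix_refl //; congr +%R.
transitivity (\sum_(y <- s) \sum_(v <- s) if kid x y && prefix y v then F v else 0); last first.
  rewrite [RHS]big_mkcond; apply: eq_bigr => y _.
  by case: (kid x y) => /=; [rewrite -big_mkcond|rewrite big1].
rewrite exchange_big /= big_mkcond [LHS]big_seq [RHS]big_seq; apply: eq_bigr => v vs.
rewrite -big_mkcond /=; case: ifPn => [/andP[xv vx]|nv].
  rewrite eq_sym in vx; have [k1 k2] := kid_prefix_take xv vx.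
  rewrite (sumr_only (fun=> F v) us (prefix_mem k2 vs)) // => y _.
  apply/andP/eqP => [[h1 h2]|->//]; by have [] := kid_prefix_uniq h1 h2.
rewrite big1 // => y /andP[h1 h2]; have [h3 h4 _] := kid_prefix_uniq h1 h2.
by rewrite h3 eq_sym h4 in nv.
Qed.

Lemma kid_sub z x y : prefix z x -> kid x y -> prefix z y.
Proof. by move=> zx /kidP[j ->]; rewrite prefix_rconsE zx. Qed.

(** Each vertex above [z] is the kid of its parent only. *)
Lemma sum_kids_subtree (F : vertex -> vertex -> R) z : z \in s ->
  \sum_(x <- s | prefix z x) \sum_(y <- s | kid x y) F x y =
  \sum_(y <- s | prefix z y && (y != z)) F (parent y) y.
Proof.
move=> zs.
transitivity (\sum_(x <- s) \sum_(y <- s) if prefix z x && kid x y then F x y else 0).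
  rewrite [LHS]big_mkcond; apply: eq_bigr => x _.
  by case: (prefix z x) => /=; [rewrite -big_mkcond|rewrite big1].
rewrite exchange_big /= [RHS]big_mkcond /= [LHS]big_seq [RHS]big_seq; apply: eq_bigr => y ys.
rewrite -big_mkcond /=; case: ifPn => [/andP[]|nv].
  case: (lastP y) ys => [|u j] ys; first by rewrite prefixs0 => /eqP ->; rewrite eqxx.
  rewrite prefix_rconsE => /orP[zu|/eqP ->]; last by rewrite eqxx.
  move=> _; rewrite parent_rcons (sumr_only (F^~ _) us (sparent ys)) // => x _.
  rewrite kid_rcons (eq_sym u); case: eqP => [->|]; by rewrite ?zu ?andbF.
rewrite big1 // => x /andP[h1 h2].
have h3 := kid_sub h1 h2; rewrite h3 /= negbK in nv.
move/eqP: nv => yz; rewrite yz in h2; case/kidP: h2 => j zj.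
by have := size_prefix h1; rewrite zj size_rcons ltnn.
Qed.

Lemma om_phi : om phi = 1.
Proof. by rewrite /vertex_weight big_ord0. Qed.

Lemma om_rcons u j : om (rcons u j) = om u * bias w (rcons u j).
Proof.
rewrite /vertex_weight size_rcons big_ord_recr /=; congr (_ * bias w _).
  apply: eq_bigr => i _; rewrite -cats1 takel_cat //.
by rewrite take_oversize // size_rcons.
Qed.

Lemma om_gt0 x : x \in s -> 0 < om x.
Proof.
elim/last_ind: x => [|x j IH] xs; first by rewrite om_phi.
rewrite om_rcons mulr_gt0 ?IH ?(sparent xs) //.
have rp : rcons x j != phi by case: (x).
by apply: lt_le_trans (bq xs rp); exact: lt_trans ltr01 q1.
Qed.

Lemma om_kid x y : kid x y -> om y = om x * bias w y.
Proof. by case/kidP => j ->; exact: om_rcons. Qed.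

Lemma om_kid_ge x y : y \in s -> kid x y -> q * om x <= om y.
Proof.
move=> ys k; rewrite (om_kid k) mulrC; case/kidP: k => j e; rewrite e in ys *.
by rewrite ler_pM2l ?om_gt0 ?(sparent ys) // bq //; case: (x).
Qed.

(** The reversible measure of the walk: the sum of the conductances of the
    edges at [x], where the edge below a vertex has conductance the weight of
    the vertex. *)
Definition stationary (x : vertex) := (x != phi)%:R * om x + \sum_(y <- s | kid x y) om y.

Lemma stationary_ge0 x : x \in s -> 0 <= stationary x.
Proof.
move=> xs; rewrite addr_ge0 ?mulr_ge0 ?(ltW (om_gt0 xs)) // big_seq_cond sumr_ge0 // => y /andP[ys _].
exact/ltW/om_gt0.
Qed.

Lemma stationary_ge_om x : x \in s -> x != phi -> om x <= stationary x.
Proof.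
move=> xs xp; rewrite /stationary xp mul1r lerDl big_seq_cond sumr_ge0 // => y /andP[ys _].
exact/ltW/om_gt0.
Qed.

Lemma stationary_gt0 x : x \in s -> x != phi -> 0 < stationary x.
Proof. by move=> xs xp; apply: lt_le_trans (stationary_ge_om xs xp); exact: om_gt0. Qed.

(** Sums over the letters that extend [x] inside the tree, as in [step_norm],
    become sums over the kids of [x] in the list of vertices. *)
Lemma sum_letters (F : vertex -> R) x :
  \sum_(j \in [set j | tree w (rcons x j)]) F (rcons x j) = \sum_(y <- s | kid x y) F y.
Proof.
rewrite -[RHS]big_filter.
have -> : [set j | tree w (rcons x j)] = [set` map (last 0%N) [seq y <- s | kid x y]].
  apply/seteqP; split => [j /= /sP tj|j /= /mapP[y]].
    apply/mapP; exists (rcons x j); last by rewrite last_rcons.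
    by rewrite mem_filter kid_rcons eqxx tj.
  rewrite mem_filter => /andP[/kidP[i ->] ys ->]; rewrite last_rcons; exact/sP.
rewrite -fsbig_seq; last first.
  rewrite map_inj_in_uniq ?filter_uniq // => y1 y2.
  by rewrite !mem_filter => /andP[/kidP[i ->] _] /andP[/kidP[j ->] _]; rewrite !last_rcons => ->.
rewrite big_map big_seq [RHS]big_seq; apply: eq_bigr => y.
by rewrite mem_filter => /andP[/kidP[i ->] _]; rewrite last_rcons.
Qed.

Lemma stationary_step_norm x : x \in s -> stationary x = om x * step_norm w x.
Proof.
move=> xs; rewrite /step_norm (sum_letters (bias w)) mulrDr /stationary mulrC; congr (_ + _).
by rewrite mulr_sumr; apply: eq_bigr => y /om_kid.
Qed.

Lemma step_norm_gt0 x : x \in s -> 0 < stationary x -> 0 < step_norm w x.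
Proof. by move=> xs; rewrite stationary_step_norm // pmulr_rgt0 // om_gt0. Qed.

Lemma kid_neq_parent x y : kid x y -> x != phi -> y == parent x = false.
Proof.
move=> /kidP[j ->] _; apply/eqP => /(congr1 size).
rewrite size_rcons /parent size_take; case: ifP; lia.
Qed.

Lemma step_ge0 x y : x \in s -> 0 <= step w x y.
Proof.
move=> xs; have h : 0 <= step_norm w x.
  by have := stationary_ge0 xs; rewrite stationary_step_norm // pmulr_rge0 // om_gt0.
rewrite /step; case: ifPn => [/andP[/andP[ys yp] _]|_].
  have ys' : y \in s by apply/sP; rewrite inE in ys.
  by rewrite divr_ge0 //; apply: le_trans (bq ys' yp); exact/ltW/(lt_trans ltr01 q1).
by case: ifPn => // _; rewrite invr_ge0.
Qed.

(** Detailed balance: both sides are the conductance of the edge. *)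
Lemma stationary_step x y : x \in s -> y \in s -> 0 < stationary x ->
  stationary x * step w x y = (kid x y)%:R * om y + ((x != phi) && (y == parent x))%:R * om x.
Proof.
move=> xs ys px; have sn := step_norm_gt0 xs px; rewrite stationary_step_norm // /step.
have -> : y \in tree w by rewrite inE; exact/sP.
rewrite andTb -/(kid x y); case: (boolP (kid x y)) => [k|nk].
  have -> : (x != phi) && (y == parent x) = false.
    by case: (boolP (x == phi)) => //= xp; rewrite (kid_neq_parent k xp).
  by rewrite (om_kid k) mul1r mul0r addr0 -mulrA; congr (_ * _); rewrite mulrC divfK ?gt_eqF.
rewrite mul0r add0r; case: ifP => _; last by rewrite mulr0 mul0r.
by rewrite mulfK ?gt_eqF // mul1r.
Qed.

(** The transition operator of the walk. *)
Definition avg (f : vertex -> R) (x : vertex) := \sum_(y <- s) step w x y * f y.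

Lemma parent_mem x : x \in s -> parent x \in s.
Proof.
by case: (lastP x) => [//|u j] ujs; rewrite parent_rcons; exact: sparent ujs.
Qed.

Lemma stationary_avg f x : x \in s -> 0 < stationary x ->
  stationary x * avg f x = \sum_(y <- s | kid x y) om y * f y + (x != phi)%:R * (om x * f (parent x)).
Proof.
move=> xs px; rewrite /avg mulr_sumr big_seq.
under eq_bigr => y ys do rewrite mulrA (stationary_step xs ys px) mulrDl.
rewrite big_split /= -!big_seq; congr (_ + _).
  by rewrite [RHS]big_mkcond; apply: eq_bigr => y _; case: (kid x y); rewrite ?mul1r ?mul0r.
case: (boolP (x == phi)) => xp /=; last first.
  rewrite mul1r (bigD1_seq (parent x)) ?parent_mem //= eqxx mul1r big1 ?addr0 // => y /negbTE ->.
  by rewrite !mul0r.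
by rewrite big1 ?mul0r // => y _; rewrite !mul0r.
Qed.

Lemma avg1 x : x \in s -> 0 < stationary x -> avg (fun=> 1) x = 1.
Proof.
move=> xs px; apply: (mulfI (lt0r_neq0 px)); rewrite stationary_avg // [RHS]mulr1 /stationary.
under eq_bigr do rewrite mulr1.
by rewrite mulr1 addrC.
Qed.

Lemma avg_le f g x : x \in s -> (forall y, y \in s -> f y <= g y) -> avg f x <= avg g x.
Proof.
move=> xs fg; rewrite /avg big_seq [leRHS]big_seq; apply: ler_sum => y ys.
by apply: ler_wpM2l; [exact: step_ge0|exact: fg].
Qed.

Lemma avg_lin (c d : R) f g x : avg (fun y => c * f y + d * g y) x = c * avg f x + d * avg g x.
Proof. by rewrite /avg !mulr_sumr -big_split /=; apply: eq_bigr => y _; ring. Qed.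

Lemma avg_sum (F : nat -> vertex -> R) N x :
  avg (fun y => \sum_(n < N) F n y) x = \sum_(n < N) avg (F n) x.
Proof. by rewrite /avg exchange_big /=; apply: eq_bigr => y _; rewrite mulr_sumr. Qed.

Lemma eq_avg f g x : (forall y, y \in s -> f y = g y) -> avg f x = avg g x.
Proof. by move=> fg; rewrite /avg big_seq [RHS]big_seq; apply: eq_bigr => y /fg ->. Qed.

(** On a tree every function is determined by its value at the root and its
    increments [d] along the edges. Writing a function in this way turns a
    prescribed Laplacian into a prescribed balance of flows, which is solved
    edge by edge; see [climb_laplace]. *)
Definition climb (d : vertex -> R) x := \sum_(z <- s | (z != phi) && prefix z x) d z.

Lemma climb_rcons d u j : rcons u j \in s -> climb d (rcons u j) = d (rcons u j) + climb d u.
Proof.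
move=> ujs; rewrite /climb (sumr_D1 _ us ujs); last by rewrite prefix_refl; case: (u).
congr (_ + _); apply: eq_bigl => z; rewrite prefix_rconsE -andbA; congr (_ && _).
case: eqP => [->|_]; rewrite ?orbF ?andbT ?andbF //.
by apply/esym/negbTE/negP => /size_prefix; rewrite size_rcons ltnn.
Qed.

(** The Laplacian at [x] of a potential with increments [d] is the flow [om *
    d] that enters [x] from its parent minus what leaves [x] to its kids. *)
Lemma climb_laplace d c x : x \in s -> x != phi ->
  stationary x * (climb d x + c - avg (fun y => climb d y + c) x) =
  om x * d x - \sum_(y <- s | kid x y) om y * d y.
Proof.
move=> xs xp; rewrite mulrBr stationary_avg ?stationary_gt0 // xp mul1r.
have -> : climb d (parent x) = climb d x - d x.
  move: xp xs; case: (lastP x) => [//|u j] _ ujs.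
  by rewrite parent_rcons climb_rcons //; ring.
have -> : \sum_(y <- s | kid x y) om y * (climb d y + c) =
  \sum_(y <- s | kid x y) om y * d y + (climb d x + c) * \sum_(y <- s | kid x y) om y.
  rewrite mulr_sumr -big_split /= big_seq_cond [RHS]big_seq_cond.
  apply: eq_bigr => y /andP[ys /kidP[j e]]; rewrite e in ys *.
  by rewrite climb_rcons //; ring.
rewrite /stationary xp mul1r; ring.
Qed.

(** By reversibility the exchanges along the edges inside the subtree cancel,
    and only the edge below [z] is left. *)
Lemma subtree_stationary_avg f z : z \in s -> z != phi ->
  \sum_(x <- s | prefix z x) stationary x * avg f x =
  \sum_(x <- s | prefix z x) stationary x * f x - om z * f z + om z * f (parent z).
Proof.
move=> zs zp.
have nphi x : prefix z x -> x != phi by case: x => //; rewrite prefixs0 (negbTE zp).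
transitivity (\sum_(x <- s | prefix z x) (\sum_(y <- s | kid x y) om y * f y + om x * f (parent x))).
  rewrite big_seq_cond [RHS]big_seq_cond; apply: eq_bigr => x /andP[xs /nphi xp].
  by rewrite stationary_avg ?stationary_gt0 // xp mul1r.
rewrite big_split /= (sum_kids_subtree (fun _ y => om y * f y)) //.
rewrite [X in _ + X](sumr_D1 _ us zs) ?prefix_refl //.
rewrite -(sum_kids_subtree (fun x y => om y * f x)) //.
have -> : \sum_(x <- s | prefix z x) stationary x * f x = \sum_(x <- s | prefix z x) om x * f x
   + \sum_(x <- s | prefix z x) \sum_(y <- s | kid x y) om y * f x.
  rewrite -big_split /=; apply: eq_bigr => x /nphi xp.
  by rewrite /stationary xp mul1r mulrDl mulr_suml.
rewrite [X in _ = X + _ - _ + _](sumr_D1 _ us zs) ?prefix_refl //.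
ring.
Qed.

Definition mass (z : vertex) := \sum_(v <- s | prefix z v) stationary v.

Lemma mass_kids x : x \in s -> mass x - \sum_(y <- s | kid x y) mass y = stationary x.
Proof. by move=> xs; rewrite /mass sum_subtree // addrK. Qed.

(** Each edge inside the subtree has two ends there, the edge below [z] only
    one. *)
Lemma mass_weight z : z \in s -> z != phi ->
  mass z = 2 * (\sum_(v <- s | prefix z v) om v) - om z.
Proof.
move=> zs zp; have nphi x : prefix z x -> x != phi.
  by move=> zx; apply: contraTneq zx => ->; rewrite prefixs0.
rewrite /mass; transitivity (\sum_(v <- s | prefix z v) (om v + \sum_(y <- s | kid v y) om y)).
  by apply: eq_bigr => v /nphi vp; rewrite /stationary vp mul1r.
rewrite big_split /= (sum_kids_subtree (fun _ y => om y)) //.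
rewrite (sumr_D1 _ us zs) ?prefix_refl //; ring.
Qed.

(** The probability that the walk from [x] obeys the constraints [S] at its
    successive positions, [x] included; see [pr_obeys]. *)
Fixpoint stay (S : seq (pred vertex)) (x : vertex) : R :=
  if S is A :: S' then (A x)%:R * avg (stay S') x else 1.

Lemma stay_ge0 S x : x \in s -> 0 <= stay S x.
Proof.
elim: S x => [|A S IH] x xs //=; apply: mulr_ge0 => //.
by rewrite /avg big_seq; apply: sumr_ge0 => y ys; rewrite mulr_ge0 ?step_ge0 ?IH.
Qed.

Variable vb : vertex.
Hypothesis vbs : vb \in s.
Hypothesis vbp : vb != phi.

(** The first vertex after the root on the path to [vb]. *)
Definition top := take 1 vb.

Lemma vb_gt0 : (0 < size vb)%N. Proof. by case: (vb) vbp. Qed.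

Lemma size_top : size top = 1%N.
Proof. by rewrite /top size_takel // vb_gt0. Qed.

Lemma top_prefix z : z != phi -> prefix z vb -> prefix top z.
Proof.
move=> zp; rewrite !prefixE size_top => /eqP e; rewrite -{1}e take_takel //.
by case: (z) zp.
Qed.

Lemma top_mem : top \in s.
Proof. exact: prefix_mem (prefix_take _ _) vbs. Qed.

Lemma top_neq : top != phi.
Proof. by rewrite -size_eq0 size_top. Qed.

Lemma kid_top : kid phi top.
Proof. by rewrite /kid top_neq /parent size_top /= take0. Qed.

Lemma stationary_pos x : x \in s -> 0 < stationary x.
Proof.
move=> xs; have [->|xp] := eqVneq x phi; last exact: stationary_gt0.
rewrite /stationary eqxx mul0r add0r (sumr_D1 _ us top_mem kid_top).
rewrite ltr_wpDr ?om_gt0 ?top_mem // big_seq_cond sumr_ge0 // => y /andP[ys _].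
exact/ltW/om_gt0.
Qed.

Lemma avg_const x : x \in s -> avg (fun=> 1) x = 1.
Proof. by move=> xs; rewrite avg1 ?stationary_pos. Qed.

Lemma stay_le1 S x : x \in s -> stay S x <= 1.
Proof.
elim: S x => [|A S IH] x xs //=.
have : avg (stay S) x <= 1 by rewrite -(avg_const xs); apply: avg_le.
by case: (A x); rewrite ?mul1r ?mul0r.
Qed.

Definition off_root : pred vertex := fun x => x != phi.
Definition off_ends : pred vertex := fun x => (x != phi) && (x != vb).
(** [alive n x] is the probability that the walk from [x] avoids the root up to
    time [n], and [free n x] that it avoids both the root and [vb]. *)
Definition alive n := stay (nseq n.+1 off_root).
Definition free n := stay (nseq n.+1 off_ends).

Lemma alive0 x : x \in s -> alive 0 x = (x != phi)%:R.
Proof. by move=> xs; rewrite /alive /= avg_const // mulr1. Qed.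

Lemma aliveS n x : alive n.+1 x = (x != phi)%:R * avg (alive n) x.
Proof. by []. Qed.

Lemma free0 x : x \in s -> free 0 x = ((x != phi) && (x != vb))%:R.
Proof. by move=> xs; rewrite /free /= avg_const // mulr1. Qed.

Lemma freeS n x : free n.+1 x = ((x != phi) && (x != vb))%:R * avg (free n) x.
Proof. by []. Qed.

Lemma alive_phi n : alive n phi = 0.
Proof. by rewrite /alive /= mul0r. Qed.

Lemma alive_decr n x : x \in s -> alive n.+1 x <= alive n x.
Proof.
elim: n x => [|n IH] x xs.
  rewrite aliveS alive0 //; apply: ler_piMr => //.
  rewrite -(avg_const xs); apply: avg_le => // y ys; exact: stay_le1.
rewrite !aliveS; apply: ler_wpM2l => //; exact: avg_le.
Qed.

(** Increments of the potential of the unit flow along the path from the root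
    to [vb]: one over the conductance on the path, zero off it. The normalized
    potential [harm] is the probability of hitting [vb] before the root. *)
Definition onpath (z : vertex) : R := (prefix z vb)%:R / om z.
Definition resist := climb onpath vb.
Definition harm x := climb onpath x / resist.

Lemma onpath_ge0 z : z \in s -> 0 <= onpath z.
Proof. by move=> zs; rewrite divr_ge0 // ltW // om_gt0. Qed.

Lemma resist_ge : (om top)^-1 <= resist.
Proof.
rewrite /resist /climb (sumr_D1 _ us top_mem); last by rewrite top_neq prefix_take.
rewrite {1}/onpath prefix_take mul1r lerDl big_seq_cond sumr_ge0 // => z /andP[zs _].
exact: onpath_ge0.
Qed.

Lemma resist_gt0 : 0 < resist.
Proof. by apply: lt_le_trans resist_ge; rewrite invr_gt0 om_gt0 // top_mem. Qed.

Lemma harm_vb : harm vb = 1.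
Proof. by rewrite /harm divff // gt_eqF // resist_gt0. Qed.

Lemma climb_phi d : climb d phi = 0.
Proof. by rewrite /climb big1 // => z; case: z. Qed.

Lemma harm_phi : harm phi = 0.
Proof. by rewrite /harm climb_phi mul0r. Qed.

Lemma harm_ge0 x : x \in s -> 0 <= harm x.
Proof.
move=> xs; rewrite divr_ge0 ?(ltW resist_gt0) // /climb big_seq_cond sumr_ge0 // => z /andP[zs _].
exact: onpath_ge0.
Qed.

Lemma resist_split x :
  resist = climb onpath x + climb (fun z => (~~ prefix z x)%:R * onpath z) vb.
Proof.
rewrite /resist /climb big_mkcond [X in X + _]big_mkcond [X in _ + X]big_mkcond -big_split /=.
apply: eq_bigr => z _; rewrite /onpath; case: (z != phi) => /=; last by rewrite addr0.
by case: (prefix z x); case: (prefix z vb); rewrite /= ?mul0r ?mul1r ?addr0 ?add0r.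
Qed.

Lemma one_sub_harm x :
  1 - harm x = climb (fun z => (~~ prefix z x)%:R * onpath z) vb / resist.
Proof.
have -> : climb (fun z => (~~ prefix z x)%:R * onpath z) vb = resist - climb onpath x.
  by rewrite (resist_split x) addrAC subrr add0r.
by rewrite mulrBl divff // gt_eqF // resist_gt0.
Qed.

Lemma harm_le1 x : x \in s -> harm x <= 1.
Proof.
move=> xs; rewrite -subr_ge0 one_sub_harm divr_ge0 ?(ltW resist_gt0) //.
rewrite /climb big_seq_cond sumr_ge0 // => z /andP[zs _].
by rewrite mulr_ge0 // onpath_ge0.
Qed.

Lemma harm_off x : ~~ prefix top x -> harm x = 0.
Proof.
move=> nx; rewrite /harm /climb big1 ?mul0r // => z /andP[zp zx].
rewrite /onpath; case: (boolP (prefix z vb)) => [zv|]; last by rewrite mul0r.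
by case/negP: nx; apply: prefix_trans zx; exact: top_prefix.
Qed.

Lemma kids_onpath x : x \in s ->
  \sum_(y <- s | kid x y) ((prefix y vb)%:R : R) = (prefix x vb && (x != vb))%:R.
Proof.
move=> xs; case: (boolP (prefix x vb && (x != vb))) => [/andP[xv xnv]|nv].
  have [k1 k2] := kid_prefix_take xv xnv.
  rewrite (sumr_D1 _ us (prefix_mem k2 vbs)) // k2 big1 ?addr0 // => y /andP[k3 yn].
  case: (boolP (prefix y vb)) => // yv.
  by have [_ _ e] := kid_prefix_uniq k3 yv; rewrite e eqxx in yn.
rewrite big1 // => y k; case: (boolP (prefix y vb)) => // yv.
by have [h1 h2 _] := kid_prefix_uniq k yv; rewrite h1 h2 in nv.
Qed.

Lemma om_onpath z : z \in s -> om z * onpath z = (prefix z vb)%:R.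
Proof. by move=> zs; rewrite /onpath mulrC divfK // gt_eqF // om_gt0. Qed.

Lemma flow_onpath x : x \in s -> x != vb ->
  om x * onpath x - \sum_(y <- s | kid x y) om y * onpath y = 0.
Proof.
move=> xs xv; rewrite om_onpath //.
have -> : \sum_(y <- s | kid x y) om y * onpath y =
  \sum_(y <- s | kid x y) ((prefix y vb)%:R : R).
  by rewrite big_seq_cond [RHS]big_seq_cond; apply: eq_bigr => y /andP[ys _]; rewrite om_onpath.
by rewrite kids_onpath // xv andbT subrr.
Qed.

Lemma avg_scale c f x : avg (fun y => f y * c) x = avg f x * c.
Proof. by rewrite /avg mulr_suml; apply: eq_bigr => y _; rewrite mulrA. Qed.

(** The unit flow has no source away from its two ends. *)
Lemma harm_avg x : x \in s -> x != phi -> x != vb -> avg harm x = harm x.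
Proof.
move=> xs xp xv; rewrite /harm avg_scale; congr (_ / _).
have := climb_laplace onpath 0 xs xp; rewrite flow_onpath // => /eqP.
rewrite mulf_eq0 gt_eqF ?stationary_pos //= addr0 subr_eq0 => /eqP ->.
by apply: eq_avg => y _; rewrite addr0.
Qed.

Definition top_mass := mass top.

Lemma mass_ge0 z : 0 <= mass z.
Proof. by rewrite /mass big_seq_cond sumr_ge0 // => v /andP[vs _]; exact: stationary_ge0. Qed.

Lemma mass_le z z' : prefix z z' -> mass z' <= mass z.
Proof.
move=> zz; rewrite /mass big_mkcond [leRHS]big_mkcond /= big_seq [leRHS]big_seq.
apply: ler_sum => v vs; case: ifPn => zv; first by rewrite (prefix_trans zz zv).
by case: ifP => // _; exact: stationary_ge0.
Qed.

Lemma om_le_mass z : z \in s -> z != phi -> om z <= mass z.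
Proof.
move=> zs zp; rewrite /mass (sumr_D1 _ us zs) ?prefix_refl //.
rewrite (le_trans (stationary_ge_om zs zp)) // lerDl big_seq_cond sumr_ge0 // => v /andP[vs _].
exact: stationary_ge0.
Qed.

(** An upper bound on the expected time that the walk from [x] needs to hit the
    root or [vb]. The equation f = 1 + avg f says that the flow of f has
    divergence [stationary], as the flow [mass] does by [mass_kids].
    Subtracting [top_mass] times the unit flow of the path keeps the equation
    and makes the flow along the path nonpositive; with the constant that makes
    f vanish at [vb] this gives the form in [exit_boundE], and the two sums
    here are its contributions from the side branch of [x] and from the rest of
    the path. *)
Definition exit_bound x :=
  climb (fun z => (~~ prefix z vb)%:R * mass z / om z) x +
  climb (fun z => (~~ prefix z x)%:R * (top_mass - mass z) / om z) vb.

Lemma exit_boundE x : exit_bound x =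
  climb (fun z => mass z / om z - top_mass * onpath z) x +
  climb (fun z => (top_mass - mass z) / om z) vb.
Proof.
rewrite /exit_bound /climb.
rewrite [X in X + _]big_mkcond [X in _ + X]big_mkcond -big_split /=.
rewrite [X in _ = X + _]big_mkcond [X in _ = _ + X]big_mkcond -big_split /=.
apply: eq_bigr => z _; rewrite /onpath; case: (z != phi) => //=.
case: (prefix z x); case: (prefix z vb) => /=; ring.
Qed.

Lemma exit_bound_ge0 x : x \in s -> 0 <= exit_bound x.
Proof.
move=> xs; rewrite addr_ge0 // /climb big_seq_cond sumr_ge0 // => z /andP[zs /andP[zp zv]].
  by rewrite divr_ge0 ?(ltW (om_gt0 zs)) // mulr_ge0 // mass_ge0.
rewrite divr_ge0 ?(ltW (om_gt0 zs)) // mulr_ge0 // subr_ge0; apply: mass_le.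
exact: top_prefix.
Qed.

Lemma exit_bound_avg x : x \in s -> x != phi -> x != vb ->
  exit_bound x = 1 + avg exit_bound x.
Proof.
move=> xs xp xv.
set d := fun z => mass z / om z - top_mass * onpath z.
set c := climb (fun z => (top_mass - mass z) / om z) vb.
rewrite exit_boundE -/d -/c (eq_avg (g := fun y => climb d y + c)); last first.
  by move=> y _; rewrite exit_boundE.
have := climb_laplace d c xs xp.
have -> : om x * d x = mass x - top_mass * (om x * onpath x).
  by rewrite /d; field; rewrite gt_eqF // om_gt0.
have -> : \sum_(y <- s | kid x y) om y * d y =
  \sum_(y <- s | kid x y) mass y - top_mass * \sum_(y <- s | kid x y) om y * onpath y.
  rewrite mulr_sumr -sumrB big_seq_cond [RHS]big_seq_cond; apply: eq_bigr => y /andP[ys _].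
  by rewrite /d; field; rewrite gt_eqF // om_gt0.
have -> : mass x - top_mass * (om x * onpath x) -
  (\sum_(y <- s | kid x y) mass y - top_mass * \sum_(y <- s | kid x y) om y * onpath y) =
  (mass x - \sum_(y <- s | kid x y) mass y) - top_mass * (om x * onpath x - \sum_(y <- s | kid x y) om y * onpath y) by ring.
rewrite flow_onpath // mulr0 subr0 mass_kids // -[RHS]mulr1 => /(mulfI (lt0r_neq0 (stationary_pos xs))).
by move=> <-; rewrite subrK.
Qed.

(** To survive, it suffices to reach [vb] first and to survive from there. *)
Lemma harm_le_alive n x : x \in s -> harm x * alive n vb <= alive n x.
Proof.
elim: n x => [|n IH] x xs.
  rewrite !alive0 // vbp mulr1; have [->|xp] := eqVneq x phi; first by rewrite harm_phi.
  exact: harm_le1.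
have [->|xp] := eqVneq x phi; first by rewrite harm_phi mul0r stay_ge0.
have [->|xv] := eqVneq x vb; first by rewrite harm_vb mul1r.
rewrite [leRHS]aliveS xp mul1r.
apply: (@le_trans _ _ (harm x * alive n vb)).
  by apply: ler_wpM2l; [exact: harm_ge0|exact: alive_decr].
by rewrite -(harm_avg xs xp xv) -avg_scale; apply: avg_le => // y ys; exact: IH.
Qed.

(** Off the two ends, the excess summed over time satisfies the equation of
    [exit_bound] with a source of at most one: the initial term [1 - harm x],
    plus [harm x] times the telescoping sum of the decrements of [alive n vb].
    *)
Lemma alive_excess N x : x \in s ->
  \sum_(n < N) (alive n x - harm x * alive n vb) <= exit_bound x.
Proof.
elim: N x => [|N IH] x xs; first by rewrite big_ord0 exit_bound_ge0.
have [->|xp] := eqVneq x phi.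
  rewrite big1 ?exit_bound_ge0 // => n _; by rewrite alive_phi harm_phi mul0r subrr.
have [->|xv] := eqVneq x vb.
  rewrite big1 ?exit_bound_ge0 // => n _; by rewrite harm_vb mul1r subrr.
rewrite exit_bound_avg //.
have key : \sum_(n < N.+1) (alive n x - harm x * alive n vb) <=
   1 + avg (fun y => \sum_(n < N) (alive n y - harm y * alive n vb)) x.
  rewrite (avg_sum (fun n y => alive n y - harm y * alive n vb)) big_ord_recl /=.
  rewrite !alive0 // xp vbp mulr1.
  have -> : \sum_(i < N) (alive (bump 0 i) x - harm x * alive (bump 0 i) vb) =
    \sum_(i < N) avg (fun y => alive i y - harm y * alive i vb) x
    + harm x * \sum_(i < N) (alive i vb - alive i.+1 vb).
    rewrite mulr_sumr -big_split /=; apply: eq_bigr => i _; rewrite /bump add1n.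
    have -> : avg (fun y => alive i y - harm y * alive i vb) x =
      avg (alive i) x - alive i vb * harm x.
      rewrite -(harm_avg xs xp xv) -[avg (alive i) x]mul1r -mulNr -avg_lin.
      by apply: eq_avg => y _; ring.
    rewrite aliveS xp mul1r; ring.
  rewrite -(big_mkord xpredT (fun i => alive i vb - alive i.+1 vb)).
  have -> : \sum_(0 <= i < N) (alive i vb - alive i.+1 vb) = 1 - alive N vb.
    elim: (N) => [|M IHM]; first by rewrite big_nil alive0 // vbp subrr.
    by rewrite big_nat_recr //= IHM; ring.
  have h1 : harm x * (1 - alive N vb) <= harm x.
    apply: ler_piMr; first exact: harm_ge0.
    by rewrite lerBlDr lerDl stay_ge0.
  have -> : (true%:R : R) = 1 by [].
  lra.
apply: (le_trans key); rewrite lerD2l; apply: avg_le => // y ys; exact: IH.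
Qed.

Lemma free_excess N x : x \in s -> \sum_(n < N) free n x <= exit_bound x.
Proof.
elim: N x => [|N IH] x xs; first by rewrite big_ord0 exit_bound_ge0.
have [e|] := eqVneq ((x != phi) && (x != vb)) false.
  rewrite big1 ?exit_bound_ge0 // => n _; by rewrite /free /= /off_ends e mul0r.
rewrite negb_eqb addbF => /andP[xp xv].
rewrite exit_bound_avg // big_ord_recl /= free0 // xp xv lerD2l.
under eq_bigr => i _ do rewrite /bump add1n freeS xp xv mul1r.
rewrite -(avg_sum free); apply: avg_le => // y ys; exact: IH.
Qed.

(** * Trees concentrated along the path to the base *)

Local Notation p := (q^-1).
Local Notation C := ((1 - q^-1)^-1).
Local Notation kappa := (om top).

Lemma q_gt0 : 0 < q. Proof. exact: lt_trans ltr01 q1. Qed.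

Lemma p_itv : 0 < p < 1.
Proof. by rewrite invr_gt0 q_gt0 invf_lt1 ?q_gt0. Qed.

Lemma C_ge1 : 1 <= C.
Proof. by have /andP[p0 p1] := p_itv; rewrite invf_ge1; lra. Qed.

Lemma kappa_gt0 : 0 < kappa. Proof. exact/om_gt0/top_mem. Qed.

(** Biases are at least [q] in every generation above [top]. *)
Lemma om_top_ge z : z \in s -> prefix top z ->
  kappa * q ^+ (size z).-1 <= om z.
Proof.
elim/last_ind: z => [|u j IH] zs.
  by rewrite prefixs0 (negbTE top_neq).
rewrite prefix_rconsE => /orP[tu|/eqP <-]; last by rewrite size_top mulr1.
have us' := sparent zs; apply: le_trans (om_kid_ge zs _); last by rewrite kid_rcons.
rewrite size_rcons /=; apply: (@le_trans _ _ (q * (kappa * q ^+ (size u).-1))).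
  have /size_prefix := tu; rewrite size_top; case: (size u) => // n _.
  by rewrite /= exprS mulrCA.
by rewrite ler_pM2l ?q_gt0 // IH.
Qed.

Lemma climb_index d x : x \in s -> climb d x = \sum_(i < size x) d (take i.+1 x).
Proof.
elim/last_ind: x => [|u j IH] xs; first by rewrite climb_phi big_ord0.
rewrite climb_rcons // (IH (sparent xs)) size_rcons big_ord_recr /= addrC.
rewrite [take _ (rcons u j)]take_oversize ?size_rcons //; congr (_ + _).
by apply: eq_bigr => i _; rewrite -cats1 takel_cat.
Qed.

Lemma geometric_sum n : \sum_(i < n) p ^+ i <= C.
Proof. by apply: geometric_le; have /andP[/ltW -> ->] := p_itv. Qed.

Lemma geometric_tail K n : \sum_(i < n) (K <= i)%:R * p ^+ i <= C * p ^+ K.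
Proof.
have /andP[p0 p1] := p_itv; have pK : 0 <= p ^+ K by rewrite exprn_ge0 // ltW.
have [nK|Kn] := leqP n K.
  rewrite big1 ?mulr_ge0 // ?invr_ge0; first by rewrite subr_ge0 ltW.
  by move=> i _; rewrite leqNgt (leq_trans (ltn_ord i) nK) mul0r.
have -> : n = (K + (n - K))%N by rewrite subnKC // ltnW.
rewrite big_split_ord /= big1 ?add0r; last first.
  by move=> i _; rewrite leqNgt ltn_ord mul0r.
have -> : \sum_(i < n - K) (K <= K + i)%:R * p ^+ (K + i) = p ^+ K * \sum_(i < n - K) p ^+ i.
  by rewrite mulr_sumr; apply: eq_bigr => i _; rewrite leq_addr mul1r exprD.
by rewrite mulrC; apply: ler_wpM2r => //; exact: geometric_sum.
Qed.

(** The weights grow geometrically along a path, so that the bound on [F]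
    decays geometrically: the generations up to [K] contribute [del] times the
    whole series, the later ones its tail [p ^+ K]. *)
Lemma climb_bound (F : vertex -> R) (del T : R) K x : x \in s -> prefix top x ->
  0 <= del -> 0 <= T ->
  (forall z, z \in s -> z != phi -> prefix z x ->
     F z <= (del + (K < size z)%:R) * T / om z) ->
  climb F x <= C * (del + p ^+ K) * (T / kappa).
Proof.
move=> xs tx del0 T0 FB; have k0 := kappa_gt0.
have xp : x != phi by apply: contraTneq tx => ->; rewrite prefixs0 top_neq.
rewrite climb_index //.
apply: (@le_trans _ _ (\sum_(i < size x) (del * p ^+ i + (K <= i)%:R * p ^+ i) * (T / kappa))).
  apply: ler_sum => i _.
  have zx := prefix_take x i.+1; have zs := prefix_mem zx xs.
  have sz : size (take i.+1 x) = i.+1 by rewrite size_takel.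
  have zp : take i.+1 x != phi by rewrite -size_eq0 sz.
  apply: (le_trans (FB _ zs zp zx)); rewrite sz ltnS -mulrDl -[leLHS]mulrA -[leRHS]mulrA.
  apply: ler_wpM2l; first by rewrite addr_ge0.
  rewrite mulrCA; apply: ler_wpM2l => //.
  have tz : prefix top (take i.+1 x).
    move: tx; rewrite !prefixE size_top => /eqP <-.
    by rewrite take_takel.
  have := om_top_ge zs tz; rewrite sz /= => h.
  have qi : 0 < q ^+ i by rewrite exprn_gt0 // q_gt0.
  rewrite exprVn -invfM mulrC lef_pV2 ?posrE //; first by rewrite om_gt0.
  by rewrite mulr_gt0.
rewrite -mulr_suml big_split /= -mulr_sumr; apply: ler_wpM2r.
  by rewrite divr_ge0 // ltW.
rewrite mulrDr; apply: lerD; last exact: geometric_tail.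
by rewrite mulrC; apply: ler_wpM2r => //; exact: geometric_sum.
Qed.

Lemma prefix_comparable (a b v : vertex) : prefix a v -> prefix b v ->
  (size a <= size b)%N -> prefix a b.
Proof. by rewrite !prefixE => /eqP ea /eqP eb ab; rewrite -{1}eb take_takel // ea. Qed.

Variables (K : nat) (del : R).
Hypothesis K_gt0 : (0 < K)%N.
Hypothesis K_le : (K <= size vb)%N.
Hypothesis del_ge0 : 0 <= del.
Definition trunk := take K vb.
Hypothesis concentrated : top_mass - mass trunk <= del * top_mass.

Lemma size_trunk : size trunk = K. Proof. by rewrite size_takel. Qed.

Lemma trunk_vb : prefix trunk vb. Proof. exact: prefix_take. Qed.

Lemma trunk_mem : trunk \in s. Proof. exact: prefix_mem trunk_vb vbs. Qed.

Lemma trunk_neq : trunk != phi. Proof. by rewrite -size_eq0 size_trunk -lt0n. Qed.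

Lemma top_trunk : prefix top trunk. Proof. exact: top_prefix trunk_neq trunk_vb. Qed.

Lemma top_mass_ge : kappa <= q * p ^+ K * top_mass.
Proof.
have k0 := kappa_gt0; have qK : 0 < q ^+ K by rewrite exprn_gt0 // q_gt0.
have h : kappa * q ^+ K.-1 <= top_mass.
  rewrite -[X in q ^+ X.-1]size_trunk; apply: le_trans (om_top_ge trunk_mem top_trunk) _.
  apply: (le_trans (om_le_mass trunk_mem trunk_neq)); exact/mass_le/top_trunk.
rewrite exprVn mulrAC ler_pdivlMr // -[K in leLHS](prednK K_gt0) exprS.
by rewrite mulrCA ler_pM2l ?q_gt0.
Qed.

Lemma top_mass_gt0 : 0 < top_mass.
Proof. exact: lt_le_trans kappa_gt0 (om_le_mass top_mem top_neq). Qed.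

(** Neither of [z] and [trunk] lies above the other, hence their subtrees are
    disjoint. *)
Lemma mass_disjoint z : prefix top z -> (size z <= K)%N -> ~~ prefix z vb ->
  mass z + mass trunk <= top_mass.
Proof.
move=> tz zK zv; rewrite /top_mass /mass [X in X + _]big_mkcond [X in _ + X]big_mkcond -big_split /=.
rewrite [leRHS]big_mkcond /= big_seq [leRHS]big_seq; apply: ler_sum => v vs.
have p0 := stationary_ge0 vs.
case: (boolP (prefix z v)) => zv'; case: (boolP (prefix trunk v)) => tv.
- case/negP: zv; apply: prefix_trans trunk_vb.
  by apply: prefix_comparable zv' tv _; rewrite size_trunk.
- by rewrite addr0 (prefix_trans tz zv').
- by rewrite add0r (prefix_trans top_trunk tv).
- by rewrite addr0; case: ifP.
Qed.

(** The flow in [exit_bound] is at most [del * top_mass] up to generation [K],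
    since by concentration a side branch has a small mass and the path carries
    most of it, and at most [top_mass] beyond that, in absolute value. *)
Lemma exit_bound_le x : x \in s -> prefix top x ->
  exit_bound x <= 2 * (C * (del + p ^+ K)) * (top_mass / kappa).
Proof.
move=> xs tx; have t0 := top_mass_gt0.
have xp : x != phi by apply: contraTneq tx => ->; rewrite prefixs0 top_neq.
have two (A : R) : 2 * A = A + A by ring.
rewrite two [leRHS]mulrDl; apply: lerD.
  apply: climb_bound => // [|z zs zp zx]; first exact: ltW.
  rewrite ler_pM2r ?invr_gt0 ?om_gt0 //.
  have tz : prefix top z.
    by apply: prefix_comparable tx zx _; rewrite size_top lt0n size_eq0.
  have dl : 0 <= del * top_mass by rewrite mulr_ge0 // ltW.
  case: (boolP (prefix z vb)) => zv; first by rewrite mul0r mulr_ge0 ?addr_ge0 ?(ltW t0).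
  have Zt : mass z <= top_mass := mass_le tz.
  rewrite mul1r; case: (leqP (size z) K) => zK; last by rewrite mulrDl mul1r; lra.
  rewrite addr0; have := mass_disjoint tz zK zv; move: concentrated; lra.
apply: climb_bound => // [||z zs zp zv]; [exact: prefix_take|exact: ltW|].
rewrite ler_pM2r ?invr_gt0 ?om_gt0 //.
have dl : 0 <= del * top_mass by rewrite mulr_ge0 // ltW.
case: (boolP (prefix z x)) => zx; first by rewrite mul0r mulr_ge0 ?addr_ge0 ?(ltW t0).
have tz := top_prefix zp zv.
rewrite mul1r; case: (leqP (size z) K) => zK.
  rewrite addr0; apply: le_trans concentrated; rewrite lerD2l lerN2; apply: mass_le.
  by apply: prefix_comparable zv trunk_vb _; rewrite size_trunk.
by rewrite mulrDl mul1r; have := mass_ge0 z; lra.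
Qed.

(** The average under the reversible measure, normalized on the subtree above
    [top]. Killed at the root, the walk started from this law nearly keeps it,
    which is why survival is nearly geometric. *)
Definition mean f := (\sum_(x <- s | prefix top x) stationary x * f x) / top_mass.

Lemma mean_le f h : (forall x, x \in s -> prefix top x -> f x <= h x) -> mean f <= mean h.
Proof.
move=> fh; rewrite /mean ler_pM2r ?invr_gt0 ?top_mass_gt0 //.
rewrite big_seq_cond [leRHS]big_seq_cond; apply: ler_sum => x /andP[xs tx].
by apply: ler_wpM2l; [exact: stationary_ge0|exact: fh].
Qed.

Lemma mean_lin (c d : R) f h : mean (fun x => c * f x + d * h x) = c * mean f + d * mean h.
Proof.
rewrite /mean !mulrA -mulrDl !mulr_sumr -big_split /=; congr (_ / _).
by apply: eq_bigr => x _; ring.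
Qed.

Lemma mean_const c : mean (fun=> c) = c.
Proof. by rewrite /mean -mulr_suml -/(mass top) -/top_mass mulrAC divff ?mul1r // gt_eqF // top_mass_gt0. Qed.

Lemma mean_sum (F : nat -> vertex -> R) N :
  mean (fun y => \sum_(n < N) F n y) = \sum_(n < N) mean (F n).
Proof.
rewrite /mean -mulr_suml; congr (_ / _); rewrite exchange_big /=; apply: eq_bigr => x _.
by rewrite mulr_sumr.
Qed.

Lemma eq_mean f h : (forall x, x \in s -> prefix top x -> f x = h x) -> mean f = mean h.
Proof. by move=> fh; apply/eqP; rewrite eq_le !mean_le // => x xs tx; rewrite fh. Qed.

Lemma neq_phi x : prefix top x -> x != phi.
Proof. by move=> tx; apply: contraTneq tx => ->; rewrite prefixs0 top_neq. Qed.

Lemma mean_alive0 : mean (alive 0) = 1.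
Proof.
rewrite -[RHS]mean_const; apply: eq_mean => x xs tx.
by rewrite alive0 // neq_phi.
Qed.

(** The mass that a step loses leaves the subtree through the edge below [top];
    by reversibility this loss is seen as a walk that starts at [top]. *)
Lemma mean_aliveS n : mean (alive n.+1) = mean (alive n) - kappa / top_mass * alive n top.
Proof.
rewrite (eq_mean (h := avg (alive n))); last first.
  by move=> x xs tx; rewrite aliveS neq_phi // mul1r.
rewrite /mean subtree_stationary_avg ?top_mem ?top_neq //.
have -> : parent top = phi by rewrite /parent size_top take0.
by rewrite alive_phi mulr0 addr0 mulrBl mulrAC.
Qed.

Lemma mean_harm_le n : mean harm * alive n vb <= mean (alive n).
Proof.
have -> : mean harm * alive n vb = mean (fun x => harm x * alive n vb).
  by rewrite /mean mulrAC [X in X / _ = _]mulr_suml; congr (_ / _); apply: eq_bigr => x _; rewrite mulrA.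
by apply: mean_le => x xs _; exact: harm_le_alive.
Qed.

Lemma mean_excess N : \sum_(n < N) (mean (alive n) - mean harm * alive n vb) <=
  2 * (C * (del + p ^+ K)) * (top_mass / kappa).
Proof.
rewrite -[leRHS]mean_const.
have -> : \sum_(n < N) (mean (alive n) - mean harm * alive n vb) =
  mean (fun x => \sum_(n < N) (alive n x - harm x * alive n vb)).
  rewrite (mean_sum (fun n x => alive n x - harm x * alive n vb)); apply: eq_bigr => n _.
  rewrite -[mean (alive n)]mul1r (mulrC (mean harm)) -mulNr -mean_lin.
  by apply: eq_mean => x _ _; ring.
apply: mean_le => x xs tx; apply: le_trans (exit_bound_le xs tx); exact: alive_excess.
Qed.

Lemma climb_top d : climb d top = d top.
Proof.
by rewrite climb_index ?top_mem // size_top big_ord_recl big_ord0 addr0 take_oversize // size_top.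
Qed.

Lemma resist_le : resist <= 2 * C / kappa.
Proof.
have /andP[p0 p1] := p_itv; have k0 := kappa_gt0.
have h : climb onpath vb <= C * (1 + p ^+ 0) * (1 / kappa).
  apply: climb_bound => //; first exact: prefix_take.
  move=> z zs zp zv; rewrite /onpath zv ler_pM2r ?invr_gt0 ?om_gt0 //.
  by rewrite mulr1 lerDl.
by move: h; rewrite expr0 -/resist div1r (mulrC 2).
Qed.

(** Resistances decay geometrically along the path, so that the first edge is a
    positive fraction of the total. *)
Lemma harm_top_ge : (2 * C)^-1 <= harm top.
Proof.
rewrite /harm climb_top /onpath prefix_take.
have k0 := kappa_gt0; have C0 := lt_le_trans ltr01 C_ge1.
rewrite ler_pdivlMr ?resist_gt0 // mulrC ler_pdivrMr; last by rewrite mulr_gt0.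
by rewrite mul1r mulrC; exact: resist_le.
Qed.

(** Above [trunk] only the edges of the path beyond generation [K] are missing
    from [harm], and the rest of the subtree has a small mass. *)
Lemma mean_harm_ge : 1 - mean harm <= del + C * p ^+ K.
Proof.
have /andP[p0 p1] := p_itv; have k0 := kappa_gt0; have C0 := lt_le_trans ltr01 C_ge1.
have -> : 1 - mean harm = mean (fun x => 1 - harm x).
  have := mean_lin 1 (-1) (fun=> 1) harm; rewrite mean_const mulr1 mulN1r => <-.
  by apply: eq_mean => x _ _; ring.
apply: (@le_trans _ _ (mean (fun x => (~~ prefix trunk x)%:R + C * p ^+ K))).
  apply: mean_le => x xs tx; have cp : 0 <= C * p ^+ K by rewrite mulr_ge0 ?exprn_ge0 // ltW.
  case: (boolP (prefix trunk x)) => kx /=; last by have := harm_ge0 xs; rewrite mulr1n; lra.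
  rewrite add0r one_sub_harm ler_pdivrMr ?resist_gt0 //.
  have h : climb (fun z => (~~ prefix z x)%:R * onpath z) vb <= C * (0 + p ^+ K) * (1 / kappa).
    apply: climb_bound => //; first exact: prefix_take.
    move=> z zs zp zv; rewrite /onpath zv add0r mulr1 mulrA ler_pM2r ?invr_gt0 ?om_gt0 // mulr1.
    case: (leqP (size z) K) => zK; last by rewrite /= lern1 leq_b1.
    rewrite (prefix_trans _ kx) //; apply: prefix_comparable zv trunk_vb _.
    by rewrite size_trunk.
  apply: (le_trans h); rewrite add0r div1r; apply: ler_wpM2l => //; exact: resist_ge.
have -> : mean (fun x => (~~ prefix trunk x)%:R + C * p ^+ K) =
   mean (fun x => (~~ prefix trunk x)%:R) + C * p ^+ K.
  have := mean_lin 1 1 (fun x => (~~ prefix trunk x)%:R) (fun=> C * p ^+ K).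
  by rewrite mean_const !mul1r => <-; apply: eq_mean => x _ _; rewrite !mul1r.
rewrite lerD2r /mean ler_pdivrMr ?top_mass_gt0 //; apply: le_trans concentrated.
rewrite lerBrDr /top_mass /mass [leRHS]big_mkcond [X in X + _]big_mkcond [X in _ + X]big_mkcond -big_split /=.
rewrite big_seq [leRHS]big_seq; apply: ler_sum => x xs; have p0' := stationary_ge0 xs.
case: (boolP (prefix trunk x)) => kx; first by rewrite (prefix_trans top_trunk kx) mulr0 add0r.
by rewrite addr0; case: ifP; rewrite ?mulr1.
Qed.

(** * Trajectories and the deep excursion event *)

Variable Qw : probability trajectory R.
Hypothesis walkQ : is_walk_law w phi Qw.

Local Notation pQ := (pr Qw).

Definition cylinder n (y : nat -> vertex) : set trajectory :=
  [set x | forall i, (i <= n)%N -> x i = y i].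

Lemma measurable_at n v : measurable [set x : trajectory | x n = v].
Proof. by apply: sub_sigma_algebra; exists n, v. Qed.

Lemma measurable_pred_at n (A : pred vertex) : measurable [set x : trajectory | A (x n)].
Proof.
rewrite (_ : [set _ | _] = \bigcup_v (if A v then [set x : trajectory | x n = v] else set0)).
  apply: countable_bigcupT_measurable => [|v]; first exact: countableP.
  by case: (A v) => //; exact: measurable_at.
apply/seteqP; split => [x /= Ax|x [v _]]; first by exists (x n) => //; rewrite Ax.
by case: ifP => // Av /= ->.
Qed.

Lemma cylinder0 y : cylinder 0 y = [set x | x 0%N = y 0%N].
Proof.
apply/seteqP; split => x /=; first by apply.
by move=> h i; rewrite leqn0 => /eqP ->.
Qed.

Lemma cylinderS n y : cylinder n.+1 y = cylinder n y `&` [set x | x n.+1 = y n.+1].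
Proof.
apply/seteqP; split => x /= => [h|[h1 h2] i].
  by split => [i i_n|]; apply: h => //; exact: leqW.
by rewrite leq_eqVlt => /orP[/eqP ->//|]; rewrite ltnS; exact: h1.
Qed.

Lemma measurable_cylinder n y : measurable (cylinder n y).
Proof.
elim: n => [|n IH]; first by rewrite cylinder0; exact: measurable_at.
by rewrite cylinderS; apply: measurableI => //; exact: measurable_at.
Qed.

Lemma pr_cylinderS n y : pQ (cylinder n.+1 y) = pQ (cylinder n y) * step w (y n) (y n.+1).
Proof.
apply: EFin_inj; rewrite EFinM -!prE; try exact: measurable_cylinder.
exact: walkQ.2.
Qed.

Fixpoint obeys (S : seq (pred vertex)) (j : nat) (x : trajectory) : Prop :=
  if S is A :: S' then A (x j) /\ obeys S' j.+1 x else True.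

Lemma measurable_obeys S j : measurable [set x | obeys S j x].
Proof.
elim: S j => [|A S IH] j.
  by rewrite (_ : [set _ | _] = setT) //; apply/seteqP; split.
rewrite (_ : [set _ | _] = [set x : trajectory | A (x j)] `&` [set x | obeys S j.+1 x]) //.
by apply: measurableI => //; exact: measurable_pred_at.
Qed.

Lemma cylinder_next j y b :
  cylinder j y `&` [set x | x j.+1 = b] = cylinder j.+1 (fun i => if i == j.+1 then b else y i).
Proof.
rewrite cylinderS eqxx; congr (_ `&` _); apply/seteqP; split => x /= h i ij.
  by rewrite h // ltn_eqF.
by rewrite h // ltn_eqF.
Qed.

Lemma pr_next j y b : pQ (cylinder j y `&` [set x | x j.+1 = b]) = pQ (cylinder j y) * step w (y j) b.
Proof.
rewrite cylinder_next pr_cylinderS eqxx (ltn_eqF (ltnSn j)); congr (pQ _ * _).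
by apply/seteqP; split => x /= h i ij; rewrite h // ltn_eqF.
Qed.

(** The transition probabilities out of a vertex sum to one over the tree. *)
Lemma next_in_tree j y : y j \in s ->
  pQ (cylinder j y `&` [set x | x j.+1 \in s]) = pQ (cylinder j y).
Proof.
move=> ys; rewrite (pr_fibers _ us (measurable_cylinder j y) (measurable_at j.+1)).
under eq_bigr => b _ do rewrite pr_next.
rewrite -mulr_sumr -[RHS]mulr1 -(avg_const ys) /avg; congr (_ * _).
by apply: eq_bigr => b _; rewrite mulr1.
Qed.

Lemma pr_first_step j y E : y j \in s -> measurable E ->
  pQ (cylinder j y `&` E) = \sum_(b <- s) pQ (cylinder j y `&` [set x | x j.+1 = b] `&` E).
Proof.
move=> ys mE; have mc := measurable_cylinder j y.
have ms := measurable_pred_at j.+1 (mem s).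
have mcE := measurableI _ _ mc mE.
transitivity (pQ (cylinder j y `&` E `&` [set x | x j.+1 \in s])).
  rewrite [LHS](pr_split _ mcE ms); apply/eqP; rewrite -subr_eq0 addrAC subrr add0r.
  have := pr_split Qw mc ms; rewrite (next_in_tree ys) => /eqP.
  rewrite -subr_eq0 opprD addrA subrr add0r oppr_eq0 => /eqP h.
  rewrite eq_le pr_ge0 andbT -h; apply: pr_le; last by move=> x [[]].
    by apply: measurableI => //; exact: measurableC.
  by apply: measurableI => //; exact: measurableC.
rewrite (pr_fibers _ us mcE (measurable_at j.+1)); apply: eq_bigr => b _.
by rewrite setIAC.
Qed.

(** The Markov property, one constraint at a time. *)
Lemma pr_obeys S j y : y j \in s ->
  pQ (cylinder j y `&` [set x | obeys S j x]) = pQ (cylinder j y) * stay S (y j).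
Proof.
elim: S j y => [|A S IH] j y ys /=.
  by rewrite mulr1 (_ : [set _ | _] = setT) ?setIT //; apply/seteqP; split.
have [Ay|nAy] := boolP (A (y j)); last first.
  rewrite mul0r mulr0 (_ : _ `&` _ = set0) ?pr_set0 // -subset0 => x [/= h []].
  by rewrite h // (negbTE nAy).
rewrite mul1r (_ : _ `&` _ = cylinder j y `&` [set x | obeys S j.+1 x]); last first.
  by apply/seteqP; split => x [h] /=; [case|split => //; rewrite h].
rewrite pr_first_step //; last exact: measurable_obeys.
rewrite /avg mulr_sumr big_seq [RHS]big_seq.
apply: eq_bigr => b bs; rewrite cylinder_next IH ?eqxx // -cylinder_next pr_next.
by rewrite mulrA.
Qed.

Lemma pr_obeys0 S : pQ [set x | obeys S 0 x] = stay S phi.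
Proof.
have c1 : pQ (cylinder 0 (fun=> phi)) = 1.
  by rewrite cylinder0 /pr walkQ.1.
have mc := measurable_cylinder 0 (fun=> phi); have mo := measurable_obeys S 0.
rewrite -(prIr mo mc c1) setIC pr_obeys //.
by rewrite c1 mul1r.
Qed.

Lemma obeys_nseq A n j x :
  obeys (nseq n A) j x <-> forall i, (j <= i < j + n)%N -> A (x i).
Proof.
elim: n j => [|n IH] j /=; first by split => // _ i; lia.
rewrite IH; split => [[h1 h2] i ij|h].
  by have [->//|ij'] := eqVneq i j; apply: h2; lia.
by split => [|i ij]; apply: h; lia.
Qed.

Lemma obeys_cat S S' j x : obeys (S ++ S') j x <-> obeys S j x /\ obeys S' (j + size S)%N x.
Proof.
elim: S j => [|A S IH] j /=; first by rewrite addn0; split => [|[]].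
by rewrite IH addSnnS; tauto.
Qed.

Lemma hitting_time_gt m v (x : trajectory) (r : R) :
  (r%:E < hitting_time R m v x)%E <-> forall k, (m <= k)%N -> x k = v -> r < k%:R.
Proof.
split=> [h k mk xk|h].
  rewrite -lte_fin; apply: lt_le_trans h _; apply: ereal_inf_lbound.
  by exists k.
have [[k [mk xk]]|no] := pselect (exists k, (m <= k)%N /\ x k = v).
  have ex : exists k, (m <= k)%N && (x k == v) by exists k; rewrite mk xk eqxx.
  case: (ex_minnP ex) => k0 /andP[mk0 /eqP xk0] kmin.
  apply: (@lt_le_trans _ _ (k0%:R)%:E); first by rewrite lte_fin; exact: h.
  apply/ereal_infP => _ [i [mi xi] <-]; rewrite lee_fin ler_nat.
  by apply: kmin; rewrite mi xi eqxx.
rewrite /hitting_time (_ : [set _ | _ in _] = set0) ?ereal_inf0 ?ltry //.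
by rewrite -subset0 => y [i [mi xi] _]; case: no; exists i.
Qed.

Definition off_until n : set trajectory :=
  [set x | forall i, (0 < i <= n)%N -> x i != phi].

Lemma return_time_gt n (x : trajectory) :
  ((n%:R : R)%:E < return_time R x)%E <-> off_until n x.
Proof.
rewrite hitting_time_gt; split => h i.
  move=> /andP[i0 i_n]; apply/eqP => xi; have := h i i0 xi.
  by rewrite ltr_nat ltnNge i_n.
move=> i0 xi; rewrite ltr_nat ltnNge; apply/negP => i_n.
by have := h i; rewrite i0 i_n xi eqxx => /(_ isT).
Qed.

Lemma measurable_off_until n : measurable (off_until n).
Proof.
rewrite (_ : off_until n = [set x | obeys (nseq n off_root) 1 x]).
  exact: measurable_obeys.
by apply/seteqP; split => x /=; rewrite obeys_nseq => h i hi; apply: h; lia.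
Qed.

Hypothesis vbE : vbase (tree w) = vb.

Lemma deep_excursionP (x : trajectory) :
  deep_excursion w x <-> exists2 m, x m = vb & off_until m x.
Proof.
rewrite /deep_excursion /= vbE; split => [h|[m xm om]].
  have [[k xk]|no] := pselect (exists k, x k = vb); last first.
    move: h; rewrite /hitting_time (_ : [set _ | _ in _] = set0) ?ereal_inf0.
      by rewrite ltNge leey.
    by rewrite -subset0 => y [i [_ xi] _]; case: no; exists i.
  have ex : exists k, x k == vb by exists k; rewrite xk.
  case: (ex_minnP ex) => m /eqP xm mmin; exists m => //; apply/return_time_gt.
  apply: le_lt_trans h; apply/ereal_infP => _ [i [_ xi] <-].
  by rewrite lee_fin ler_nat; apply: mmin; rewrite xi.
apply: (@le_lt_trans _ _ (m%:R)%:E); last exact/return_time_gt.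
by apply: ereal_inf_lbound; exists m.
Qed.

Local Notation DE := (deep_excursion w).

Lemma measurable_deep : measurable (DE : set trajectory).
Proof.
rewrite (_ : DE = \bigcup_m ([set x : trajectory | x m = vb] `&` off_until m)).
  apply: bigcup_measurable => m _; apply: measurableI; [exact: measurable_at|].
  exact: measurable_off_until.
apply/seteqP; split => x; first by move/deep_excursionP => [m h1 h2]; exists m.
by case=> m _ [h1 h2]; apply/deep_excursionP; exists m.
Qed.

Local Notation at_vb := (pred1 vb : pred vertex).

(** The probability that the walk from [x] is at [vb] at time [k] after
    avoiding both ends before. *)
Definition hits k := stay (nseq k off_ends ++ [:: at_vb]).

Lemma hits0 x : x \in s -> hits 0 x = (x == vb)%:R.
Proof. by move=> xs; rewrite /hits /= avg_const // mulr1. Qed.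

Lemma hits_sum_avg m x : x \in s ->
  \sum_(k < m.+1) hits k x = (x == vb)%:R + (off_ends x)%:R * avg (fun y => \sum_(k < m) hits k y) x.
Proof.
move=> xs; rewrite big_ord_recl hits0 // (avg_sum hits); congr (_ + _).
by rewrite mulr_sumr.
Qed.

Lemma hits_le_harm m x : x \in s -> \sum_(k < m) hits k x <= harm x.
Proof.
elim: m x => [|m IH] x xs; first by rewrite big_ord0 harm_ge0.
rewrite hits_sum_avg //; have [->|xv] := eqVneq x vb.
  by rewrite harm_vb /off_ends eqxx andbF mul0r addr0.
rewrite add0r /off_ends xv andbT; have [->|xp] := eqVneq x phi; first by rewrite mul0r harm_phi.
by rewrite mul1r -(harm_avg xs xp xv); apply: avg_le.
Qed.

(** Both sides satisfy the same one-step equation. Since [free m x] is summable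
    in [m] by [free_excess], this and [hits_le_harm] identify [harm] with the
    probability of hitting [vb] before the root. *)
Lemma harm_le_hits m x : x \in s -> harm x <= \sum_(k < m.+1) hits k x + free m x.
Proof.
elim: m x => [|m IH] x xs.
  rewrite big_ord_recl big_ord0 hits0 // free0 //.
  have [->|xv] := eqVneq x vb; first by rewrite harm_vb andbF !addr0.
  have [->|xp] := eqVneq x phi; first by rewrite harm_phi !addr0.
  by rewrite /= addr0 add0r harm_le1.
rewrite hits_sum_avg // freeS; have [->|xv] := eqVneq x vb.
  by rewrite harm_vb /off_ends eqxx andbF !mul0r !addr0.
rewrite add0r /off_ends xv andbT; have [->|xp] := eqVneq x phi.
  by rewrite !mul0r harm_phi addr0.
rewrite !mul1r -(harm_avg xs xp xv).
have := avg_lin 1 1 (fun y => \sum_(k < m.+1) hits k y) (free m) x.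
by rewrite !mul1r => <-; apply: avg_le => // y ys; rewrite !mul1r; exact: IH.
Qed.

(** As [hits], but with earlier visits to [vb] allowed; it serves only to show
    that [vb] is out of reach where [harm] vanishes. *)
Definition visit k := stay (nseq k off_root ++ [:: at_vb]).

Lemma visit_le_harm k x : x \in s -> visit k x <= harm x.
Proof.
elim: k x => [|k IH] x xs.
  rewrite /visit /= avg_const // mulr1; have [->|xv] := eqVneq x vb; first by rewrite harm_vb.
  exact: harm_ge0.
have -> : visit k.+1 x = (x != phi)%:R * avg (visit k) x by [].
have [->|xp] := eqVneq x phi; first by rewrite mul0r harm_phi.
rewrite mul1r; have [->|xv] := eqVneq x vb.
  by rewrite harm_vb -(avg_const vbs); apply: avg_le => // y ys; exact: stay_le1.
by rewrite -(harm_avg xs xp xv); apply: avg_le.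
Qed.

Local Notation ptop := (step w phi top).

Lemma pr_second_step (B : pred vertex) S :
  pQ [set x | B (x 1%N) /\ obeys S 1 x] = \sum_(y <- s) step w phi y * ((B y)%:R * stay S y).
Proof.
case: S => [|A S].
  rewrite (_ : [set _ | _] = [set x | obeys [:: (predT : pred vertex); B] 0 x]); last first.
    by apply/seteqP; split => x /= [].
  rewrite pr_obeys0 /= mul1r /avg big_seq [RHS]big_seq; apply: eq_bigr => y ys.
  by rewrite -/(avg (fun=> 1) y) avg_const.
rewrite (_ : [set _ | _] = [set x | obeys ((predT : pred vertex) :: (fun v => B v && A v) :: S) 0 x]); last first.
  apply/seteqP; split => x /=; first by case=> -> [-> ?].
  by case=> _ [/andP[-> ->] ?].
rewrite pr_obeys0 /= mul1r; apply: eq_bigr => y _.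
by case: (B y); case: (A y); rewrite /= ?mul1r ?mul0r ?mulr0.
Qed.

Lemma pr_via_top S : pQ [set x | x 1%N == top /\ obeys S 1 x] = ptop * stay S top.
Proof.
rewrite (pr_second_step (pred1 top)) (bigD1_seq top) ?top_mem //= eqxx mul1r big1 ?addr0 //.
by move=> y /negbTE ->; rewrite mul0r mulr0.
Qed.

Lemma ptop_gt0 : 0 < ptop.
Proof.
have := stationary_step sphi top_mem (stationary_pos sphi).
rewrite kid_top eqxx mul0r addr0 mul1r => h.
by rewrite -(pmulr_rgt0 _ (stationary_pos sphi)) h kappa_gt0.
Qed.

Lemma measurable_via (B : pred vertex) S : measurable [set x : trajectory | B (x 1%N) /\ obeys S 1 x].
Proof. by apply: measurableI; [exact: measurable_pred_at|exact: measurable_obeys]. Qed.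

Lemma pr_start : pQ [set x | x 0%N = phi] = 1.
Proof. by rewrite /pr walkQ.1. Qed.

(** From a kid of the root other than [top], the base is reached through the
    root only, and [harm] vanishes there. *)
Lemma pr_side : pQ (DE `&` [set x | x 1%N != top]) = 0.
Proof.
apply/eqP; rewrite eq_le pr_ge0 andbT.
have mt := measurable_pred_at 1 (fun v => v != top).
have mD := measurableI _ _ measurable_deep mt.
rewrite -(prIr mD (measurable_at 0 phi) pr_start).
pose F k := [set x : trajectory | x 1%N != top /\ obeys (nseq k off_root ++ [:: at_vb]) 1 x].
have mF k : measurable (F k) by exact: (measurable_via (fun v => v != top)).
apply: (@le_trans _ _ (pQ (\bigcup_k F k))).
  apply: pr_le; first by apply: measurableI => //; exact: measurable_at.
    by apply: bigcup_measurable => k _.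
  move=> x [[/deep_excursionP[[|m] xm om] x1] /= x0].
    by move: vbp; rewrite -xm x0 eqxx.
  exists m => //; split => //; rewrite obeys_cat size_nseq obeys_nseq /=.
  split; last by rewrite add1n xm eqxx.
  by move=> i hi; apply: om; lia.
apply: pr_bigcup_le => // n; rewrite big1 // => k _.
rewrite (pr_second_step (fun v => v != top)) big_seq big1 // => y ys.
have [->|yt] /= := eqVneq y top; first by rewrite mul0r mulr0.
case: (boolP (prefix top y)) => ty; last first.
  suff -> : stay (nseq k off_root ++ [:: at_vb]) y = 0 by rewrite !mulr0.
  by apply/eqP; rewrite eq_le stay_ge0 // andbT -(harm_off ty); exact: visit_le_harm.
suff -> : step w phi y = 0 by rewrite mul0r.
apply: (mulfI (lt0r_neq0 (stationary_pos sphi))); rewrite mulr0 stationary_step ?stationary_pos // eqxx mul0r addr0.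
case: (boolP (kid phi y)) => [/kidP[j e]|]; last by rewrite mul0r.
move: ty yt; rewrite (e : y = [:: j]) prefixs1 (negbTE top_neq) /= => /eqP ->.
by rewrite eqxx.
Qed.

Lemma pr_deep_split E : measurable E -> E `<=` DE -> pQ E = pQ (E `&` [set x | x 1%N == top]).
Proof.
move=> mE ED; have mt := measurable_pred_at 1 (pred1 top).
rewrite (pr_split _ mE mt) -[RHS]addr0; congr (_ + _).
have mt' := measurable_pred_at 1 (fun v => v != top).
apply/eqP; rewrite eq_le pr_ge0 andbT -pr_side; apply: pr_le.
- by apply: measurableI => //; exact: measurableC.
- by apply: measurableI => //; exact: measurable_deep.
- by move=> x [/ED h1 h2]; split => //; exact/negP.
Qed.

(** The events [F k] below, that the base is hit for the first time at time
    [k.+1], are disjoint; their probabilities are [hits k top], with sum [harm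
    top]. *)
Lemma pr_deep : pQ DE = ptop * harm top.
Proof.
have mD := measurable_deep; have mt := measurable_pred_at 1 (pred1 top).
have mDt := measurableI _ _ mD mt.
pose F k := [set x : trajectory | x 1%N == top /\ obeys (nseq k off_ends ++ [:: at_vb]) 1 x].
have mF k : measurable (F k) by exact: (measurable_via (pred1 top)).
have mU : measurable (\bigcup_k F k) by apply: bigcup_measurable => k _.
have prF k : pQ (F k) = ptop * hits k top by rewrite pr_via_top.
have FP k x : F k x <-> [/\ x 1%N = top, forall i, (0 < i <= k)%N -> off_ends (x i) & x k.+1 = vb].
  rewrite /F /= obeys_cat size_nseq obeys_nseq /= add1n.
  split => [[/eqP h1 [h2 [/eqP h3 _]]]|[h1 h2 h3]].
    by split => // i hi; apply: h2; lia.
  split; first exact/eqP.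
  by split; [move=> i hi; apply: h2; lia|split => //; exact/eqP].
rewrite (pr_deep_split mD) //; apply/eqP; rewrite eq_le; apply/andP; split.
  rewrite -(prIr mDt (measurable_at 0 phi) pr_start).
  apply: (@le_trans _ _ (pQ (\bigcup_k F k))).
    apply: pr_le => //; first by apply: measurableI => //; exact: measurable_at.
    move=> x [[/deep_excursionP[m xm om] /eqP x1] /= x0].
    have ex : exists m, x m == vb by exists m; rewrite xm.
    case: (ex_minnP ex) => -[|k] /eqP xk kmin.
      by move: vbp; rewrite -xk x0 eqxx.
    exists k => //; apply/FP; split => // i /andP[i0 ik].
    rewrite /off_ends om /=; last by rewrite i0 /=; have := kmin m; rewrite xm eqxx => /(_ isT); lia.
    by apply/negP => /kmin; lia.
  apply: pr_bigcup_le => // n; under eq_bigr => i _ do rewrite prF.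
  by rewrite -mulr_sumr ler_pM2l ?ptop_gt0 // hits_le_harm // top_mem.
have DU : pQ (\bigcup_k F k) <= pQ (DE `&` [set x | x 1%N == top]).
  apply: pr_le => // x [k _ /FP[x1 hk xk]]; split; last by rewrite /= x1.
  apply/deep_excursionP; exists k.+1 => // i /andP[i0 ik].
  have [->|ne] := eqVneq i k.+1; first by rewrite xk.
  by have /andP[] : off_ends (x i) by apply: hk; lia.
apply: le_trans DU; apply: (@le_of_summable _ (fun n => ptop * free n top) _ _ (ptop * exit_bound top)).
  by move=> N; rewrite -mulr_sumr ler_pM2l ?ptop_gt0 // free_excess // top_mem.
move=> n; apply: (@le_trans _ _ (\sum_(i < n.+1) pQ (F i) + ptop * free n top)).
  under eq_bigr => i _ do rewrite prF.
  by rewrite -mulr_sumr -mulrDr ler_pM2l ?ptop_gt0 // harm_le_hits // top_mem.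
rewrite lerD2r; apply: pr_bigcup_ge => //.
move=> i j _ _ [x [/FP[_ hi xi] /FP[_ hj xj]]].
have [ij|ij|//] := ltngtP i j.
  by have := hj i.+1; rewrite ij /= /off_ends xi eqxx andbF => /(_ isT).
by have := hi j.+1; rewrite ij /= /off_ends xj eqxx andbF => /(_ isT).
Qed.

Definition late n := pQ (DE `&` off_until n.+1).

Lemma late_le n : late n <= ptop * alive n top.
Proof.
have mE := measurableI _ _ measurable_deep (measurable_off_until n.+1).
rewrite /late (pr_deep_split mE); last by move=> x [].
rewrite /alive -pr_via_top; apply: pr_le.
- by apply: measurableI => //; exact: (measurable_pred_at 1 (pred1 top)).
- exact: (measurable_via (pred1 top)).
move=> x [[_ ou] xt]; split => //.
by rewrite obeys_nseq => i hi; apply: ou; lia.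
Qed.

(** An excursion that is alive is deep unless it has avoided the base all
    along, which [free] accounts for. *)
Lemma late_ge n : ptop * (alive n top - free n top) <= late n.
Proof.
have mE := measurableI _ _ measurable_deep (measurable_off_until n.+1).
have mV := measurable_via (pred1 top) (nseq n.+1 off_ends).
rewrite mulrBr lerBlDr /alive /free -!pr_via_top.
apply: le_trans (prU_le Qw mE mV); apply: pr_le.
- exact: (measurable_via (pred1 top)).
- exact: measurableU.
move=> x [xt]; rewrite obeys_nseq => off.
have [[m /andP[hm /eqP xm]]|no] := pselect (exists m, (0 < m <= n.+1)%N && (x m == vb)).
  left; split.
    by apply/deep_excursionP; exists m => // i hi; apply: off; lia.
  by move=> i hi; apply: off; lia.
right; split => //; rewrite obeys_nseq => i hi; rewrite /off_ends.
apply/andP; split; first by apply: off; lia.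
by apply/negP => xi; apply: no; exists i; rewrite xi andbT; lia.
Qed.

Lemma late_decr n : late n.+1 <= late n.
Proof.
have md := measurable_deep; apply: pr_le.
- by apply: measurableI => //; exact: measurable_off_until.
- by apply: measurableI => //; exact: measurable_off_until.
by move=> x [h1 h2]; split => // i hi; apply: h2; lia.
Qed.

(** A positive integer time H is the number of n >= 0 with H > n. *)
Lemma return_time_series (x : trajectory) :
  (return_time R x = \sum_(0 <= n <oo) (\1_(off_until n) x)%:E)%E.
Proof.
have i01 n : (0 <= (\1_(off_until n) x : R)%:E)%E by rewrite lee_fin.
have [[k [k0 xk]]|no] := pselect (exists k, (0 < k)%N /\ x k = phi).
  have ex : exists k, (0 < k)%N && (x k == phi) by exists k; rewrite k0 xk eqxx.
  case: (ex_minnP ex) => m /andP[m0 /eqP xm] mmin.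
  have offP n : off_until n x <-> (n < m)%N.
    split=> [h|nm i /andP[i0 ik]].
      by rewrite ltnNge; apply/negP => mn; have := h m; rewrite m0 mn xm eqxx => /(_ isT).
    by apply/negP => xi; have := mmin i; rewrite i0 xi => /(_ isT); lia.
  rewrite (nneseries_split 0 m) // add0n eseries0 ?adde0; last first.
    move=> i mi _; rewrite indicE memNset // => /offP; lia.
  rewrite big_mkord (eq_bigr (fun=> 1%E)); last first.
    by move=> i _; rewrite indicE mem_set //; exact/offP.
  rewrite sumEFin sumr_const card_ord; apply/eqP; rewrite eq_le; apply/andP; split.
    by apply: ereal_inf_lbound; exists m.
  apply/ereal_infP => _ [i [mi xi] <-]; rewrite lee_fin ler_nat.
  by apply: mmin; rewrite mi xi eqxx.
have off n : off_until n x.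
  by move=> i /andP[i0 _]; apply/negP => /eqP xi; apply: no; exists i.
transitivity (+oo : \bar R)%E.
  rewrite /return_time /hitting_time (_ : [set _ | _ in _] = set0) ?ereal_inf0 //.
  by rewrite -subset0 => y [i [mi xi] _]; case: no; exists i.
apply/esym/eq_infty => r; pose N := (Num.truncn r).+1.
apply: (@le_trans _ _ (N%:R)%:E); first by rewrite lee_fin ltW // truncnS_gt.
apply: le_trans (nneseries_lim_ge N _) => //.
rewrite big_mkord (eq_bigr (fun=> 1%E)); last by move=> i _; rewrite indicE mem_set.
by rewrite sumEFin sumr_const card_ord.
Qed.

Lemma integral_return_time :
  (\int[Qw]_(x in DE) return_time R x = \sum_(0 <= n <oo) (pQ (DE `&` off_until n))%:E)%E.
Proof.
have mf n : measurable_fun DE (fun x => (\1_(off_until n) x : R)%:E).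
  apply/measurable_EFinP; apply: measurable_indic; exact: measurable_off_until.
under eq_integral => x _ do rewrite return_time_series.
rewrite (integral_nneseries Qw measurable_deep mf); last first.
  by move=> n x _; rewrite lee_fin.
apply: eq_eseriesr => n _.
rewrite integral_indic; [|exact: measurable_deep|exact: measurable_off_until].
rewrite setIC; apply: prE; apply: measurableI; [exact: measurable_deep|exact: measurable_off_until].
Qed.

Lemma return_time_gt_real (r : R) (x : trajectory) :
  (r%:E < return_time R x)%E <-> off_until (Num.truncn r) x.
Proof.
rewrite hitting_time_gt; split => h i.
  case: i => // i /andP[_ ir]; apply/negP => /eqP xi; have := h i.+1 isT xi.
  by rewrite -truncn_le_nat leqNgt ir.
case: i => // i _ xi; rewrite -truncn_le_nat leqNgt; apply/negP => ir.
by have := h i.+1; rewrite ir xi eqxx => /(_ isT).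
Qed.

(** * The exponential limit on a fixed tree *)

Local Notation e1 := (C * (del + p ^+ K)).
(* The rate of the exponential law that approximates the survival time. *)
Local Notation theta := (kappa / top_mass * harm top).

Lemma cancel_ratio (a b c : R) : 0 < a -> 0 < b -> a / b * (2 * c * (b / a)) = 2 * c.
Proof. by move=> a0 b0; field; rewrite !gt_eqF. Qed.

Lemma harm_top_gt0 : 0 < harm top.
Proof.
apply: lt_le_trans harm_top_ge; rewrite invr_gt0 mulr_gt0 //.
exact: lt_le_trans ltr01 C_ge1.
Qed.

Lemma theta_gt0 : 0 < theta.
Proof. exact: mulr_gt0 (divr_gt0 kappa_gt0 top_mass_gt0) harm_top_gt0. Qed.

Lemma theta_le : theta <= q * p ^+ K.
Proof.
apply: (@le_trans _ _ (kappa / top_mass)).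
  by rewrite ler_piMr ?harm_le1 ?top_mem // ltW // divr_gt0 ?kappa_gt0 ?top_mass_gt0.
by rewrite ler_pdivrMr ?top_mass_gt0 // top_mass_ge.
Qed.

Lemma e1_ge0 : 0 <= e1.
Proof.
have /andP[p0 _] := p_itv; have c1 := C_ge1; have d0 := del_ge0.
rewrite mulr_ge0 ?addr_ge0 ?exprn_ge0 ?(ltW p0) //; exact: le_trans c1.
Qed.

(** [perturbed_geometric] for the identity [mean_aliveS], whose defects are the
    excess times bounded by [exit_bound]. *)
Lemma mean_alive_exp N : e1 <= 2^-1 -> q * p ^+ K <= 2^-1 ->
  `|mean (alive N) - expR (- (theta * N%:R))| <= 10 * e1 + 2 * theta.
Proof.
move=> he hq; have k0 := kappa_gt0; have t0 := top_mass_gt0.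
have gm : 1 - mean harm <= e1.
  apply: le_trans mean_harm_ge _; rewrite mulrDr lerD2r.
  by rewrite ler_peMl // ?del_ge0 // C_ge1.
have gm1 : mean harm <= 1.
  by rewrite -[leRHS]mean_const; apply: mean_le => x xs _; exact: harm_le1.
have := @perturbed_geometric R (kappa / top_mass) (harm top) (mean harm)
  (2 * e1 * (top_mass / kappa)) (fun n => alive n vb) (fun n => mean (alive n)) (fun n => alive n top).
have -> : 3 * (kappa / top_mass * (2 * e1 * (top_mass / kappa))) = 6 * e1.
  by rewrite cancel_ratio //; ring.
move=> /(_ (divr_gt0 k0 t0)) h; apply: le_trans (h _ _ _ _ _ _ _ _ _ N) _.
- by rewrite (ltW harm_top_gt0) harm_le1 ?top_mem.
- by rewrite gm1 andbT; move: he gm; lra.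
- by rewrite theta_gt0 (le_trans theta_le).
- exact: mean_alive0.
- exact: mean_aliveS.
- by move=> n; apply: harm_le_alive; exact: top_mem.
- exact: mean_harm_le.
- move=> M; apply: le_trans (alive_excess _ top_mem) _.
  by apply: exit_bound_le; [exact: top_mem|exact: prefix_refl].
- exact: mean_excess.
move: gm; lra.
Qed.

(** The conditional law of the return time: P(H > n.+1 | DE). *)
Definition tail n := late n / pQ DE.

Lemma pr_deep_gt0 : 0 < pQ DE.
Proof. by rewrite pr_deep mulr_gt0 ?ptop_gt0 ?harm_top_gt0. Qed.

(** By [late_le] and [late_ge] the tail is [alive n top] over [harm top] up to
    [free n top], and the sums of [alive n top] telescope by [mean_aliveS]. *)
Lemma tail_sums N : `|theta * \sum_(n < N) tail n - (1 - mean (alive N))| <= 2 * e1.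
Proof.
have k0 := kappa_gt0; have t0 := top_mass_gt0; have h0 := harm_top_gt0; have pt := ptop_gt0.
have -> : 1 - mean (alive N) = kappa / top_mass * \sum_(n < N) alive n top.
  elim: N => [|N IH]; first by rewrite big_ord0 mulr0 mean_alive0 subrr.
  by rewrite big_ord_recr /= mulrDr -IH mean_aliveS; ring.
have -> : theta * \sum_(n < N) tail n = kappa / top_mass * ((\sum_(n < N) late n) / ptop).
  rewrite -mulr_suml pr_deep; move: (\sum_(n < N) late n) => S.
  move: k0 t0 h0 pt; move: (kappa) (top_mass) (harm top) ptop => k T g1 p1 k0 t0 h0 pt.
  by field; rewrite !gt_eqF.
have h1 : (\sum_(n < N) late n) / ptop <= \sum_(n < N) alive n top.
  rewrite ler_pdivrMr // mulrC mulr_sumr; apply: ler_sum => n _; exact: late_le.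
have h2 : \sum_(n < N) alive n top - \sum_(n < N) free n top <= (\sum_(n < N) late n) / ptop.
  rewrite ler_pdivlMr // mulrC -sumrB mulr_sumr; apply: ler_sum => n _; exact: late_ge.
have h3 : \sum_(n < N) free n top <= 2 * e1 * (top_mass / kappa).
  apply: le_trans (free_excess _ top_mem) _; apply: exit_bound_le; [exact: top_mem|exact: prefix_refl].
have kt : 0 < kappa / top_mass by rewrite divr_gt0.
have e : kappa / top_mass * (2 * e1 * (top_mass / kappa)) = 2 * e1.
  exact: cancel_ratio.
rewrite -mulrBr normrM (gtr0_norm kt) -e ler_pM2l //.
by rewrite ler_norml; apply/andP; split; lra.
Qed.

Lemma tail_decr n : tail n.+1 <= tail n.
Proof. by rewrite /tail ler_pM2r ?invr_gt0 ?pr_deep_gt0 // late_decr. Qed.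

Lemma deep_off0 : DE `&` off_until 0 = DE.
Proof. by apply/seteqP; split => x; [case|split => // i; rewrite leqn0; case: i]. Qed.

(** The mean is one plus the sum of the tail, as H > 0 surely. It is
    characterized as a least upper bound, which is all that the comparison with
    [theta] uses. *)
Lemma mean_return_timeE : exists M : R,
  [/\ cond_expect Qw DE (return_time R) = M%:E,
      forall N, 1 + \sum_(n < N) tail n <= M &
      forall c, (forall N, 1 + \sum_(n < N) tail n <= c) -> M <= c].
Proof.
have D0 := pr_deep_gt0; have th0 := theta_gt0.
have sums N : \sum_(n < N.+1) pQ (DE `&` off_until n) = pQ DE * (1 + \sum_(n < N) tail n).
  rewrite big_ord_recl deep_off0 mulrDr mulr1 mulr_sumr; congr (_ + _).
  by apply: eq_bigr => i _; rewrite /tail mulrC divfK // gt_eqF.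
have sum_mono N : \sum_(n < N) pQ (DE `&` off_until n) <= \sum_(n < N.+1) pQ (DE `&` off_until n).
  by rewrite big_ord_recr /= lerDl pr_ge0.
have bounded N : 1 + \sum_(n < N) tail n <= 1 + (1 + 2 * e1) / theta.
  rewrite lerD2l ler_pdivlMr // mulrC.
  have := tail_sums N; rewrite ler_norml => /andP[_].
  have : 0 <= mean (alive N).
    by rewrite -[leLHS]mean_const; apply: mean_le => x xs _; exact: stay_ge0.
  lra.
have fB N : \sum_(n < N) pQ (DE `&` off_until n) <= pQ DE * (1 + (1 + 2 * e1) / theta).
  by apply: le_trans (sum_mono N) _; rewrite sums ler_pM2l.
have [M [ME M1 M2]] := nneseries_bounded (fun n => pr_ge0 Qw (DE `&` off_until n)) fB.
exists (M / pQ DE); split.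
- rewrite /cond_expect integral_return_time ME (prE Qw measurable_deep) inver gt_eqF //.
- by move=> N; rewrite ler_pdivlMr // mulrC -sums.
- move=> c hc; rewrite ler_pdivrMr // mulrC; apply: M2 => N.
  by apply: le_trans (sum_mono N) _; rewrite sums ler_pM2l.
Qed.

Lemma cond_prob_late (t M : R) : 0 < M ->
  cond_prob Qw DE [set x | (t%:E < return_time R x / M%:E)%E] =
  (pQ (DE `&` off_until (Num.truncn (t * M))) / pQ DE)%:E.
Proof.
move=> M0; have D0 := pr_deep_gt0.
rewrite /cond_prob (_ : _ `&` DE = DE `&` off_until (Num.truncn (t * M))).
  rewrite !prE ?inver ?gt_eqF //; first exact: measurable_deep.
  by apply: measurableI; [exact: measurable_deep|exact: measurable_off_until].
rewrite setIC; congr (_ `&` _); apply/seteqP; split => x /=.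
  by rewrite inver gt_eqF // lte_pdivlMr // -EFinM => /return_time_gt_real.
by move=> ou; rewrite inver gt_eqF // lte_pdivlMr // -EFinM; apply/return_time_gt_real.
Qed.

Lemma cond_prob_late_le1 (t : R) :
  (cond_prob Qw DE [set x | (t%:E < return_time R x / cond_expect Qw DE (return_time R))%E] <= 1)%E.
Proof.
have [M [-> M1 _]] := mean_return_timeE.
have M0 : 0 < M by apply: lt_le_trans (M1 0%N); rewrite big_ord0 addr0.
rewrite cond_prob_late // lee_fin ler_pdivrMr ?pr_deep_gt0 // mul1r.
apply: pr_le; [|exact: measurable_deep|exact: subIsetl].
by apply: measurableI; [exact: measurable_deep|exact: measurable_off_until].
Qed.

(** The tail has partial sums close to those of the exponential law of rate
    [theta]; letting their number grow, the mean [M] is close to the inverse of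
    [theta], and [tail_modulus] applies. *)
Lemma tree_exponential (t dd eps : R) : 0 < t -> dd <= 2^-1 -> dd <= t / 2 ->
  tail_modulus t eps dd ->
  12 * e1 + 3 * (q * p ^+ K) <= dd ->
  exists2 r : R, cond_prob Qw DE
    [set x | (t%:E < return_time R x / cond_expect Qw DE (return_time R))%E] = r%:E &
    `|r - expR (- t)| <= eps.
Proof.
move=> t0 d1 d2 main small.
have D0 := pr_deep_gt0; have th0 := theta_gt0; have th1 := theta_le; have e0 := e1_ge0.
have [M [ME M1 M2]] := mean_return_timeE; rewrite ME.
have he : e1 <= 2^-1 by lra.
have hq : q * p ^+ K <= 2^-1 by lra.
have sums N : `|theta * \sum_(n < N) tail n - (1 - expR (- (theta * N%:R)))| <= 12 * e1 + 2 * theta.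
  have := tail_sums N; have := mean_alive_exp N he hq.
  by rewrite !ler_norml => /andP[? ?] /andP[? ?]; apply/andP; split; lra.
have Mhi : theta * M <= 1 + 12 * e1 + 3 * theta.
  suff : M <= (1 + 12 * e1 + 3 * theta) / theta by rewrite ler_pdivlMr // mulrC.
  apply: M2 => N; rewrite ler_pdivlMr // mulrDl mul1r [_ * theta]mulrC.
  have := sums N; rewrite ler_norml => /andP[_].
  have := expR_ge0 (- (theta * N%:R)). lra.
have Mlo : 1 - 12 * e1 - 2 * theta <= theta * M.
  apply: (@le_of_summable _ (fun n => expR (- (theta * n%:R))) _ _ (1 - expR (- theta))^-1).
    by move=> N; exact: sum_expN.
  move=> N; have := sums N; rewrite ler_norml => /andP[+ _].
  have : theta * (1 + \sum_(n < N) tail n) <= theta * M by rewrite ler_pM2l.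
  rewrite mulrDr mulr1; lra.
have tM1 : 1 <= t * M.
  have a1 : t * 2^-1 <= t * (theta * M) by rewrite ler_pM2l //; lra.
  have a2 : theta <= t * 2^-1 by lra.
  have := le_trans a2 a1; rewrite [t * (theta * M)]mulrCA -[X in X <= _]mulr1.
  by rewrite ler_pM2l.
have M0 : 0 < M by have := lt_le_trans ltr01 tM1; rewrite pmulr_rgt0.
have tr : (0 < Num.truncn (t * M))%N by rewrite truncn_gt0.
exists (tail (Num.truncn (t * M)).-1).
  by rewrite cond_prob_late // /tail /late prednK.
apply: (main _ theta M) => //.
- by rewrite th0; lra.
- exact: tail_decr.
- by move=> N; apply: le_trans (sums N) _; lra.
- by rewrite ler_norml; apply/andP; split; lra.
- by rewrite prednK //; have /andP[] := truncn_itv (le_trans ler01 tM1).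
- by rewrite prednK //; have /andP[] := truncn_itv (le_trans ler01 tM1).
Qed.

End FiniteTree.

(** * Environments and their trees *)

Section Environments.
Variable R : realType.

(** Labels for all the words, inside the tree or not: the offspring number and
    the bias of the edge to the parent. Subtrees are then shifts of the
    labelling, which makes them independent under [gw_family]. *)
Definition env : Type := vertex -> nat * R.

HB.instance Definition _ := Pointed.on env.

Definition shift (i : nat) (e : env) : env := fun v => e (i :: v).

Definition offspring (e : env) := (e [::]).1.

(** The event [A] that concerns a kid may depend on the number of its siblings,
    because a weight is shared out among all of them. *)
Definition has_child (A : nat -> set env) : set env :=
  [set e | exists2 i, (1 <= i <= offspring e)%N & A (offspring e) (shift i e)].

Definition has_pair (A A' : nat -> set env) : set env :=
  [set e | exists i j, [/\ (1 <= i <= offspring e)%N, (1 <= j <= offspring e)%N, i != j,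
     A (offspring e) (shift i e) & A' (offspring e) (shift j e)]].

Fixpoint level k (A : set env) : set env :=
  if k is k'.+1 then has_child (fun=> level k' A) else A.

Definition progeny (e : env) : set vertex := gw_tree (fun v => (e v).1).

Lemma progeny_nil e : progeny e [::].
Proof. by []. Qed.

Lemma progeny_cons e j u :
  progeny e (j :: u) <-> (1 <= j <= offspring e)%N /\ progeny (shift j e) u.
Proof.
split=> [H|[hj H] [|i] //= hi]; last exact: H.
split; first exact: (H 0%N isT).
by move=> i hi; exact: (H i.+1).
Qed.

Definition tall N : set env := level N setT.

Lemma tallP N e : tall N e <-> exists2 v, size v = N & progeny e v.
Proof.
elim: N e => [|N IH] e /=; first by split => // _; exists [::].
split=> [[i hi /IH[v sv pv]]|[[|i v]//= [sv] /progeny_cons[hi pv]]].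
  by exists (i :: v); rewrite /= ?sv //; apply/progeny_cons.
by exists i => //; apply/IH; exists v.
Qed.

Definition short N (e : env) := forall v, progeny e v -> (size v < N)%N.

Lemma progeny_take e v i : progeny e v -> progeny e (take i v).
Proof.
elim: v e i => [|j v IH] e [|i] //= /progeny_cons[hj pv].
by apply/progeny_cons; split => //; exact: IH.
Qed.

Lemma shortP N e : short N e <-> ~ tall N e.
Proof.
split=> [sh /tallP[v sv /sh]|nt v pv]; first by rewrite sv ltnn.
rewrite ltnNge; apply/negP => Nv; apply/nt/tallP; exists (take N v).
  by rewrite size_takel.
exact: progeny_take.
Qed.

Lemma short_shift N e j : (1 <= j <= offspring e)%N -> short N.+1 e -> short N (shift j e).
Proof. by move=> hj sh u pu; have := sh (j :: u); apply; apply/progeny_cons. Qed.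

Lemma short_le N N' e : (N <= N')%N -> short N e -> short N' e.
Proof. by move=> NN sh v /sh /leq_trans; apply. Qed.

Definition finite_progeny (e : env) := exists N, short N e.

Lemma finite_progeny_shift e j : (1 <= j <= offspring e)%N -> finite_progeny e -> finite_progeny (shift j e).
Proof.
move=> hj [N sh]; exists N; apply: (short_shift hj); exact: short_le sh.
Qed.

Definition wt (e : env) (v : vertex) : R := \prod_(i < size v) (e (take i.+1 v)).2.

Lemma wt_nil e : wt e [::] = 1.
Proof. by rewrite /wt big_ord0. Qed.

Lemma wt_cons e j u : wt e (j :: u) = (e [:: j]).2 * wt (shift j e) u.
Proof. by rewrite /wt big_ord_recl /= take0. Qed.

Fixpoint vertices N (e : env) : seq vertex :=
  if N is N'.+1 then [::] :: [seq j :: u | j <- iota 1 (offspring e), u <- vertices N' (shift j e)]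
  else [::].

Lemma mem_vertices N e v : (v \in vertices N e) <-> progeny e v /\ (size v < N)%N.
Proof.
elim: N e v => [|N IH] e v /=; first by split => // -[].
rewrite inE; case: v => [|j u] /=; first by split.
split.
  move=> /allpairsPdep[j' [u' [hj /IH[pu su] [-> ->]]]]; split => //.
  by apply/progeny_cons; split => //; move: hj; rewrite mem_iota; lia.
move=> [/progeny_cons[hj pu] su]; apply/allpairsPdep; exists j, u; split => //.
  by rewrite mem_iota; lia.
by apply/IH.
Qed.

Lemma vertices_uniq N e : uniq (vertices N e).
Proof.
elim: N e => //= N IH e; apply/andP; split.
  by apply/negP => /allpairsPdep[j' [u' [_ _]]].
apply: allpairs_uniq_dep => //; first exact: iota_uniq.
by move=> [j u] [j' u'] _ _ /= [-> ->].
Qed.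

Definition weighted (e : env) : wtree R := WTree (progeny e) (fun v => (e v).2).

Definition tw (e : env) : R := total_weight (weighted e).

Lemma progeny_vertices N e : short N e -> progeny e = [set` vertices N e].
Proof.
by move=> sh; apply/seteqP; split => v /=; rewrite mem_vertices => // pv; [split => //; exact: sh|case: pv].
Qed.

Lemma tw_vertices N e : short N e -> tw e = \sum_(v <- vertices N e) wt e v.
Proof.
move=> sh; rewrite /tw /total_weight /= (progeny_vertices sh) -fsbig_seq //.
exact: vertices_uniq.
Qed.

Lemma tw_children e : finite_progeny e ->
  tw e = 1 + \sum_(j <- iota 1 (offspring e)) (e [:: j]).2 * tw (shift j e).
Proof.
move=> [N sh]; rewrite (@tw_vertices N.+1); last exact: short_le sh.
rewrite /= big_cons wt_nil; congr (_ + _); rewrite big_allpairs_dep big_seq [RHS]big_seq.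
apply: eq_bigr => j; rewrite mem_iota => hj; rewrite (@tw_vertices N); last first.
  by apply: short_shift; [lia|exact: short_le sh].
by rewrite mulr_sumr; apply: eq_bigr => u _; rewrite wt_cons.
Qed.

Definition heavy (u : R) : set env := [set e | finite_progeny e /\ u < tw e].

Lemma heavy_le u u' : u <= u' -> heavy u' `<=` heavy u.
Proof. by move=> uu e [fe ue]; split => //; exact: le_lt_trans ue. Qed.

Definition shifts (v : vertex) (e : env) : env := fun u => e (v ++ u).

Lemma levelP k (A : set env) e :
  level k A e <-> exists v, [/\ size v = k, progeny e v & A (shifts v e)].
Proof.
elim: k e => [|k IH] e /=.
  split=> [Ae|[v [/size0nil -> _]]] //; by exists [::].
split=> [[i hi /IH[v [sv pv Av]]]|[v [sv pv Av]]].
  by exists (i :: v); rewrite /= sv; split => //; apply/progeny_cons.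
case: v sv pv Av => // i v [sv] /progeny_cons[hi pv] Av.
by exists i => //; apply/IH; exists v.
Qed.

Lemma progeny_cat e v u : progeny e v -> progeny (shifts v e) u -> progeny e (v ++ u).
Proof.
elim: v e => [|j v IH] e //= /progeny_cons[hj pv] pu.
by apply/progeny_cons; split => //; exact: IH.
Qed.

Lemma sum_prefix N e v : short N e -> progeny e v ->
  \sum_(u <- vertices N e | prefix v u) wt e u = wt e v * tw (shifts v e).
Proof.
elim: v e N => [|j v IH] e N sh pv.
  rewrite wt_nil mul1r -[shifts _ _]/e (tw_vertices sh).
  by apply: eq_bigl => u; rewrite prefix0s.
case: N sh => [|N] sh; first by have := sh _ (progeny_nil e).
have [hj pv'] := (progeny_cons _ _ _).1 pv.
rewrite /= big_cons /= big_mkcond big_allpairs_dep /=.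
rewrite (bigD1_seq j) ?iota_uniq //=; last by rewrite mem_iota add1n ltnS.
rewrite [X in _ + X]big1 ?addr0; last first.
  by move=> i ij; apply: big1 => u _; rewrite eq_sym (negbTE ij).
rewrite wt_cons -mulrA -[shifts _ _]/(shifts v (shift j e)).
rewrite -(IH _ N (short_shift hj sh) pv') mulr_sumr [RHS]big_mkcond; apply: eq_bigr => u _.
by rewrite eqxx wt_cons.
Qed.

Definition stout N u : set env := heavy u `&` ~` tall N.

(** What prevents the weight, or the height, from being concentrated above one
    kid. With [n] kids the threshold is [s / n], so that the kids below it
    weigh at most [s] altogether. *)
Definition fork N s : set env :=
  has_pair (fun n => heavy (s / n%:R)) (fun n => heavy (s / n%:R) `|` tall N).

(** Nearly all the weight, and all the vertices of maximal height, lie above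
    [v]; hence [v] lies on the path to the base. *)
Definition concentrated_at k (del : R) (e : env) : Prop :=
  exists v M, [/\ size v = k, progeny e v,
    tw e - wt e v * tw (shifts v e) <= del * tw e,
    (forall u, progeny e u -> ~~ prefix v u -> (size u < M)%N) &
    exists2 u, progeny e u & size u = M].

End Environments.

Section BoundedBiases.
Variables (R : realType) (q Q : R).
Hypothesis q1 : 1 < q.
Hypothesis qQ : q < Q.

Local Notation env := (env R).

Lemma Q_gt0 : 0 < Q. Proof. exact: lt_trans (lt_trans ltr01 q1) qQ. Qed.

Lemma Q_gt1 : 1 < Q. Proof. exact: lt_trans q1 qQ. Qed.

Definition bounded_bias (e : env) := forall v, q <= (e v).2 <= Q.

Definition good : set env := [set e | finite_progeny e /\ bounded_bias e].

Lemma good_shift e j : (1 <= j <= offspring e)%N -> good e -> good (shift j e).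
Proof. by move=> hj [fe be]; split; [exact: finite_progeny_shift|move=> v; exact: be]. Qed.

Lemma tw_ge1 e : good e -> 1 <= tw e.
Proof.
move=> [[N sh] be]; elim: N e sh be => [|N IH] e sh be; first by have := sh _ (progeny_nil e).
rewrite tw_children; last by exists N.+1.
rewrite lerDl big_seq sumr_ge0 // => j; rewrite mem_iota => hj.
have hj' : (1 <= j <= offspring e)%N by lia.
have /andP[b1 b2] := be [:: j].
have := IH _ (short_shift hj' sh) (fun v => be (j :: v)).
have := lt_trans ltr01 q1 => q0 t1; rewrite mulr_ge0 //; [exact: le_trans (ltW q0) b1|exact: le_trans t1].
Qed.

Lemma bias_itv e v : good e -> q <= (e v).2 <= Q.
Proof. by move=> [_]; apply. Qed.

Lemma bias_ge0 e v : good e -> 0 <= (e v).2.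
Proof.
by move=> /(@bias_itv _ v) /andP[+ _]; apply: le_trans; exact/ltW/(lt_trans ltr01 q1).
Qed.

Lemma tw_ge0 e : good e -> 0 <= tw e.
Proof. by move=> /tw_ge1; exact: le_trans. Qed.

Lemma tw_split e j : good e -> (1 <= j <= offspring e)%N ->
  tw e = 1 + (e [:: j]).2 * tw (shift j e) +
   \sum_(i <- iota 1 (offspring e) | i != j) (e [:: i]).2 * tw (shift i e).
Proof.
move=> ge hj; rewrite (tw_children ge.1) (bigD1_seq j) ?iota_uniq ?addrA //.
by rewrite mem_iota; lia.
Qed.

Lemma tw_child_le e j : good e -> (1 <= j <= offspring e)%N ->
  (e [:: j]).2 * tw (shift j e) <= tw e.
Proof.
move=> ge hj; rewrite (tw_split ge hj) addrAC lerDr addr_ge0 // big_seq_cond sumr_ge0 // => i.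
rewrite mem_iota => /andP[hi _]; rewrite mulr_ge0 ?bias_ge0 //; apply/tw_ge0/good_shift => //.
Qed.

(** The pigeonhole principle. *)
Lemma heavy_child e s : good e -> 0 <= s -> 1 + Q * s < tw e ->
  exists2 j, (1 <= j <= offspring e)%N & s / (offspring e)%:R < tw (shift j e).
Proof.
move=> ge s0 hs; apply: contrapT => no.
have light j : (1 <= j <= offspring e)%N -> tw (shift j e) <= s / (offspring e)%:R.
  by move=> hj; rewrite leNgt; apply/negP => hl; apply: no; exists j.
move: hs; rewrite (tw_children ge.1) ltrD2l ltNge => /negP; apply.
apply: (@le_trans _ _ (\sum_(j <- iota 1 (offspring e)) Q * (s / (offspring e)%:R))).
  rewrite big_seq [leRHS]big_seq; apply: ler_sum => j; rewrite mem_iota => hj.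
  have hj' : (1 <= j <= offspring e)%N by lia.
  have /andP[_ b2] := bias_itv [:: j] ge.
  apply: ler_pM => //; [exact: bias_ge0|exact/tw_ge0/good_shift|exact: light].
rewrite big_const_seq count_predT size_iota iter_addr_0 -[leLHS]mulr_natl mulrCA.
apply: ler_wpM2l; first exact/ltW/Q_gt0.
have [->|n_gt0] := posnP (offspring e); first by rewrite mul0r.
by rewrite mulrC divfK // pnatr_eq0 -lt0n.
Qed.

Fixpoint spill k (s : R) : R := if k is k'.+1 then 1 + Q * s + Q * spill k' s else 0.

Lemma spill_ge0 k s : 0 <= s -> 0 <= spill k s.
Proof.
move=> s0; elim: k => //= k IH; rewrite !addr_ge0 ?mulr_ge0 //; exact/ltW/Q_gt0.
Qed.

Lemma spill_le k s : 0 <= s -> spill k s <= (1 + s) * (k%:R * Q ^+ k).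
Proof.
move=> s0; have Qp := ltW Q_gt0; have Q1' := ltW Q_gt1.
elim: k => [|k IH] /=; first by rewrite mul0r mulr0.
have h1 : Q * spill k s <= Q * ((1 + s) * (k%:R * Q ^+ k)) by exact: ler_wpM2l.
have h2 : 1 <= Q ^+ k by exact: exprn_ege1.
have h3 : Q * (1 + s) * 1 <= Q * (1 + s) * Q ^+ k.
  by apply: ler_wpM2l => //; rewrite mulr_ge0 // addr_ge0.
rewrite exprS -natr1.
have -> : (1 + s) * ((k%:R + 1) * (Q * Q ^+ k)) =
  Q * ((1 + s) * (k%:R * Q ^+ k)) + Q * (1 + s) * Q ^+ k by ring.
lra.
Qed.

Lemma good_shifts v e : progeny e v -> good e -> good (shifts v e).
Proof.
elim: v e => [|j v IH] e; first by [].
by move=> /progeny_cons[hj pv] ge; apply: (IH (shift j e)) => //; exact: good_shift.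
Qed.

(** Follow the heavy kid at each of [k] generations. As long as no fork is met,
    the other kids are light and short, and what they weigh adds up, multiplied
    by at most [Q] at each generation, to [spill k s]. *)
Lemma trunk_path N s k e : good e -> 0 <= s -> spill k s < tw e ->
  (forall i, (i < k)%N -> ~ level i (fork N s) e) ->
  exists v, [/\ size v = k, progeny e v,
    tw e - wt e v * tw (shifts v e) <= spill k s &
    forall u, progeny e u -> ~~ prefix v u -> (size u < k + N)%N].
Proof.
elim: k e => [|k IH] e ge s0 /= hs nofork.
  exists [::]; rewrite wt_nil mul1r (_ : shifts _ _ = e) // subrr; split => // u _.
  by rewrite prefix0s.
have sp0 := spill_ge0 k s0; have Qp := Q_gt0.
have Qsp : 0 <= Q * spill k s by rewrite mulr_ge0 // ltW.
have hs1 : 1 + Q * s < tw e by apply: le_lt_trans hs; rewrite lerDl.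
have [j hj tj] := heavy_child ge s0 hs1.
have gj := good_shift hj ge.
have others i : (1 <= i <= offspring e)%N -> i != j ->
    tw (shift i e) <= s / (offspring e)%:R /\ short N (shift i e).
  move=> hi ij; have gi := good_shift hi ge.
  have nf := nofork 0%N isT.
  split.
    rewrite leNgt; apply/negP => ti; apply: nf; exists j, i; split => //; first by rewrite eq_sym.
      by split => //; exact: gj.1.
    by left; split => //; exact: gi.1.
  apply/shortP => ta; apply: nf; exists j, i; split => //; first by rewrite eq_sym.
    by split => //; exact: gj.1.
  by right.
have /andP[b1 b2] := bias_itv [:: j] ge; have b0 := bias_ge0 [:: j] ge.
have rest : tw e - (e [:: j]).2 * tw (shift j e) <= 1 + Q * s.
  have -> : tw e - (e [:: j]).2 * tw (shift j e) =
    1 + \sum_(i <- iota 1 (offspring e) | i != j) (e [:: i]).2 * tw (shift i e).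
    by rewrite {1}(tw_split ge hj); ring.
  rewrite lerD2l; have n_gt0 : (0 < offspring e)%N by have /andP[j0 jn] := hj; exact: leq_trans j0 jn.
  have nR : 0 < (offspring e)%:R :> R by rewrite ltr0n.
  apply: (@le_trans _ _ (\sum_(i <- iota 1 (offspring e)) Q * (s / (offspring e)%:R))).
    rewrite big_mkcond big_seq [leRHS]big_seq; apply: ler_sum => i; rewrite mem_iota => hi.
    have hi' : (1 <= i <= offspring e)%N by move: hi; rewrite add1n ltnS.
    case: ifPn => [ij|_]; last by rewrite mulr_ge0 ?divr_ge0 // ltW.
    have /andP[_ c2] := bias_itv [:: i] ge; have [ti _] := others i hi' ij.
    by apply: ler_pM => //; [exact: bias_ge0|exact/tw_ge0/good_shift].
  rewrite big_const_seq count_predT size_iota iter_addr_0 -[leLHS]mulr_natl mulrCA.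
  by rewrite [X in Q * X <= _]mulrC divfK // gt_eqF.
have tj' : spill k s < tw (shift j e).
  have t0 := tw_ge0 gj.
  have : (e [:: j]).2 * tw (shift j e) <= Q * tw (shift j e) by exact: ler_wpM2r.
  rewrite -(ltr_pM2l Qp); lra.
have nf i : (i < k)%N -> ~ level i (fork N s) (shift j e).
  by move=> ik lv; apply: (nofork i.+1) => //=; exists j.
have [v [sv pv dv hv]] := IH _ gj s0 tj' nf.
exists (j :: v); split.
- by rewrite /= sv.
- exact/progeny_cons.
- rewrite wt_cons -[shifts _ _]/(shifts v (shift j e)).
  have : (e [:: j]).2 * (tw (shift j e) - wt (shift j e) v * tw (shifts v (shift j e))) <= Q * spill k s.
    apply: (@le_trans _ _ ((e [:: j]).2 * spill k s)); first exact: ler_wpM2l.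
    exact: ler_wpM2r.
  move: rest; lra.
move=> [|i u] pu; first by move=> _; rewrite addSn.
move: pu => /progeny_cons[hi pu]; rewrite prefix_cons.
have [ij|ij] := eqVneq j i.
  by rewrite -ij in pu; move=> /(hv _ pu); rewrite /= addSn ltnS.
move=> _; rewrite /= addSn ltnS; apply: leq_trans (leq_addl _ _).
by rewrite eq_sym in ij; have [_ sh] := others i hi ij; exact: sh.
Qed.

Lemma wt_le e v : good e -> progeny e v -> 0 <= wt e v <= Q ^+ size v.
Proof.
elim: v e => [|j v IH] e ge; first by rewrite wt_nil ler01 /=.
move=> /progeny_cons[hj pv]; rewrite wt_cons /= exprS.
have /andP[w1 w2] := IH _ (good_shift hj ge) pv.
have b0 := bias_ge0 [:: j] ge; have /andP[_ b2] := bias_itv [:: j] ge.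
by rewrite mulr_ge0 //= ler_pM.
Qed.

End BoundedBiases.

(** * Random environments and the branching property *)

Section Environment.
Variables (R : realType) (h : probability nat R) (nu : probability (measurableTypeR R) R).
Variables (d : measure_display) (Omega : measurableType d) (P : probability Omega R).
Variables (K : vertex -> {RV P >-> nat}) (B : vertex -> {RV P >-> measurableTypeR R}).
Hypothesis KB : gw_family h nu K B.

Local Notation env := (env R).

Definition box (s : seq vertex) (a : vertex -> set nat) (b : vertex -> set (measurableTypeR R)) : set env :=
  [set e | forall v, v \in s -> a v (e v).1 /\ b v (e v).2].

(** A family of events that is stable under intersection, generates a
    sigma-algebra on environments, and whose probabilities [gw_family] gives.
    *)
Definition boxes : set (set env) :=
  [set A | exists s a b, [/\ uniq s, forall v, measurable (b v) & A = box s a b]].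

Notation envm := (g_sigma_algebraType boxes).

Lemma boxesT : boxes setT.
Proof.
exists [::], (fun=> setT), (fun=> setT); split => //.
by apply/seteqP; split.
Qed.

Lemma boxesI : setI_closed boxes.
Proof.
move=> _ _ [s1 [a1 [b1 [u1 m1 ->]]]] [s2 [a2 [b2 [u2 m2 ->]]]].
exists (undup (s1 ++ s2)),
  (fun v => (if v \in s1 then a1 v else setT) `&` (if v \in s2 then a2 v else setT)),
  (fun v => (if v \in s1 then b1 v else setT) `&` (if v \in s2 then b2 v else setT)).
split; first exact: undup_uniq.
  by move=> v; apply: measurableI; case: ifP.
apply/seteqP; split => e /= => [[h1 h2] v|hb].
  rewrite mem_undup mem_cat => hv.
  by case: (boolP (v \in s1)) (h1 v) => [_ /(_ isT)[? ?]|_ _];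
     case: (boolP (v \in s2)) (h2 v) => [_ /(_ isT)[? ?]|_ _].
split => v vs; have := hb v; rewrite mem_undup mem_cat vs ?orbT => /(_ isT)[[? ?] [? ?]] //.
Qed.

Definition sample (o : Omega) : env := fun v => (K v o, B v o).

Lemma sample_box s a b :
  sample @^-1` box s a b = \bigcap_(v in [set` s]) (K v @^-1` a v `&` B v @^-1` b v).
Proof. by apply/seteqP; split => o /= hv v /= vs; exact: hv. Qed.

Lemma measurable_sample (A : set envm) : measurable A -> measurable (sample @^-1` A).
Proof.
move=> mA; pose G := [set A : set env | measurable (sample @^-1` A)].
apply: (@smallest_sub _ (sigma_algebra setT) boxes G _ _ A mA).
  split => [|X mX|F mF].
  - by rewrite /G /= preimage_set0.
  - by rewrite /G /= setTD preimage_setC; apply: measurableC; exact: mX.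
  - by rewrite /G /= preimage_bigcup; apply: bigcup_measurable => k _; exact: mF.
move=> _ [s [a [b [_ mb ->]]]]; rewrite /G /= sample_box.
apply: fin_bigcap_measurable => // v _; apply: measurableI.
  exact: measurable_funPTI.
by apply: measurable_funPTI; exact: mb.
Qed.

Definition mu (A : set env) : R := pr P (sample @^-1` A).

Lemma mu_box s a b : uniq s -> (forall v, measurable (b v)) ->
  mu (box s a b) = \prod_(v <- s) (pr h (a v) * pr nu (b v)).
Proof.
move=> us mb; rewrite /mu /pr sample_box KB // -/(pr h _).
elim: s {us} => [|v s IH]; first by rewrite !big_nil.
rewrite !big_cons -IH fineM ?fineM //.
- by rewrite fin_num_measure.
- by rewrite fin_num_measure.
- by rewrite fin_numM // fin_num_measure.
- elim: s {IH} => [|v' s IH]; first by rewrite big_nil.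
  by rewrite big_cons !fin_numM // fin_num_measure.
Qed.

(** The labels of the root, of the words that begin with [i] and of those that
    begin with [j] are disjoint families. *)
Lemma branching_box i j n s1 a1 b1 s2 a2 b2 : i != j ->
  uniq s1 -> (forall v, measurable (b1 v)) -> uniq s2 -> (forall v, measurable (b2 v)) ->
  mu [set e | [/\ offspring e = n, box s1 a1 b1 (shift i e) & box s2 a2 b2 (shift j e)]] =
  pr h [set n] * mu (box s1 a1 b1) * mu (box s2 a2 b2).
Proof.
move=> ij u1 m1 u2 m2.
pose s := [::] :: map (cons i) s1 ++ map (cons j) s2.
pose a (v : vertex) := if v is k :: u then if k == i then a1 u else a2 u else [set n].
pose b (v : vertex) : set (measurableTypeR R) :=
  if v is k :: u then if k == i then b1 u else b2 u else setT.
have ji : (j == i) = false by rewrite eq_sym (negbTE ij).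
rewrite (_ : [set _ | _] = box s a b); last first.
  apply/seteqP; split => e.
    move=> /= [e0 h1 h2] v; rewrite inE mem_cat => /orP[/eqP -> //|].
    by case/orP => /mapP[u us ->] /=; rewrite ?eqxx ?ji; [exact: h1|exact: h2].
  move=> hb; split => /=.
  - by have [] := hb [::] isT.
  - move=> u us; move: (hb (i :: u)); rewrite /= eqxx; apply.
    by rewrite inE mem_cat map_f ?orbT.
  - move=> u us; move: (hb (j :: u)); rewrite /= ji; apply.
    by rewrite inE mem_cat (map_f (cons j)) ?orbT.
have mb v : measurable (b v) by case: v => [|k u] //=; case: ifP.
have us : uniq s.
  rewrite /s /= cat_uniq !map_inj_uniq ?u1 ?u2; try by move=> x y [].
  rewrite mem_cat negb_or /= andbT; apply/andP; split.
    by apply/andP; split; apply/mapP => -[].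
  by apply/hasPn => _ /mapP[u _ ->]; apply/mapP => -[u' _ [/eqP]]; rewrite ji.
rewrite !mu_box // /s big_cons big_cat /= !big_map /= prT mulr1 mulrA.
congr (_ * _ * _); first by apply: eq_bigr => u _; rewrite eqxx.
by apply: eq_bigr => u _; rewrite ji.
Qed.

Lemma measurable_shift i (A : set envm) : measurable A ->
  measurable ([set e | A (shift i e)] : set envm).
Proof.
move=> mA; pose G := [set A : set env | measurable ([set e | A (shift i e)] : set envm)].
apply: (@smallest_sub _ (sigma_algebra setT) boxes G _ _ A mA).
  split => [|X mX|F mF].
  - rewrite /G /= (_ : [set _ | _] = set0) //.
  - rewrite /G /= (_ : [set _ | _] = ~` [set e | X (shift i e)]); first exact: measurableC.
    by apply/seteqP; split => e /= => [[]|].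
  - rewrite /G /= (_ : [set _ | _] = \bigcup_k [set e | F k (shift i e)]) //.
    apply: bigcup_measurable => k _; exact: mF.
move=> _ [s [a [b [us mb ->]]]]; apply: sub_sigma_algebra.
exists (map (cons i) s), (a \o behead), (b \o behead); split.
- by rewrite map_inj_uniq // => x y [].
- by move=> v; exact: mb.
apply/seteqP; split => e /= hb.
  by move=> _ /mapP[u us' ->]; exact: hb.
by move=> u us'; exact: (hb (i :: u) (map_f _ us')).
Qed.

Lemma measurable_coordinate v (a : set nat) (b : set (measurableTypeR R)) : measurable b ->
  measurable ([set e : env | a (e v).1 /\ b (e v).2] : set envm).
Proof.
move=> mb; apply: sub_sigma_algebra; exists [:: v], (fun=> a), (fun=> b); split => //.
apply/seteqP; split => e /= => [hab u|]; first by rewrite inE => /eqP ->.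
by apply; rewrite inE.
Qed.

Lemma measurable_offspring_at v (a : set nat) :
  measurable ([set e : env | a (e v).1] : set envm).
Proof.
rewrite (_ : [set _ | _] = [set e : env | a (e v).1 /\ setT (e v).2]).
  exact: measurable_coordinate.
by apply/seteqP; split => e //= [].
Qed.

Definition split_event n i j (A A' : set env) : set env :=
  [set e | [/\ offspring e = n, A (shift i e) & A' (shift j e)]].

Lemma measurable_split n i j (A A' : set envm) : measurable A -> measurable A' ->
  measurable (split_event n i j A A' : set envm).
Proof.
move=> mA mA'; rewrite (_ : split_event _ _ _ _ _ =
  ([set e | offspring e = n] `&` [set e | A (shift i e)]) `&` [set e | A' (shift j e)]).
  apply: measurableI; last exact: measurable_shift.
  apply: measurableI; last exact: measurable_shift.
  exact: (measurable_offspring_at [::] [set n]).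
by apply/seteqP; split => e /= => [[]|[[]]].
Qed.

Lemma mu_split_eq (A A' : set envm) : measurable A -> measurable A' ->
  mu A = mu (A `&` A') + mu (A `&` ~` A').
Proof.
move=> mA mA'; rewrite /mu preimage_setI preimage_setI preimage_setC.
by apply: pr_split; exact: measurable_sample.
Qed.

Lemma mu_setT : mu setT = 1.
Proof. by rewrite /mu preimage_setT prT. Qed.

Lemma mu_ge0 A : 0 <= mu A. Proof. exact: pr_ge0. Qed.

Lemma mu_le1 (A : set envm) : measurable A -> mu A <= 1.
Proof. by move=> mA; apply: pr_le1; exact: measurable_sample. Qed.

Lemma mu_le (A A' : set envm) : measurable A -> measurable A' -> A `<=` A' -> mu A <= mu A'.
Proof.
move=> mA mA' AA; apply: pr_le; try exact: measurable_sample.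
by move=> o; exact: AA.
Qed.

(** Both sides are finite measures of [X] that agree on the boxes. *)
Lemma box_extension (E : set envm) (f : env -> env) (c : R) : 0 <= c -> measurable E ->
  (forall X : set envm, measurable X -> measurable (f @^-1` X : set envm)) ->
  (forall X, boxes X -> mu (E `&` f @^-1` X) = c * mu X) ->
  forall X : set envm, measurable X -> mu (E `&` f @^-1` X) = c * mu X.
Proof.
move=> c0 mE mf base; pose G := [set X : set envm | mu (E `&` f @^-1` X) = c * mu X].
apply: (@dynkin_induction _ envm boxes G) => //.
- exact: boxesI.
- exact/base/boxesT.
- move=> X mX HX; rewrite /G /= preimage_setC.
  have e1 := mu_split_eq mE (mf _ mX); have e2 := mu_split_eq (@measurableT _ envm) mX.
  have := base _ boxesT; rewrite preimage_setT setIT e1 HX e2 !setTI mulrDr.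
  exact: addrI.
- move=> F mF tF HF; rewrite /G /= preimage_bigcup setI_bigcupr /mu !preimage_bigcup.
  apply: pr_bigcup_scale => //.
  - by move=> k; apply: measurable_sample; apply: measurableI => //; exact: mf.
  - by move=> k; exact: measurable_sample.
  - by move=> k l _ _ [x [[_ h1] [_ h2]]]; apply: tF => //; exists (f (sample x)).
  - by move=> k l _ _ [x [h1 h2]]; apply: tF => //; exists (sample x).
Qed.

(** Extension from the boxes, first in the second event for a fixed first one,
    then in the first event when the second one is a box. *)
Lemma branching n i j (A A' : set envm) : i != j -> measurable A -> measurable A' ->
  mu (split_event n i j A A') = pr h [set n] * mu A * mu A'.
Proof.
move=> ij mA mA'.
have sndE X Y : split_event n i j X Y = split_event n i j X setT `&` shift j @^-1` Y.
  by apply/seteqP; split => e /= => [[]|[[]]].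
have fstE X Y : split_event n i j X Y = split_event n i j setT Y `&` shift i @^-1` X.
  by apply/seteqP; split => e /= => [[]|[[]]].
rewrite sndE; move: A' mA'; apply: box_extension.
- by rewrite mulr_ge0 ?pr_ge0 ?mu_ge0.
- exact: measurable_split.
- by move=> X; exact: measurable_shift.
move=> Y bY; have mY : measurable (Y : set envm) by exact: sub_sigma_algebra.
rewrite -sndE fstE mulrAC; move: A mA; apply: box_extension.
- by rewrite mulr_ge0 ?pr_ge0 ?mu_ge0.
- exact: measurable_split.
- by move=> X; exact: measurable_shift.
move: bY => [s2 [a2 [b2 [u2 m2 ->]]]] _ [s1 [a1 [b1 [u1 m1 ->]]]].
by rewrite -fstE mulrAC; exact: branching_box.
Qed.

(** A countable union of events on which the number of kids is known; the
    second kid in [split_event] is a dummy, and 0 is never the letter of a kid.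
    *)
Lemma has_childE A : has_child A =
  \bigcup_n \big[setU/set0]_(i <- iota 1 n) split_event n i 0 (A n) setT.
Proof.
apply/seteqP; split => e.
  move=> [i hi Ai]; exists (offspring e) => //.
  rewrite -bigcup_seq; exists i; first by rewrite /= mem_iota; lia.
  by split.
move=> [n _]; rewrite -bigcup_seq => -[i /=]; rewrite mem_iota => hi [e0 Ai _].
by exists i; rewrite e0 //; lia.
Qed.

Lemma has_pairE A A' : has_pair A A' =
  \bigcup_n \big[setU/set0]_(ij <- [seq ij <- [seq (i, j) | i <- iota 1 n, j <- iota 1 n] | ij.1 != ij.2])
     split_event n ij.1 ij.2 (A n) (A' n).
Proof.
apply/seteqP; split => e.
  move=> [i [j [hi hj ij Ai Aj]]]; exists (offspring e) => //.
  rewrite -bigcup_seq; exists (i, j); last by split.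
  rewrite /= mem_filter /= ij; apply/allpairsP; exists (i, j); rewrite !mem_iota /=; split => //; lia.
move=> [n _]; rewrite -bigcup_seq => -[[i j] /=].
rewrite mem_filter /= => /andP[ij /allpairsP[[i' j'] /= [hi hj [? ?]]]] [e0 Ai Aj]; subst i' j'.
move: hi hj; rewrite !mem_iota => hi hj.
by exists i, j; rewrite e0; split => //; lia.
Qed.

Lemma measurable_has_child (A : nat -> set env) : (forall n, measurable (A n : set envm)) ->
  measurable (has_child A : set envm).
Proof.
move=> mA; rewrite has_childE; apply: bigcup_measurable => n _.
by apply: bigsetU_measurable => i _; exact: measurable_split.
Qed.

Lemma measurable_has_pair (A A' : nat -> set env) : (forall n, measurable (A n : set envm)) ->
  (forall n, measurable (A' n : set envm)) -> measurable (has_pair A A' : set envm).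
Proof.
move=> mA mA'; rewrite has_pairE; apply: bigcup_measurable => n _.
by apply: bigsetU_measurable => i _; exact: measurable_split.
Qed.

Lemma measurable_level k (A : set env) : measurable (A : set envm) -> measurable (level k A : set envm).
Proof. by move=> mA; elim: k => //= k IH; exact: measurable_has_child. Qed.

Lemma measurable_tall N : measurable (tall N : set envm).
Proof. by apply: measurable_level; exact: measurableT. Qed.

Lemma measurable_finite_progeny : measurable ([set e | finite_progeny e] : set envm).
Proof.
rewrite (_ : [set _ | _] = \bigcup_N ~` tall N).
  by apply: bigcup_measurable => N _; apply: measurableC; exact: measurable_tall.
by apply/seteqP; split => e [N]; [move=> /shortP ns; exists N|move=> _ /shortP ns; exists N].
Qed.

Lemma measurable_bounded_bias q Q : measurable ([set e | bounded_bias q Q e] : set envm).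
Proof.
rewrite (_ : [set _ | _] = \bigcap_v [set e : env | setT (e v).1 /\ [set` `[q, Q]] (e v).2]).
  rewrite -[X in measurable X]setCK setC_bigcap; apply: measurableC.
  apply: countable_bigcupT_measurable => [|v]; first exact: countableP.
  by apply: measurableC; apply: measurable_coordinate; exact: measurable_itv.
apply/seteqP; split => e /= hb v; first by move=> _ /=; rewrite in_itv /=.
by have [//|_] := hb v; rewrite /= in_itv.
Qed.

Lemma measurable_good q Q : measurable (good q Q : set envm).
Proof. by apply: measurableI; [exact: measurable_finite_progeny|exact: measurable_bounded_bias]. Qed.

Lemma measurable_wt v : measurable_fun setT (fun e : envm => wt e v : R).
Proof.
rewrite /wt; apply: measurable_prod => i _.
move=> _ Y mY; rewrite setTI.
rewrite (_ : _ @^-1` _ = [set e : env | setT (e (take i.+1 v)).1 /\ Y (e (take i.+1 v)).2]).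
  exact: measurable_coordinate.
by apply/seteqP; split => e //= [].
Qed.

Lemma measurable_progeny v : measurable ([set e | progeny e v] : set envm).
Proof.
elim: v => [|j v IH]; first by rewrite (_ : [set _ | _] = setT) //; apply/seteqP; split.
rewrite (_ : [set _ | _] = [set e | (1 <= j <= offspring e)%N] `&` [set e | progeny (shift j e) v]).
  apply: measurableI; last exact: (measurable_shift j IH).
  exact: (measurable_offspring_at [::] (fun n => (1 <= j <= n)%N)).
by apply/seteqP; split => e /=; rewrite progeny_cons.
Qed.

(** There are countably many finite trees, and on each of them the weight is a
    finite sum of products of labels. *)
Lemma measurable_heavy u : measurable (heavy u : set envm).
Proof.
pose T (l : seq vertex) : set env := [set e | progeny e = [set` l]].
have mT l : measurable (T l : set envm).
  rewrite (_ : T l = \bigcap_v (if v \in l then [set e | progeny e v] else ~` [set e | progeny e v])).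
    rewrite -[X in measurable X]setCK setC_bigcap; apply: measurableC.
    apply: countable_bigcupT_measurable => [|v]; first exact: countableP.
    apply: measurableC; case: ifP => _; first exact: measurable_progeny.
    by apply: measurableC; exact: measurable_progeny.
  apply/seteqP; split => e /= he.
    by move=> v _; case: ifPn => vl; rewrite /= he //=; exact/negP.
  apply/seteqP; split => v /=.
    by move=> pv; have := he v I; case: ifPn => // _ /(_ pv).
  by move=> vl; have := he v I; rewrite vl.
rewrite (_ : heavy u = \bigcup_(l : seq vertex)
   (if uniq l then (([set e | finite_progeny e] `&` T l) `&` [set e | u < \sum_(v <- l) wt e v]) else set0)).
  apply: countable_bigcupT_measurable => [|l]; first exact: countableP.
  case: ifP => // _; apply: measurableI.
    by apply: measurableI => //; exact: measurable_finite_progeny.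
  have : measurable_fun setT (fun e : envm => \sum_(v <- l) wt e v).
    by apply: measurable_sum => v; exact: measurable_wt.
  move=> /(_ measurableT [set` `]u, +oo[]) /(_ (measurable_itv _)); rewrite setTI.
  by congr measurable; apply/seteqP; split => e /=; rewrite in_itv /= andbT.
apply/seteqP; split => e.
  move=> [[N sh] ue]; exists (vertices N e) => //; rewrite vertices_uniq.
  split; last by rewrite /= -tw_vertices.
  by split; [exists N|exact: progeny_vertices].
move=> [l _]; case: ifP => // ul [[fe Te] ue]; split => //.
move: ue; rewrite /= /tw /total_weight /= Te -fsbig_seq //.
Qed.

Lemma measurable_stout N u : measurable (stout N u : set envm).
Proof.
apply: measurableI; first exact: measurable_heavy.
by apply: measurableC; exact: measurable_tall.
Qed.

Lemma measurable_fork N s : measurable (fork N s : set envm).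
Proof.
apply: measurable_has_pair => n; first exact: measurable_heavy.
by apply: measurableU; [exact: measurable_heavy|exact: measurable_tall].
Qed.

Variables (q Q mh : R) (n0 : nat).
Hypothesis q1 : 1 < q.
Hypothesis qQ : q < Q.
Hypothesis nu_itv : pr nu [set` `[q, Q]] = 1.
Hypothesis mh0 : 0 <= mh.
Hypothesis mh1 : mh < 1.
Hypothesis offspring_mean_le : forall n : nat, \sum_(k < n) k%:R * pr h [set (k : nat)] <= mh.
Hypothesis moments : forall r, exists M : R, forall n : nat, \sum_(k < n) k%:R ^+ r * pr h [set (k : nat)] <= M.
Hypothesis n0_gt0 : (0 < n0)%N.
Hypothesis h_n0 : 0 < pr h [set n0].

Lemma mu_bigcup_le (F : nat -> set env) c : (forall n, measurable (F n : set envm)) ->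
  (forall n, \sum_(i < n) mu (F i) <= c) -> mu (\bigcup_n F n) <= c.
Proof.
move=> mF hc; rewrite /mu preimage_bigcup; apply: pr_bigcup_le => // n.
exact: measurable_sample.
Qed.

Lemma mu_bigsetU_le (I : Type) (r : seq I) (F : I -> set env) :
  (forall i, measurable (F i : set envm)) ->
  mu (\big[setU/set0]_(i <- r) F i) <= \sum_(i <- r) mu (F i).
Proof.
move=> mF; rewrite /mu.
have -> : sample @^-1` (\big[setU/set0]_(i <- r) F i) = \big[setU/set0]_(i <- r) (sample @^-1` F i).
  elim: r => [|i r IH]; first by rewrite !big_nil preimage_set0.
  by rewrite !big_cons preimage_setU IH.
by apply: pr_bigsetU_le => i; exact: measurable_sample.
Qed.

Lemma mu_has_child (A : nat -> set env) c : (forall n, measurable (A n : set envm)) ->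
  (forall N, \sum_(n < N) n%:R * pr h [set (n : nat)] * mu (A n) <= c) -> mu (has_child A) <= c.
Proof.
move=> mA hc; rewrite has_childE; apply: mu_bigcup_le => [n|N].
  by apply: bigsetU_measurable => i _; exact: measurable_split.
apply: le_trans (hc N); apply: ler_sum => n _.
apply: le_trans (mu_bigsetU_le _ _) _; first by move=> i; exact: measurable_split.
rewrite big_seq (eq_bigr (fun=> pr h [set (n : nat)] * mu (A n))).
  by rewrite -big_seq big_const_seq count_predT size_iota iter_addr_0 -mulrA mulr_natl.
move=> i; rewrite mem_iota => hi; rewrite branching ?mu_setT ?mulr1 //; lia.
Qed.

Lemma mu_has_pair (A A' : nat -> set env) c : (forall n, measurable (A n : set envm)) ->
  (forall n, measurable (A' n : set envm)) ->
  (forall N, \sum_(n < N) n%:R ^+ 2 * pr h [set (n : nat)] * (mu (A n) * mu (A' n)) <= c) ->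
  mu (has_pair A A') <= c.
Proof.
move=> mA mA' hc; rewrite has_pairE; apply: mu_bigcup_le => [n|N].
  by apply: bigsetU_measurable => i _; exact: measurable_split.
apply: le_trans (hc N); apply: ler_sum => n _.
apply: le_trans (mu_bigsetU_le _ _) _; first by move=> i; exact: measurable_split.
rewrite big_seq (eq_bigr (fun=> pr h [set (n : nat)] * mu (A n) * mu (A' n))); last first.
  by move=> ij; rewrite mem_filter => /andP[pp _]; rewrite branching.
rewrite -big_seq big_const_seq count_predT iter_addr_0 -[X in X <= _]mulr_natl -!mulrA [X in _ <= X]mulrA -natrM.
apply: ler_wpM2r; first by rewrite !mulr_ge0 ?pr_ge0 ?mu_ge0.
rewrite ler_nat; apply: leq_trans (_ : size [seq (i, j) | i <- iota 1 n, j <- iota 1 n] <= _)%N.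
  by rewrite size_filter count_size.
by rewrite size_allpairs size_iota.
Qed.

(** First moment bound: the expected number of vertices in generation [k] is at
    most [mh ^+ k]. *)
Lemma mu_level k (A : set env) : measurable (A : set envm) -> mu (level k A) <= mh ^+ k * mu A.
Proof.
move=> mA; elim: k => [|k IH]; first by rewrite mul1r.
apply: mu_has_child => [n|N]; first exact: measurable_level.
rewrite -mulr_suml exprS -mulrA; apply: ler_pM => //; last exact: mu_ge0.
by apply: sumr_ge0 => n _; rewrite mulr_ge0 // pr_ge0.
Qed.

Lemma mu_level_le k (A : set env) : measurable (A : set envm) -> mu (level k A) <= mu A.
Proof.
move=> mA; apply: le_trans (mu_level _ mA) _; rewrite ler_piMl ?mu_ge0 //.
by rewrite exprn_ile1 // ltW.
Qed.

Lemma mu_tall N : mu (tall N) <= mh ^+ N.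
Proof.
apply: le_trans (mu_level _ _) _; first exact: measurableT.
by rewrite mu_setT mulr1.
Qed.

Lemma mu_finite_progeny : mu [set e | finite_progeny e] = 1.
Proof.
apply/eqP; rewrite eq_le (mu_le1 measurable_finite_progeny) /=.
apply: (@le_of_summable _ (fun N => mh ^+ N) _ _ (1 - mh)^-1).
  by move=> N; apply: geometric_le; rewrite mh0.
move=> N; have := mu_split_eq (@measurableT _ envm) (measurable_tall N).
rewrite mu_setT !setTI => ->; rewrite addrC; apply: lerD; last exact: mu_tall.
apply: mu_le; [by apply: measurableC; exact: measurable_tall|exact: measurable_finite_progeny|].
by move=> e /shortP ns; exists N.
Qed.

Lemma mu_bounded_bias : mu [set e | bounded_bias q Q e] = 1.
Proof.
pose F n : set env := if (unpickle n : option vertex) is Some v then ~` [set e : env | q <= (e v).2 <= Q] else set0.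
have mb (v : vertex) : measurable ([set e : env | q <= (e v).2 <= Q] : set envm).
  rewrite (_ : [set _ | _] = [set e : env | setT (e v).1 /\ [set` `[q, Q]] (e v).2]).
    by apply: measurable_coordinate; exact: measurable_itv.
  apply/seteqP; split => e he; first by split => //; rewrite /= ?in_itv.
  by case: he => _; rewrite /= ?in_itv.
have mF n : measurable (F n : set envm).
  by rewrite /F; case: unpickle => // v; exact: measurableC.
have F0 n : mu (F n) = 0.
  rewrite /F; case: unpickle => [v|]; last by rewrite /mu preimage_set0 pr_set0.
  have := mu_split_eq (@measurableT _ envm) (mb v); rewrite mu_setT !setTI.
  have -> : mu [set e : env | q <= (e v).2 <= Q] = 1.
    rewrite (_ : [set _ | _] = box [:: v] (fun=> setT) (fun=> [set` `[q, Q]])).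
      by rewrite mu_box ?big_seq1 ?prT ?mul1r // => _; exact: measurable_itv.
    apply/seteqP; split => e /=; first by move=> he u; rewrite inE => /eqP ->; split => //=; rewrite ?in_itv.
    by move=> /(_ v (mem_head _ _))[_] /=; rewrite ?in_itv.
  by move=> /eqP; rewrite -subr_eq0 opprD addrA subrr add0r oppr_eq0 => /eqP.
have U0 : mu (\bigcup_n F n) = 0.
  apply/eqP; rewrite eq_le mu_ge0 andbT; apply: mu_bigcup_le => // n.
  by rewrite big1.
have mU : measurable (\bigcup_n F n : set envm) by apply: bigcup_measurable.
have := mu_split_eq (@measurableT _ envm) mU; rewrite mu_setT !setTI U0 add0r => e1; rewrite [RHS]e1.
congr mu; apply/seteqP; split => e.
  move=> be [n _]; rewrite /F; case: unpickle => // v; apply; exact: be.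
move=> ne v; apply: contrapT => nb; apply: ne; exists (pickle v) => //.
by rewrite /F pickleK.
Qed.

Lemma mu_goodI (A : set env) : measurable (A : set envm) -> mu (A `&` good q Q) = mu A.
Proof.
move=> mA; rewrite /mu preimage_setI; apply: prIr; try exact: measurable_sample.
  by apply: measurable_sample; exact: measurable_good.
rewrite (_ : good q Q = [set e | finite_progeny e] `&` [set e | bounded_bias q Q e]) // preimage_setI prIr.
- exact: mu_finite_progeny.
- by apply: measurable_sample; exact: measurable_finite_progeny.
- by apply: measurable_sample; exact: measurable_bounded_bias.
- exact: mu_bounded_bias.
Qed.

(** Inclusions of events have to be checked in good environments only. *)
Lemma mu_le_good (A A' : set env) : measurable (A : set envm) -> measurable (A' : set envm) ->
  A `&` good q Q `<=` A' -> mu A <= mu A'.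
Proof.
move=> mA mA' h'; rewrite -(mu_goodI mA); apply: mu_le => //.
by apply: measurableI => //; exact: measurable_good.
Qed.

(** * Heavy trees are concentrated *)

Definition heavy_prob u := mu (heavy u).

Lemma heavy_prob_le u u' : u <= u' -> heavy_prob u' <= heavy_prob u.
Proof. by move=> uu; apply: mu_le; [exact: measurable_heavy|exact: measurable_heavy|exact: heavy_le]. Qed.

Lemma heavy_prob_ge0 u : 0 <= heavy_prob u. Proof. exact: mu_ge0. Qed.

Lemma heavy_prob_le1 u : heavy_prob u <= 1. Proof. exact: (mu_le1 (measurable_heavy u)). Qed.

(** When the root has [n0] kids, it suffices that the first of them has a
    subtree heavier than [s / q], its edge having a bias of at least [q]. *)
Lemma heavy_prob_doubling s : pr h [set n0] * heavy_prob (s / q) <= heavy_prob s.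
Proof.
have q0 : 0 < q by exact: lt_trans ltr01 q1.
have mh' := measurable_heavy (s / q).
have := branching n0 (isT : 1 != 0)%N mh' (@measurableT _ envm); rewrite mu_setT mulr1 => <-.
apply: mu_le_good; [exact: (measurable_split _ _ _ mh' measurableT)|exact: measurable_heavy|].
move=> e [[e0 [f1 t1] _] ge]; split; first exact: ge.1.
have hj : (1 <= 1 <= offspring e)%N by rewrite e0.
apply: lt_le_trans (tw_child_le q1 qQ ge hj).
have /andP[b1 _] := bias_itv [:: 1%N] ge.
rewrite ltr_pdivrMr // in t1; apply: (lt_le_trans t1); rewrite mulrC.
by apply: ler_wpM2r => //; apply/(tw_ge0 q1 qQ)/good_shift.
Qed.

(** About log x / log q applications of [heavy_prob_doubling], each at the
    price of a constant factor, which is written [q ^+ A]. *)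
Lemma heavy_prob_scaling : exists A, forall s x, 0 <= s -> 1 <= x -> heavy_prob (s / x) <= (q * x) ^+ A * heavy_prob s.
Proof.
have q0 : 0 < q by exact: lt_trans ltr01 q1.
have [A hA] := expn_unbounded (pr h [set n0])^-1 q1; exists A => s x s0 x1.
have step s' : heavy_prob (s' / q) <= q ^+ A * heavy_prob s'.
  have hd := heavy_prob_doubling s'; have c0 := h_n0.
  rewrite -ler_pdivlMl // in hd; apply: (le_trans hd).
  by apply: ler_wpM2r => //; exact: heavy_prob_ge0.
have pow j : heavy_prob (s / q ^+ j) <= (q ^+ j) ^+ A * heavy_prob s.
  elim: j => [|j IH]; first by rewrite expr0 invr1 mulr1 expr1n mul1r.
  rewrite exprSr invfM mulrA; apply: le_trans (step _) _.
  have qA : 0 < q ^+ A by rewrite exprn_gt0.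
  by rewrite exprMn -mulrA [X in _ <= X]mulrCA ler_pM2l.
have ex : exists j, x <= q ^+ j by apply: expn_unbounded.
have x0 : 0 < x by exact: lt_le_trans ltr01 x1.
case: (ex_minnP ex) => j xj jmin.
have qj : q ^+ j <= q * x.
  case: j xj jmin => [|j] xj jmin.
    by rewrite expr0 -[1]mulr1 ler_pM // ltW.
  rewrite exprS ler_pM2l // leNgt; apply/negP => hx.
  by have := jmin j (ltW hx); rewrite ltnn.
apply: (@le_trans _ _ (heavy_prob (s / q ^+ j))).
  by apply: heavy_prob_le; rewrite ler_wpM2l // lef_pV2 // posrE // exprn_gt0.
apply: le_trans (pow j) _; apply: ler_wpM2r; first exact: heavy_prob_ge0.
by rewrite lerXn2r // nnegrE ?exprn_ge0 ?mulr_ge0 ?(ltW q0) // ltW.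
Qed.

(** By induction on the height: among [n] kids of a stout tree one is stout, at
    a threshold of order [u / n]. The price [n ^+ r] and the choice of the kid
    are paid by the moment of order [r.+1]. *)
Lemma mu_stout N r : exists2 C : R, 0 <= C & forall u, 0 < u -> mu (stout N u) <= C / u ^+ r.
Proof.
elim: N => [|N [C C0 hC]].
  exists 0 => // u u0; rewrite mul0r (_ : stout 0 u = set0) /mu ?preimage_set0 ?pr_set0 //.
  by rewrite -subset0 => e [_ /=]; apply.
have [M hM] := moments r.+1.
have M0 : 0 <= M by have := hM 0%N; rewrite big_ord0.
have Qp := Q_gt0 q1 qQ; have c1 : 0 <= C * (2 * Q) ^+ r * M.
  by rewrite !mulr_ge0 ?exprn_ge0 ?mulr_ge0 // ltW.
exists (2 ^+ r + C * (2 * Q) ^+ r * M); first by rewrite addr_ge0 // exprn_ge0.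
move=> u u0; have ur : 0 < u ^+ r by rewrite exprn_gt0.
rewrite ler_pdivlMr //; have [u2|u2] := leP 2 u; last first.
  apply: (@le_trans _ _ (2 ^+ r)); last by rewrite lerDl.
  apply: (@le_trans _ _ (u ^+ r)).
    by rewrite ler_piMl ?(ltW ur) //; exact: (mu_le1 (measurable_stout _ _)).
  by rewrite lerXn2r // ?nnegrE ltW.
apply: (@le_trans _ _ (C * (2 * Q) ^+ r * M)); last by rewrite lerDr exprn_ge0.
rewrite -ler_pdivlMr //.
pose A n := stout N (u / (2 * Q) / (n : nat)%:R).
have mA n : measurable (A n : set envm) by exact: measurable_stout.
apply: (@le_trans _ _ (mu (has_child A))).
  apply: mu_le_good; [exact: measurable_stout|exact: measurable_has_child|].
  move=> e [[[fe ue] nt] ge].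
  have s0 : 0 <= u / (2 * Q) by rewrite divr_ge0 ?mulr_ge0 // ltW.
  have s1 : 1 + Q * (u / (2 * Q)) < tw e.
    apply: le_lt_trans ue; have -> : Q * (u / (2 * Q)) = u / 2 by field; rewrite gt_eqF.
    lra.
  have [j hj hj'] := heavy_child q1 qQ ge s0 s1; exists j => //; split.
    by split => //; exact: finite_progeny_shift.
  by move=> tj; apply: nt; exists j.
apply: mu_has_child => // m.
apply: (@le_trans _ _ (C * (2 * Q) ^+ r / u ^+ r * \sum_(n < m) n%:R ^+ r.+1 * pr h [set (n : nat)])).
  rewrite mulr_sumr; apply: ler_sum => n _.
  have [nz|n_gt0] := posnP n; first by rewrite nz exprS !mul0r mulr0.
  have nR : 0 < n%:R :> R by rewrite ltr0n.
  have := hC (u / (2 * Q) / n%:R); rewrite !divr_gt0 ?mulr_gt0 // => /(_ isT) hn.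
  apply: (@le_trans _ _ (n%:R * pr h [set (n : nat)] * (C / (u / (2 * Q) / n%:R) ^+ r))).
    by apply: ler_wpM2l => //; rewrite mulr_ge0 // pr_ge0.
  rewrite le_eqVlt; apply/orP; left; apply/eqP.
  rewrite !expr_div_n exprS; field.
  by rewrite !expf_neq0 ?gt_eqF ?mulr_gt0.
rewrite mulrAC; apply: ler_wpM2r; first by rewrite invr_ge0 ltW.
by apply: ler_wpM2l => //; rewrite mulr_ge0 // exprn_ge0 // mulr_ge0 // ltW.
Qed.

(** The two kids are independent. Their thresholds [s / n] are brought back to
    [s] by [heavy_prob_scaling] at a price polynomial in [n], and the moments
    of the offspring number pay for it and for the choice of the two kids. *)
Lemma mu_fork : exists2 C : R, 0 <= C & forall N s, 0 <= s ->
  mu (fork N s) <= C * heavy_prob s * (heavy_prob s + mh ^+ N).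
Proof.
have q0 : 0 < q by exact: lt_trans ltr01 q1.
have [A hA] := heavy_prob_scaling; have [M hM] := moments (2 + (A + A)).
have M0 : 0 <= M by have := hM 0%N; rewrite big_ord0.
exists (q ^+ (A + A) * M); first by rewrite mulr_ge0 // exprn_ge0 // ltW.
move=> N s s0; have ps := heavy_prob_ge0 s; have mN : 0 <= mh ^+ N by rewrite exprn_ge0.
apply: mu_has_pair => [n|n|m]; first exact: measurable_heavy.
  by apply: measurableU; [exact: measurable_heavy|exact: measurable_tall].
apply: (@le_trans _ _ (q ^+ (A + A) * heavy_prob s * (heavy_prob s + mh ^+ N) *
   \sum_(n < m) n%:R ^+ (2 + (A + A)) * pr h [set (n : nat)])).
  rewrite mulr_sumr; apply: ler_sum => n _.
  have [nz|n_gt0] := posnP n; first by rewrite nz [X in _ <= _ * (X * _)]exprD !expr0n /= !mul0r mulr0.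
  have n1 : 1 <= n%:R :> R by rewrite ler1n.
  have hp := hA s n%:R s0 n1.
  have qn1 : 1 <= (q * n%:R) ^+ A.
    by apply: exprn_ege1; rewrite -[leLHS]mulr1; apply: ler_pM => //; exact: ltW.
  have hU : mu (heavy (s / n%:R) `|` tall N) <= (q * n%:R) ^+ A * (heavy_prob s + mh ^+ N).
    apply: (@le_trans _ _ (heavy_prob (s / n%:R) + mh ^+ N)).
      apply: (@le_trans _ _ (heavy_prob (s / n%:R) + mu (tall N))); last by rewrite lerD2l mu_tall.
      rewrite /heavy_prob /mu preimage_setU; apply: prU_le; apply: measurable_sample.
        exact: measurable_heavy.
      exact: measurable_tall.
    by rewrite mulrDr; apply: lerD => //; rewrite ler_peMl.
  have -> : q ^+ (A + A) * heavy_prob s * (heavy_prob s + mh ^+ N) * (n%:R ^+ (2 + (A + A)) * pr h [set (n : nat)]) =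
    n%:R ^+ 2 * pr h [set (n : nat)] * (((q * n%:R) ^+ A * heavy_prob s) * ((q * n%:R) ^+ A * (heavy_prob s + mh ^+ N))).
    by rewrite !exprD !exprMn; ring.
  apply: ler_wpM2l; first by rewrite mulr_ge0 ?pr_ge0 // exprn_ge0.
  by apply: ler_pM => //; [exact: mu_ge0|exact: mu_ge0].
rewrite [q ^+ (A + A) * M * _]mulrAC -!mulrA; rewrite ler_wpM2l ?exprn_ge0 ?(ltW q0) //.
rewrite [M * _]mulrC !mulrA; apply: ler_wpM2l => //; by rewrite mulr_ge0 // addr_ge0.
Qed.

Lemma heavy_prob_half : heavy_prob (2^-1) = 1.
Proof.
apply/eqP; rewrite eq_le heavy_prob_le1 /= -[X in X <= _]mu_setT.
apply: mu_le_good; [exact: measurableT|exact: measurable_heavy|].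
by move=> e [_ ge]; split; [exact: ge.1|apply: lt_le_trans (tw_ge1 q1 qQ ge); lra].
Qed.

Lemma heavy_prob_gt0 u : 0 < u -> 0 < heavy_prob u.
Proof.
move=> u0; have q0 : 0 < q by exact: lt_trans ltr01 q1.
have half := heavy_prob_half.
have [u1|u1] := leP 1 (2 * u).
  have [A hA] := heavy_prob_scaling; have := hA u (2 * u) (ltW u0) u1.
  have -> : u / (2 * u) = 2^-1 by field; rewrite gt_eqF.
  rewrite half => h1; rewrite lt_neqAle heavy_prob_ge0 andbT eq_sym; apply/eqP => p0.
  by move: h1; rewrite p0 mulr0 ler10.
by apply: lt_le_trans (heavy_prob_le (_ : u <= 2^-1)); rewrite ?half //; lra.
Qed.

(** As every finite tree weighs at least one, [heavy_prob] is one at 1/2; scale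
    from there. *)
Lemma heavy_prob_lower : exists A, forall u, 1 <= u -> 1 <= (2 * q * u) ^+ A * heavy_prob u.
Proof.
have [A hA] := heavy_prob_scaling; exists A => u u1.
have half := heavy_prob_half.
have u0 : 0 <= u by exact: le_trans u1.
have := hA u (2 * u) u0; have -> : u / (2 * u) = 2^-1 by field; rewrite gt_eqF //; lra.
rewrite half mulrA [q * 2]mulrC; apply; lra.
Qed.

(** The exceptional event [X] is that there is a fork at some vertex of a
    generation before [k], or that the subtree at some vertex of generation [k]
    is stout. With a threshold [s] proportional to [u], forks cost a multiple
    of [heavy_prob u * (heavy_prob s + mh ^+ N)]; choosing first [N] and then
    [u] large makes the second factor small. Stout subtrees are negligible
    because [heavy_prob u] decays at most polynomially. *)
Lemma concentration k del eta : 0 < del -> 0 < eta -> exists u0, forall u, u0 <= u ->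
  exists2 X : set env, measurable (X : set envm) &
    mu X <= eta * heavy_prob u /\ forall e, good q Q e -> u < tw e -> ~ X e -> concentrated_at k del e.
Proof.
move=> del0 eta0; wlog del2 : del del0 / del <= 2^-1.
  move=> wl; have [d1|d1] := leP del 2^-1; first exact: wl.
  have [|//|u0 hu0] := wl 2^-1; first by lra.
  exists u0 => u /hu0[X mX [h1 h2]]; exists X => //; split => // e ge ue nX.
  have [v [M [a1 a2 a3 a4 a5]]] := h2 e ge ue nX; exists v, M; split => //.
  by apply: (le_trans a3); rewrite ler_wpM2r // ?(tw_ge0 q1 qQ ge) // ltW.
have Qp := Q_gt0 q1 qQ; have Q1' := Q_gt1 q1 qQ; have q0 : 0 < q by exact: lt_trans ltr01 q1.
pose D : R := k%:R * Q ^+ k + 1.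
have D1 : 1 <= D by rewrite lerDr mulr_ge0 // exprn_ge0 // ltW.
have D0 : 0 < D by exact: lt_le_trans ltr01 D1.
(* The ratio s / u, chosen so that spill Q k s stays below del * u. *)
pose dp := del / (2 * D).
have dp0 : 0 < dp by rewrite divr_gt0 // mulr_gt0.
have dp1 : dp <= 1 by rewrite ler_pdivrMr ?mulr_gt0 //; lra.
have [A hA] := heavy_prob_scaling.
have [A' hA'] := heavy_prob_lower.
have [C C0 hC] := mu_fork.
pose G := (q / dp) ^+ A.
have G0 : 0 < G by rewrite exprn_gt0 // divr_gt0.
pose F := k%:R * C * G.
have F0 : 0 <= F by rewrite !mulr_ge0 // ltW.
have F8 : 0 < eta / (8 * (F + 1)) by rewrite divr_gt0 // mulr_gt0 // ltr_wpDl.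
have mhi : 0 <= mh < 1 by rewrite mh0.
have [N hN] := expn_small mhi F8.
have [C1 C10 hC1] := mu_stout N 1.
have [C2 C20 hC2] := mu_stout N A'.+1.
pose H := (2 * q) ^+ A' * (C2 * (4 * Q ^+ k) ^+ A'.+1).
have H0 : 0 <= H by rewrite !mulr_ge0 // exprn_ge0 // ?mulr_ge0 ?exprn_ge0 // ltW.
have dFN : F * mh ^+ N <= eta / 8.
  apply: (@le_trans _ _ ((F + 1) * mh ^+ N)).
    by apply: ler_wpM2r; [exact: exprn_ge0|rewrite lerDl].
  move: hN; rewrite ler_pdivlMr ?mulr_gt0 ?ltr_wpDl //; lra.
exists (Num.max 1 (Num.max (2 * D / del) (Num.max (4 * F * C1 / (dp * eta)) (2 * H / eta)))) => u.
rewrite !ge_max => /and4P[u1 u2 u3 u4].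
have u0 : 0 < u by exact: lt_le_trans ltr01 u1.
have de0 : 0 < dp * eta by exact: mulr_gt0.
rewrite ler_pdivrMr // in u2; rewrite (ler_pdivrMr _ _ de0) in u3; rewrite ler_pdivrMr // in u4.
pose s := dp * u; have s0 : 0 < s by rewrite mulr_gt0.
(* The end of the path has at least half of the weight and a path weight of at
   most Q ^+ k, hence a subtree heavier than u'. *)
pose u' := u / (4 * Q ^+ k).
have Qk : 0 < Q ^+ k by rewrite exprn_gt0.
have Qk1 : 1 <= Q ^+ k by rewrite exprn_ege1 // ltW.
have u'0 : 0 < u' by rewrite divr_gt0 // mulr_gt0.
have sle : spill Q k s <= del * u.
  apply: le_trans (spill_le q1 qQ k (ltW s0)) _; apply: (@le_trans _ _ ((1 + s) * D)).
    by apply: ler_wpM2l; [rewrite addr_ge0 // ltW|rewrite lerDl].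
  have -> : (1 + s) * D = D + del * u / 2.
    by rewrite /s /dp; field; rewrite gt_eqF.
  lra.
have mf := measurable_fork N s; have ms := measurable_stout N u'.
pose X := (\big[setU/set0]_(i <- iota 0 k) level i (fork N s)) `|` level k (stout N u').
have mX1 : measurable (\big[setU/set0]_(i <- iota 0 k) level i (fork N s) : set envm).
  by apply: bigsetU_measurable => i _; exact: measurable_level.
have mX2 : measurable (level k (stout N u') : set envm) by exact: measurable_level.
exists X; first exact: measurableU.
have ps : heavy_prob s <= G * heavy_prob u.
  have dpi : 1 <= dp^-1 by rewrite invf_ge1.
  by have := hA u dp^-1 (ltW u0) dpi; rewrite invrK mulrC.
have pu := heavy_prob_ge0 u.
(* heavy_prob s itself is small: a heavy tree is either tall or stout. *)
have ps' : heavy_prob s <= mh ^+ N + C1 / s.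
  have := mu_split_eq (measurable_heavy s) (measurable_tall N) => e1.
  rewrite /heavy_prob e1; apply: lerD; last by have := hC1 s s0; rewrite expr1.
  have mt := measurable_tall N; have mI := measurableI _ _ (measurable_heavy s) mt.
  by apply: le_trans (mu_tall N); exact: (mu_le mI mt (@subIsetr _ _ _)).
split.
  apply: (@le_trans _ _ (k%:R * mu (fork N s) + mu (stout N u'))).
    apply: (@le_trans _ _ (mu (\big[setU/set0]_(i <- iota 0 k) level i (fork N s)) + mu (level k (stout N u')))).
      by rewrite /mu preimage_setU; apply: prU_le; exact: measurable_sample.
    apply: lerD; last exact: mu_level_le.
    apply: le_trans (mu_bigsetU_le _ _) _; first by move=> i; exact: measurable_level.
    apply: (@le_trans _ _ (\sum_(i <- iota 0 k) mu (fork N s))).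
      by apply: ler_sum => i _; exact: mu_level_le.
    by rewrite big_const_seq count_predT size_iota iter_addr_0 mulr_natl.
  have h1 : k%:R * mu (fork N s) <= eta / 2 * heavy_prob u.
    apply: (@le_trans _ _ (k%:R * (C * heavy_prob s * (heavy_prob s + mh ^+ N)))).
      by apply: ler_wpM2l => //; apply: hC; exact: ltW.
    have mN0 : 0 <= mh ^+ N by exact: exprn_ge0.
    apply: (@le_trans _ _ (F * (heavy_prob s + mh ^+ N) * heavy_prob u)).
      have -> : k%:R * (C * heavy_prob s * (heavy_prob s + mh ^+ N)) = k%:R * C * (heavy_prob s + mh ^+ N) * heavy_prob s by ring.
      have -> : F * (heavy_prob s + mh ^+ N) * heavy_prob u = k%:R * C * (heavy_prob s + mh ^+ N) * (G * heavy_prob u) by rewrite /F; ring.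
      by apply: ler_wpM2l => //; rewrite !mulr_ge0 // addr_ge0 // heavy_prob_ge0.
    apply: ler_wpM2r => //.
    have : F * heavy_prob s <= F * (mh ^+ N + C1 / s) by exact: ler_wpM2l.
    have : F * (C1 / s) <= eta / 4.
      by rewrite mulrA ler_pdivrMr // /s; move: u3; lra.
    rewrite !mulrDr; lra.
  have h2 : mu (stout N u') <= eta / 2 * heavy_prob u.
    apply: le_trans (hC2 _ u'0) _; rewrite /u' expr_div_n invf_div mulrA ler_pdivrMr ?exprn_gt0 //.
    have h3 : C2 * (4 * Q ^+ k) ^+ A'.+1 <= H * u ^+ A' * heavy_prob u.
      rewrite /H; have -> : (2 * q) ^+ A' * (C2 * (4 * Q ^+ k) ^+ A'.+1) * u ^+ A' * heavy_prob u =
        C2 * (4 * Q ^+ k) ^+ A'.+1 * ((2 * q * u) ^+ A' * heavy_prob u) by rewrite [(2 * q * u) ^+ _]exprMn; ring.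
      apply: ler_peMr; last exact: hA'.
      by rewrite mulr_ge0 // exprn_ge0 // mulr_ge0 // ltW.
    apply: (le_trans h3).
    have -> : eta / 2 * heavy_prob u * u ^+ A'.+1 = (eta / 2 * u) * u ^+ A' * heavy_prob u by rewrite exprS; ring.
    apply: ler_wpM2r => //; apply: ler_wpM2r; first by rewrite exprn_ge0 // ltW.
    lra.
  lra.
move=> e ge ue nX.
have nofork i : (i < k)%N -> ~ level i (fork N s) e.
  by move=> ik li; apply: nX; left; rewrite -bigcup_seq; exists i => //=; rewrite mem_iota.
have sp : spill Q k s < tw e.
  by apply: le_lt_trans ue; apply: (le_trans sle); rewrite ler_piMl ?(ltW u0) //; lra.
have [v [sv pv dv hv]] := trunk_path q1 qQ ge (ltW s0) sp nofork.
have t0 := tw_ge0 q1 qQ ge; have gv := good_shifts pv ge; have tv0 := tw_ge0 q1 qQ gv.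
have /andP[w0 w1] := wt_le q1 ge pv; rewrite sv in w1.
have big : u' < tw (shifts v e).
  rewrite ltr_pdivrMr ?mulr_gt0 //.
  have : wt e v * tw (shifts v e) <= Q ^+ k * tw (shifts v e) by exact: ler_wpM2r.
  have : del * u <= 2^-1 * u by rewrite ler_pM2r.
  lra.
have tl : tall N (shifts v e).
  apply: contrapT => nt; apply: nX; right; apply/levelP; exists v; split => //.
  by split => //; split => //; exact: gv.1.
exists v, (k + N)%N; split => //.
  apply: (le_trans dv); apply: (le_trans sle); rewrite ler_pM2l //; exact: ltW.
have [u2' su pu'] := (tallP _ _).1 tl.
exists (v ++ u2'); first exact: progeny_cat.
by rewrite size_cat sv su.
Qed.

End Environment.

(** * Averages, supports and moments *)

(** The integral of a nonnegative function is the supremum of the integrals of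
    the simple functions below it. *)
Lemma ge0_le_lower_integral (d : measure_display) (T : measurableType d) (R : realType)
  (m : {measure set T -> \bar R}) (D : set T) (f g : T -> \bar R) :
  (forall x, D x -> (0 <= f x)%E) -> (forall x, D x -> (f x <= g x)%E) ->
  (\int[m]_(x in D) f x <= \int[m]_(x in D) g x)%E.
Proof.
move=> f0 fg; rewrite !ge0_integralE //; last first.
  by move=> x Dx; apply: le_trans (f0 x Dx) (fg x Dx).
apply: ereal_sup_le => _ [k kf <-]; exists k => // x.
apply: (le_trans (kf x)); rewrite !patchE; case: ifPn => // xD; apply: fg.
by rewrite inE in xD.
Qed.

(** Comparison with step functions on both sides. In the application [f] is a
    probability computed in a random tree, whose measurability as a function of
    the tree is not known, so that its integral is accessible by comparison
    only. *)
Lemma lower_average (d : measure_display) (T : measurableType d) (R : realType)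
  (P : probability T R) (D X N : set T) (f : T -> \bar R) (a eps eta : R) :
  measurable D -> measurable X -> measurable N -> P N = 0%E ->
  0 <= a <= 1 -> 0 <= eps -> 0 < pr P D -> pr P X <= eta * pr P D ->
  (forall x, D x -> (0 <= f x)%E) ->
  (forall x, D x -> ~ N x -> (f x <= 1)%E) ->
  (forall x, D x -> ~ N x -> ~ X x -> exists2 r, f x = r%:E & `|r - a| <= eps) ->
  exists2 r : R, ((\int[P]_(x in D) f x) / P D = r%:E)%E & `|r - a| <= eps + eta.
Proof.
move=> mD mX mN N0 /andP[a0 a1] e0 D0 hX f0 f1 fa.
have mDX := measurableI _ _ mD mX.
have XD : pr P (D `&` X) <= pr P X by apply: pr_le => //; exact: subIsetr.
have up : (\int[P]_(x in D) f x <= ((a + eps) * pr P D + pr P X)%:E)%E.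
  pose g1 (x : T) : \bar R := (a + eps)%:E.
  pose g2 := (fun _ : T => 1%E : \bar R) \_ X.
  pose g3 := (fun _ : T => +oo%E : \bar R) \_ N.
  have g10 x : D x -> (0 <= g1 x)%E by rewrite lee_fin addr_ge0.
  have g20 x : D x -> (0 <= g2 x)%E by move=> _; rewrite /g2 patchE; case: ifP.
  have g30 x : D x -> (0 <= g3 x)%E by move=> _; rewrite /g3 patchE; case: ifP => // _; rewrite leey.
  have mg2 : measurable_fun D g2.
    by apply/measurable_restrict => //; exact: measurable_cst.
  have mg3 : measurable_fun D g3.
    by apply/measurable_restrict => //; exact: measurable_cst.
  have mg1 : measurable_fun D g1 by exact: measurable_cst.
  apply: (@le_trans _ _ (\int[P]_(x in D) (g1 x + (g2 x + g3 x)))%E).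
    apply: ge0_le_lower_integral => // x Dx; rewrite /g1 /g2 /g3 !patchE.
    have [xN|nN] := pselect (N x).
      by rewrite (mem_set xN) addey ?addey ?leey //; case: ifP.
    rewrite (memNset nN) adde0; have [xX|nX] := pselect (X x).
      rewrite (mem_set xX); apply: le_trans (f1 x Dx nN) _.
      by rewrite -EFinD lee_fin lerDr addr_ge0.
    rewrite (memNset nX) adde0; have [r -> hr] := fa x Dx nN nX.
    by rewrite lee_fin; move: hr; rewrite ler_norml => /andP[_]; lra.
  rewrite ge0_integralD //; last 2 first.
  - by move=> x Dx; rewrite adde_ge0 ?g20 ?g30.
  - exact: emeasurable_funD.
  rewrite ge0_integralD //.
  have -> : (\int[P]_(x in D) g1 x = ((a + eps) * pr P D)%:E)%E.
    by rewrite EFinM -prE //; exact: integral_cst.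
  have -> : (\int[P]_(x in D) g2 x = (pr P (D `&` X))%:E)%E.
    by rewrite -prE // -integral_mkcondr integral_cst // mul1e.
  have -> : (\int[P]_(x in D) g3 x = 0)%E.
    have mDN := measurableI _ _ mD mN.
    have e0' : P (D `&` N) = 0%E.
      by apply/eqP; rewrite eq_le measure_ge0 andbT -N0; apply: le_measure; rewrite ?inE.
    rewrite -integral_mkcondr; transitivity (+oo * P (D `&` N))%E; first exact: integral_cst.
    by rewrite e0' mule0.
  by rewrite adde0 -EFinD lee_fin lerD2l.
pose b := Num.max 0 (a - eps).
have b0 : 0 <= b by rewrite le_max lexx.
have b1 : b <= 1 by rewrite ge_max ler01; lra.
have ba : a - eps <= b by rewrite le_max lexx orbT.
have mN' := measurableC mN; have mX' := measurableC mX.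
have mG : measurable (D `&` (~` N `&` ~` X)) by apply: measurableI => //; exact: measurableI.
have lo : ((b * (pr P D - pr P X))%:E <= \int[P]_(x in D) f x)%E.
  pose g := (fun _ : T => b%:E : \bar R) \_ (~` N `&` ~` X).
  apply: (@le_trans _ _ (\int[P]_(x in D) g x)%E).
    have -> : (\int[P]_(x in D) g x = (b * pr P (D `&` (~` N `&` ~` X)))%:E)%E.
      by rewrite EFinM -(prE P mG) -integral_mkcondr; exact: integral_cst.
    rewrite lee_fin; apply: ler_wpM2l => //; rewrite lerBlDr.
    have h1 := pr_split P mD mX.
    have h2 := pr_split P (measurableI _ _ mD mX') mN.
    have h3 : pr P (D `&` ~` X `&` N) = 0.
      apply/eqP; rewrite eq_le pr_ge0 andbT.
      have <- : pr P N = 0 by rewrite /pr N0.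
      exact: (pr_le P (measurableI _ _ (measurableI _ _ mD mX') mN) mN (@subIsetr _ _ _)).
    rewrite h1 h2 h3 add0r (setIC (~` N)) setIA; lra.
  apply: ge0_le_lower_integral => x Dx; rewrite /g patchE.
    by case: ifP => // _; rewrite lee_fin.
  case: ifPn => xG; last exact: f0.
  rewrite inE in xG; case: xG => nN nX; have [r fr hr] := fa x Dx nN nX.
  rewrite fr lee_fin /b ge_max; move: hr; rewrite ler_norml => /andP[hr _].
  by have := f0 x Dx; rewrite fr lee_fin => ->; lra.
have fin : (\int[P]_(x in D) f x)%E \is a fin_num.
  by rewrite ge0_fin_numE ?integral_ge0 //; exact: le_lt_trans up (ltry _).
exists (fine (\int[P]_(x in D) f x)%E / pr P D).
  rewrite [in LHS](prE P mD) inver gt_eqF // EFinM fineK //.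
have hu : fine (\int[P]_(x in D) f x)%E <= (a + eps) * pr P D + pr P X by rewrite -lee_fin fineK.
have hl : b * (pr P D - pr P X) <= fine (\int[P]_(x in D) f x)%E by rewrite -lee_fin fineK.
have pX := pr_ge0 P X.
have bX : b * pr P X <= pr P X by rewrite ler_piMl.
have bD : (a - eps) * pr P D <= b * pr P D by rewrite ler_pM2r.
rewrite ler_norml lerBlDr lerBrDr ler_pdivlMr // ler_pdivrMr //; apply/andP; split; lra.
Qed.

(** The complement of [q, Q] is covered by the rational balls of measure zero,
    which are countably many. *)
Lemma support_full (R : realType) (nu : probability (measurableTypeR R) R) (q Q : R) :
  measure_support nu `<=` [set` `[q, Q]] -> pr nu [set` `[q, Q]] = 1.
Proof.
move=> supp; pose b (r : rat) (m : nat) : set (measurableTypeR R) := ball (ratr r : R) m.+1%:R^-1.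
have mb r m : measurable (b r m) by exact: measurable_ball.
pose F n : set (measurableTypeR R) := if (unpickle n : option (rat * nat)) is Some rm then
  (if pr nu (b rm.1 rm.2) == 0 then b rm.1 rm.2 else set0) else set0.
have mF n : measurable (F n) by rewrite /F; case: unpickle => // -[r m] /=; case: ifP.
have F0 n : pr nu (F n) = 0.
  rewrite /F; case: unpickle => [[r m] /=|]; last by rewrite pr_set0.
  by case: ifPn => [/eqP//|_]; rewrite pr_set0.
have U0 : pr nu (\bigcup_n F n) = 0.
  apply/eqP; rewrite eq_le pr_ge0 andbT; apply: pr_bigcup_le => // n.
  by rewrite big1.
have mI : measurable ([set` `[q, Q]] : set (measurableTypeR R)) by exact: measurable_itv.
have := pr_split nu (@measurableT _ (measurableTypeR R)) mI; rewrite prT !setTI.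
suff -> : pr nu (~` [set` `[q, Q]]) = 0 by rewrite addr0.
apply/eqP; rewrite eq_le pr_ge0 andbT -U0; apply: pr_le.
- exact: measurableC.
- exact: bigcup_measurable.
suff key (x : R) : ~ [set` `[q, Q]] x -> (\bigcup_n F n) x by move=> x; exact: key.
move=> nx; have [e e0 ne] : exists2 e : R, 0 < e & nu (ball x e) = 0%E.
  apply: contrapT => no; apply: nx; apply: supp => e e0.
  rewrite lt_neqAle measure_ge0 andbT; apply/eqP => h; apply: no; exists e => //.
pose m := Num.truncn (2 / e).
have m0 : 0 < m.+1%:R^-1 :> R by rewrite invr_gt0.
have me : 2 * m.+1%:R^-1 <= e.
  rewrite ler_pdivrMr // -ler_pdivrMl // mulrC ltW // truncnS_gt //.
have xx : x < x + m.+1%:R^-1 by rewrite ltrDl.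
have [r] := rat_in_itvoo xx; rewrite in_itv /= => /andP[r1 r2].
have sub (y : R) : b r m y -> ball x e y.
  rewrite /b !ball_itv /= !in_itv /= => /andP[y1 y2].
  have {}y1 : (ratr r : R) - m.+1%:R^-1 < y := y1.
  have {}y2 : y < (ratr r : R) + m.+1%:R^-1 := y2.
  have {}r1 : x < (ratr r : R) := r1.
  have {}r2 : (ratr r : R) < x + m.+1%:R^-1 := r2.
  move: m0 me r1 r2 y1 y2; move: (m.+1%:R^-1 : R) (ratr r : R) => dl rr *.
  by apply/andP; split; lra.
exists (pickle (r, m)); [exact: I|rewrite /F pickleK /=].
have -> : pr nu (b r m) == 0.
  rewrite eq_le pr_ge0 andbT; have <- : pr nu (ball x e) = 0 by rewrite /pr ne.
  exact: (pr_le nu (mb r m) (measurable_ball x e) sub).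
have {}r1 : x < (ratr r : R) := r1.
have {}r2 : (ratr r : R) < x + m.+1%:R^-1 := r2.
rewrite /b ball_itv /= in_itv /=.
move: m0 r1 r2; move: (m.+1%:R^-1 : R) (ratr r : R) => dl rr *.
by apply/andP; split; lra.
Qed.

(** Bernoulli's inequality for the exponential, raised to the power [r]. *)
Lemma pow_le_exp (R : realType) (c : R) r : 0 < c ->
  exists2 C : R, 0 <= C & forall k : nat, k%:R ^+ r <= C * expR (c * k%:R).
Proof.
move=> c0; pose y := c / r.+1%:R; have y0 : 0 < y by rewrite divr_gt0.
exists (y ^- r); first by rewrite invr_ge0 exprn_ge0 // ltW.
move=> k; rewrite ler_pdivlMl ?exprn_gt0 // -exprMn.
have yk : 0 <= y * k%:R by rewrite mulr_ge0 // ltW.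
have -> : c * k%:R = r.+1%:R * (y * k%:R).
  by rewrite /y mulrA [r.+1%:R * _]mulrC divfK.
rewrite expRM_natl.
have h1 : 1 + y * k%:R <= expR (y * k%:R) by exact: expR_ge1Dx.
have h0 : 0 <= expR (y * k%:R) by exact: expR_ge0.
apply: (@le_trans _ _ (expR (y * k%:R) ^+ r)).
  by rewrite lerXn2r ?nnegrE //; lra.
by rewrite exprS ler_peMl ?exprn_ge0 //; lra.
Qed.

Lemma tail_moments (R : realType) (h : probability nat R) (c : R) : 0 < c ->
  (forall k : nat, (1 <= k)%N ->
     (\sum_(k <= l <oo) h [set l] <= (expR (- (c * k%:R)))%:E)%E) ->
  forall r, exists M : R, forall n : nat, \sum_(k < n) k%:R ^+ r * pr h [set (k : nat)] <= M.
Proof.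
move=> c0 tail r.
have hk (k : nat) : pr h [set k] <= expR (- (c * k%:R)).
  case: k => [|k]; first by rewrite mulr0 oppr0 expR0 pr_le1.
  rewrite -lee_fin -prE //; apply: le_trans (tail k.+1 isT).
  apply: le_trans (nneseries_lim_ge k.+2 _) => //.
  by rewrite big_nat1.
have c2 : 0 < c / 2 by rewrite divr_gt0.
have [C C0 hC] := pow_le_exp r c2.
exists (C * (1 - expR (- (c / 2)))^-1) => n.
apply: le_trans (ler_wpM2l C0 (sum_expN n c2)).
rewrite mulr_sumr; apply: ler_sum => k _.
have -> : C * expR (- (c / 2 * k%:R)) = C * expR (c / 2 * k%:R) * expR (- (c * k%:R)).
  by rewrite -[RHS]mulrA -expRD; congr (_ * expR _); field.
by apply: ler_pM; [exact: exprn_ge0|exact: pr_ge0|exact: hC|exact: hk].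
Qed.

(** * The exponential limit in a concentrated environment *)

Lemma seq_least (T : eqType) (r : rel T) (s : seq T) :
  (forall x y, r x y || r y x) -> transitive r -> s != [::] ->
  exists2 x, x \in s & {in s, forall y, r x y}.
Proof.
move=> rtot rtr; elim: s => // x [|y s] IH _.
  by exists x; [rewrite inE|move=> z; rewrite inE => /eqP ->; have := rtot x x; rewrite orbb].
have [m ms hm] := IH isT; have [xm|mx] := orP (rtot x m).
  exists x => [|z]; first by rewrite inE eqxx.
  rewrite inE => /predU1P[->|/hm]; [by have := rtot x x; rewrite orbb|exact: rtr].
exists m => [|z]; first by rewrite inE ms orbT.
by rewrite inE => /predU1P[->|/hm].
Qed.

Lemma vbaseP (T : set vertex) : finite_set T -> T phi -> is_vbase T (vbase T).
Proof.
move=> /finite_seqP[l ->] phil.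
have [u ul hu] := @seq_least _ (fun u v : vertex => (size v <= size u)%N) l
  (fun u v => leq_total (size v) (size u))
  (fun y x z xy yz => leq_trans yz xy) ltac:(by case: (l) phil).
pose lex : rel vertex := fun u v => ((u : seqlexi nat) <= v)%O.
have [v] := @seq_least _ lex [seq v <- l | size v == size u]
  (fun u v => @le_total _ (seqlexi nat) u v) (@le_trans _ (seqlexi nat))
  ltac:(by have : u \in [seq v <- l | size v == size u];
        [rewrite mem_filter eqxx|case: [seq v <- l | size v == size u]]).
rewrite mem_filter => /andP[/eqP suv vl] hv.
apply: (@xgetPex _ phi [set v | is_vbase [set` l] v]); exists v; split => //= [z zl|z zl szv].
  by rewrite suv; exact: hu.
by apply: hv; rewrite mem_filter szv suv eqxx.
Qed.

Section WeightedEnvironments.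
Variable R : realType.
Implicit Types e : env R.

Lemma progeny_rcons e u j :
  progeny e (rcons u j) <-> progeny e u /\ (1 <= j <= (e u).1)%N.
Proof.
elim: u e => [|i u IH] e.
  rewrite (progeny_cons e j [::]).
  by split => [[hj _]|[_ hj]]; split => //; exact: progeny_nil.
rewrite rcons_cons !progeny_cons; split.
  by move=> [hi /IH[pu hj]].
by move=> [[hi pu] hj]; split => //; apply/IH.
Qed.

Lemma is_tree_progeny e : is_tree (progeny e) <-> finite_progeny e.
Proof.
split.
  move=> [/finite_seqP[l el] _ _ _]; exists (\max_(v <- l) size v).+1 => v.
  by rewrite el /= => vl; rewrite ltnS; apply: leq_bigmax_seq.
move=> [N sh]; split.
- by rewrite (progeny_vertices sh); exact: finite_seq.
- exact: progeny_nil.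
- by move=> u j /progeny_rcons[].
- by move=> u pu; exists (e u).1 => j; rewrite progeny_rcons; split => [[]|].
Qed.

Lemma vbase_progeny e : finite_progeny e -> is_vbase (progeny e) (vbase (progeny e)).
Proof. by move=> /is_tree_progeny[Tfin Tphi _ _]; exact: vbaseP. Qed.

Lemma offspring_gt0 e : finite_progeny e -> 1 < tw e -> (0 < offspring e)%N.
Proof.
move=> fe; rewrite lt0n; apply: contraTneq => e0.
by rewrite (tw_children fe) e0 big_nil addr0 ltxx.
Qed.

Lemma child1 e : (0 < offspring e)%N -> progeny e [:: 1%N].
Proof. by move=> e0; apply/progeny_cons; split => //; exact: progeny_nil. Qed.

Lemma vbase_neq0 e : finite_progeny e -> 1 < tw e -> vbase (progeny e) != phi.
Proof.
move=> fe e1; have [_ hs _] := vbase_progeny fe.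
rewrite -size_eq0 -lt0n; exact: (hs _ (child1 (offspring_gt0 fe e1))).
Qed.

Variables q Q : R.
Hypothesis q1 : 1 < q.
Hypothesis qQ : q < Q.

Lemma vertices_prefix_closed N e u j :
  rcons u j \in vertices N e -> u \in vertices N e.
Proof.
move=> /mem_vertices[/progeny_rcons[pu _]]; rewrite size_rcons => su.
by apply/mem_vertices; split => //; exact: ltnW.
Qed.

Lemma mem_verticesP N e v : short N e -> progeny e v <-> v \in vertices N e.
Proof. by move=> sh; rewrite mem_vertices; split => [pv|[]] //; split => //; exact: sh. Qed.

(** The hypotheses of the estimates on a fixed tree are met with [K] = [del] =
    1, and this bound suffices on the exceptional event. *)
Lemma weighted_late_le1 e (Qw : probability trajectory R) (t : R) :
  good q Q e -> 1 < tw e -> is_walk_law (weighted e) phi Qw ->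
  (cond_prob Qw (deep_excursion (weighted e))
    [set x | (t%:E < return_time R x /
       cond_expect Qw (deep_excursion (weighted e)) (return_time R))%E] <= 1)%E.
Proof.
move=> ge e1 walkQ; have [[N sh] be] := ge; have fe : finite_progeny e by exists N.
have [pvb hvb _] := vbase_progeny fe; have vb0 := vbase_neq0 fe e1.
have sP := mem_verticesP _ sh.
have bq v : v \in vertices N e -> v != phi -> q <= bias (weighted e) v.
  by move=> _ _; have /andP[] := be v.
have sphi := (sP _).1 (progeny_nil e); have vbs := (sP _).1 pvb.
apply: (@cond_prob_late_le1 _ (weighted e) (vertices N e) q (vertices_uniq _ _) sphi
  (@vertices_prefix_closed N e) sP q1 bq _ vbs vb0 1%N 1 isT _ ler01 _ _ walkQ erefl).
  by rewrite lt0n size_eq0.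
by rewrite subrr mul1r; apply: (mass_ge0 (@vertices_prefix_closed N e) q1 bq).
Qed.

Lemma subtree_weight_le N e z z' : good q Q e -> short N e -> progeny e z' -> prefix z z' ->
  wt e z' * tw (shifts z' e) <= wt e z * tw (shifts z e).
Proof.
move=> ge sh pz' zz'; have pz : progeny e z.
  by move: zz' => /prefixP[r ez']; have := progeny_take (i := size z) pz'; rewrite ez' take_size_cat.
rewrite -(sum_prefix sh pz) -(sum_prefix sh pz') big_mkcond [leRHS]big_mkcond.
rewrite big_seq [leRHS]big_seq; apply: ler_sum => u /mem_vertices[pu _].
have [/(prefix_trans zz') -> //|_] := ifP; case: ifP => // _.
by have /andP[] := wt_le q1 ge pu.
Qed.

(** The vertex [v] of [concentrated_at] is the vertex [trunk] of the path to
    the base. In terms of weights, the mass missing above it is at most twice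
    the weight missing, plus the weight of [v] itself, at most [Q ^+ k], which
    [u1] makes negligible. *)
Lemma weighted_exponential (t eps : R) : 0 < t -> 0 < eps ->
  exists k (del u1 : R), 0 < del /\
  forall e (Qw : probability trajectory R),
    good q Q e -> concentrated_at k del e -> u1 <= tw e ->
    is_walk_law (weighted e) phi Qw ->
  exists2 r, cond_prob Qw (deep_excursion (weighted e))
    [set x | (t%:E < return_time R x /
       cond_expect Qw (deep_excursion (weighted e)) (return_time R))%E] = r%:E &
    `|r - expR (- t)| <= eps.
Proof.
move=> t0 eps0; have [dd0 dd0p Hdd] := tail_of_partial_sums t0 eps0.
pose dd := Num.min dd0 (Num.min 2^-1 (t / 2)).
have ddp : 0 < dd by rewrite /dd !lt_min dd0p divr_gt0 // invr_gt0 ltr0n.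
have dd_dd0 : dd <= dd0 by rewrite /dd ge_min lexx.
have dd_half : dd <= 2^-1 by rewrite /dd !ge_min lexx !orbT.
have dd_t : dd <= t / 2 by rewrite /dd !ge_min lexx !orbT.
have q0 : 0 < q by exact: lt_trans q1.
have Qp := Q_gt0 q1 qQ.
have p0 : 0 < q^-1 by rewrite invr_gt0.
have p1 : q^-1 < 1 by rewrite invf_lt1.
pose C := (1 - q^-1)^-1; have C0 : 0 < C by rewrite invr_gt0 subr_gt0.
have D0 : 0 < 2 * (12 * C + 3 * q) by lra.
have [k0 hk0] := @expn_small _ q^-1 (dd / (2 * (12 * C + 3 * q))) ltac:(by rewrite (ltW p0) p1)
  (divr_gt0 ddp D0).
(* The terms of the final error that come from p ^+ k and from del share dd
   equally; 6 * del is the fraction of the mass that will be missing. *)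
pose k := k0.+1; have hk : q^-1 ^+ k * (12 * C + 3 * q) <= dd / 2.
  have : q^-1 ^+ k <= dd / (2 * (12 * C + 3 * q)).
    by apply: le_trans hk0; rewrite exprS ler_piMl ?exprn_ge0 // ltW.
  rewrite ler_pdivlMr //; lra.
pose del := Num.min 2^-1 (dd / (144 * C)).
have C144 : 0 < 144 * C by lra.
have delp : 0 < del by rewrite /del lt_min divr_gt0 // invr_gt0 ltr0n.
have del_half : del <= 2^-1 by rewrite /del ge_min lexx.
have del_dd : del * (144 * C) <= dd.
  by rewrite -ler_pdivlMr // /del ge_min lexx orbT.
exists k, del, (Q ^+ k / del); split => // e Qw ge [v [M [sv pv dv hv [u0 pu0 su0]]]] big walkQ.
have [[N sh] be] := ge; have fe : finite_progeny e by exists N.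
have [pvb hvb _] := vbase_progeny fe.
have vvb : prefix v (vbase (progeny e)).
  apply/negPn/negP => /(hv _ pvb); rewrite -su0 ltnNge => /negP; apply; exact: hvb.
have kvb : (k <= size (vbase (progeny e)))%N by rewrite -sv; exact: size_prefix.
have vb0 : vbase (progeny e) != phi by rewrite -size_eq0 -lt0n; exact: leq_trans kvb.
have sP := mem_verticesP _ sh.
have bq z : z \in vertices N e -> z != phi -> q <= bias (weighted e) z.
  by move=> _ _; have /andP[] := be z.
have sphi := (sP _).1 (progeny_nil e); have vbs := (sP _).1 pvb.
have trunkE : take k (vbase (progeny e)) = v by apply/eqP; rewrite -sv -prefixE.
have ptop : progeny e (top (vbase (progeny e))) by exact: progeny_take.
have topv : prefix (top (vbase (progeny e))) v.
  by rewrite -trunkE /top -(@take_takel _ 1 k (vbase _) isT) prefix_take.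
have v0 : v != phi by rewrite -size_eq0 sv.
have top0 : top (vbase (progeny e)) != phi.
  by rewrite -size_eq0 /top size_takel // (leq_trans _ kvb).
have mW z : progeny e z -> z != phi ->
    mass (weighted e) (vertices N e) z = 2 * (wt e z * tw (shifts z e)) - wt e z.
  move=> pz z0; rewrite (mass_weight _ (vertices_uniq N e) (@vertices_prefix_closed N e)) //.
    by rewrite (sum_prefix sh pz).
  exact/sP.
have HT := @tree_exponential _ (weighted e) (vertices N e) q (vertices_uniq _ _) sphi
  (@vertices_prefix_closed N e) sP q1 bq _ vbs vb0 k (6 * del) isT kvb.
apply: (HT _ _ Qw walkQ erefl t dd eps t0 dd_half dd_t); last 2 first.
- exact: tail_modulus_le dd_dd0 Hdd.
- rewrite -/C; have c1 : 0 <= q^-1 ^+ k by rewrite exprn_ge0 // ltW.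
  move: hk del_dd; nra.
- by rewrite mulr_ge0 // ltW.
rewrite /top_mass /trunk trunkE (mW _ ptop top0) (mW _ pv v0).
have g1 := tw_ge1 q1 qQ (good_shifts ptop ge).
have /andP[w1 _] := wt_le q1 ge ptop; have /andP[w2] := wt_le q1 ge pv.
rewrite sv => w3.
have Wle := subtree_weight_le ge sh pv topv.
have Wtot := subtree_weight_le ge sh ptop (prefix0s _).
have e0 : shifts phi e = e by [].
rewrite wt_nil mul1r e0 in Wtot.
have bg : Q ^+ k <= del * tw e by rewrite mulrC -ler_pdivrMr.
have tw0 := tw_ge0 q1 qQ ge.
have omt : wt e (top (vbase (progeny e))) <=
    wt e (top (vbase (progeny e))) * tw (shifts (top (vbase (progeny e))) e).
  by rewrite ler_peMr.
move: w1 w2 w3 Wle Wtot bg tw0 omt dv delp del_half.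
set Wt := wt e (top _) * tw _; set Wv := wt e v * tw _; set ot := wt e (top _); set ov := wt e v.
move: Wt Wv ot ov (Q ^+ k) => Wt Wv ot ov QK.
move: (tw e) => T; clear; move=> w1 w2 w3 Wle Wtot bg tw0 omt dv dp dh.
have h1 : del * T <= 2^-1 * T by exact: ler_wpM2r.
have h2 : 2^-1 * T <= 2 * Wt - ot by lra.
have h3 : del * (2^-1 * T) <= del * (2 * Wt - ot) by rewrite ler_pM2l.
lra.
Qed.

End WeightedEnvironments.

(** * Averaging over the environment *)

Section Annealed.
Variables (R : realType) (h : probability nat R) (nu : probability (measurableTypeR R) R).
Variables (d : measure_display) (Omega : measurableType d) (P : probability Omega R).
Variables (K : vertex -> {RV P >-> nat}) (B : vertex -> {RV P >-> measurableTypeR R}).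

(** What [is_wtree] requires of the biases. *)
Definition proper : set (env R) :=
  [set e | forall v, progeny e v -> v != phi -> 1 < (e v).2].

Lemma measurable_proper : measurable (proper : set (g_sigma_algebraType (@boxes R))).
Proof.
rewrite (_ : proper = \bigcap_v (~` [set e : env R | progeny e v] `|`
    [set e : env R | setT (e v).1 /\ (if v == phi then setT else [set` `]1, +oo[]) (e v).2])).
  rewrite -[X in measurable X]setCK setC_bigcap; apply: measurableC.
  apply: countable_bigcupT_measurable => [|v]; first exact: countableP.
  apply: measurableC; apply: measurableU.
    by apply: measurableC; exact: measurable_progeny.
  apply: measurable_coordinate; case: ifP => _; [exact: measurableT|exact: measurable_itv].
apply/seteqP; split => e /= he v.
  move=> _; have [pv|npv] := pselect (progeny e v); [right; split => //|by left].
  by case: eqVneq => //= v0; rewrite in_itv /= he.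
by move=> pv v0; have [//|[_]] := he v I; rewrite (negbTE v0) /= in_itv /= andbT.
Qed.

Lemma good_proper q Q : 1 < q -> good q Q `<=` proper.
Proof. by move=> q1 e [_ be] v _ _; have /andP[+ _] := be v; exact: lt_le_trans. Qed.

Lemma conditioned_event u :
  [set o | is_wtree (gw_wtree K B o) /\ u < total_weight (gw_wtree K B o)] =
  sample K B @^-1` (heavy u `&` proper).
Proof.
apply/seteqP; split => o /=.
  by move=> [[/(is_tree_progeny (sample K B o)) fe he] ue].
by move=> [[fe ue] he]; split => //; split => //; exact: (is_tree_progeny (sample K B o)).2.
Qed.

Lemma offspring_mean : (\sum_(1 <= k <oo) (k%:R)%:E * h [set k] < 1)%E ->
  exists mh : R, [/\ 0 <= mh, mh < 1 &
    forall n : nat, \sum_(k < n) k%:R * pr h [set (k : nat)] <= mh].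
Proof.
have pos k : (0 <= (k%:R)%:E * h [set k])%E by rewrite mule_ge0 // lee_fin.
move=> lt1; have ge0 := nneseries_ge0 (N := 1) (P := xpredT) (fun k _ _ => pos k).
have lim n := nneseries_lim_ge (m := 1) (P := xpredT) n (fun k _ _ => pos k).
move: lt1 ge0 lim; case: (\sum_(1 <= k <oo) _)%E => [m| |] //; rewrite lte_fin lee_fin => m1 m0 lim.
exists m; split => // -[|n]; first by rewrite big_ord0.
rewrite -lee_fin; apply: le_trans (lim n.+1).
rewrite big_ord_recl mul0r add0r -sumEFin big_add1 /= big_mkord.
by apply: lee_sum => i _; rewrite EFinM -prE.
Qed.

Lemma offspring_positive : (0 < \sum_(1 <= k <oo) (k%:R)%:E * h [set k])%E ->
  exists2 n, (0 < n)%N & 0 < pr h [set n].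
Proof.
move=> gt0; apply: contrapT => no; move: gt0; rewrite eseries0 ?ltxx // => k k0 _.
rewrite prE // (_ : pr h [set k] = 0) ?mule0 //; apply/eqP; rewrite eq_le pr_ge0 andbT leNgt.
by apply/negP => hk; apply: no; exists k.
Qed.

Hypothesis KB : gw_family h nu K B.

(** In [good] environments, which are almost sure, the quenched probability is
    at most one, and it is close to exp(-t) off the exceptional event of
    [concentration]. *)
Lemma joint_prob_close (q Q c t eps : R) (walk : wtree R -> probability trajectory R) :
  (0 < \sum_(1 <= k <oo) (k%:R)%:E * h [set k])%E ->
  (\sum_(1 <= k <oo) (k%:R)%:E * h [set k] < 1)%E ->
  0 < c ->
  (forall k : nat, (1 <= k)%N ->
     (\sum_(k <= l <oo) h [set l] <= (expR (- (c * k%:R)))%:E)%E) ->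
  1 < q -> q < Q -> measure_support nu `<=` [set` `[q, Q]] ->
  (forall w, is_wtree w -> has_edge w -> is_walk_law w phi (walk w)) ->
  0 < t -> 0 < eps ->
  exists u0, forall u, u0 <= u -> exists2 r,
    joint_prob P (gw_wtree K B) walk u
      (fun w => [set x | (t%:E < return_time R x / mean_return_time walk w)%E]) = r%:E &
    `|r - expR (- t)| <= eps.
Proof.
move=> mh_gt0 mh_lt1 c0 h_tail q1 qQ nu_supp walkP t0 eps0.
have [mh [mh0 mh1 offspring_mean_le]] := offspring_mean mh_lt1.
have [n0 n0_gt0 h_n0] := offspring_positive mh_gt0.
have moments := tail_moments c0 h_tail; have nu_itv := support_full nu_supp.
have eps2 : 0 < eps / 2 by rewrite divr_gt0.
have [k [del [u1 [del0 quenched]]]] := weighted_exponential q1 qQ t0 eps2.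
have [u0 annealed] := concentration KB q1 qQ nu_itv mh0 mh1 offspring_mean_le moments n0_gt0 h_n0 k del0 eps2.
exists (Num.max 1 (Num.max u0 u1)) => u; rewrite !ge_max => /and3P[u_ge1 u0u u1u].
have [X mX [X_le X_conc]] := annealed u u0u.
have mD : measurable (heavy u `&` proper : set (g_sigma_algebraType (@boxes R))).
  by apply: measurableI; [exact: measurable_heavy|exact: measurable_proper].
have mG := @measurable_good R q Q.
have goodI := @mu_goodI _ _ _ _ _ _ _ _ KB _ _ _ _ q1 qQ nu_itv mh0 mh1 offspring_mean_le n0_gt0 h_n0.
have D_ge : heavy_prob K B u <= pr P (sample K B @^-1` (heavy u `&` proper)).
  rewrite /heavy_prob -(goodI _ (measurable_heavy u)).
  apply: pr_le; [|exact: measurable_sample|]; last first.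
    by move=> o [hu hg]; split => //; exact: good_proper q1 _ hg.
  by apply: measurable_sample; apply: measurableI => //; exact: measurable_heavy.
have D_gt0 : 0 < pr P (sample K B @^-1` (heavy u `&` proper)).
  apply: lt_le_trans D_ge.
  exact: (heavy_prob_gt0 KB q1 qQ nu_itv mh0 mh1 offspring_mean_le n0_gt0 h_n0 (lt_le_trans ltr01 u_ge1)).
have N0 : P (sample K B @^-1` (~` good q Q)) = 0.
  rewrite prE; last by apply: measurable_sample; exact: measurableC.
  have := pr_split P (@measurableT _ Omega) (measurable_sample K B mG).
  rewrite !setTI -preimage_setC; have := goodI setT measurableT; rewrite setTI mu_setT /mu => ->.
  have := @mu_setT R d Omega P K B; rewrite /mu preimage_setT => ->.
  by rewrite -[X in X = _]addr0 => /addrI <-.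
rewrite [eps]splitr /joint_prob /cond_expect conditioned_event.
have walk_law e : good q Q e -> u < tw e -> is_walk_law (weighted e) phi (walk (weighted e)).
  move=> ge ue; apply: walkP.
    by split; [exact/is_tree_progeny/ge.1|exact: good_proper q1 _ ge].
  exists [:: 1%N] => //; apply/child1/(offspring_gt0 ge.1); exact: le_lt_trans ue.
apply: (@lower_average _ _ _ _ _ (sample K B @^-1` X) (sample K B @^-1` (~` good q Q))).
- exact: measurable_sample.
- exact: measurable_sample.
- by apply: measurable_sample; exact: measurableC.
- exact: N0.
- by rewrite expR_ge0 expR_le1 oppr_le0 ltW.
- exact: ltW.
- exact: D_gt0.
- by apply: le_trans X_le _; rewrite ler_pM2l.
- by move=> o _; rewrite /cond_prob mule_ge0 // inve_ge0.
- move=> o [[_ ue] _] /contrapT ge.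
  exact: (weighted_late_le1 q1 t ge (le_lt_trans u_ge1 ue) (walk_law _ ge ue)).
- move=> o [[_ ue] _] /contrapT ge nX.
  have := quenched _ _ ge (X_conc _ ge ue nX) (le_trans u1u (ltW ue)) (walk_law _ ge ue).
  by [].
Qed.

End Annealed.

Theorem theorem3 (R : realType)
  (h : probability nat R)
  (mh_gt0 : (0 < \sum_(1 <= k <oo) (k%:R)%:E * h [set k])%E)
  (mh_lt1 : (\sum_(1 <= k <oo) (k%:R)%:E * h [set k] < 1)%E)
  (c : R) (c_gt0 : 0 < c)
  (h_tail : forall k : nat, (1 <= k)%N ->
     (\sum_(k <= l <oo) h [set l] <= (expR (- (c * k%:R)))%:E)%E)
  (nu : probability (measurableTypeR R) R)
  (nu_gt1 : nu [set` `]1, +oo[] = 1%E)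
  (q Q : R) (q_gt1 : 1 < q) (qQ : q < Q)
  (nu_supp : measure_support nu `<=` [set` `[q, Q]])
  (d : measure_display) (Omega : measurableType d) (P : probability Omega R)
  (K : vertex -> {RV P >-> nat}) (B : vertex -> {RV P >-> measurableTypeR R})
  (KB : gw_family h nu K B)
  (walk : wtree R -> probability trajectory R)
  (walkP : forall w, is_wtree w -> has_edge w -> is_walk_law w phi (walk w))
  (t : R) (t_gt0 : 0 < t) :
  joint_prob P (gw_wtree K B) walk u
    (fun w => [set x | (t%:E < return_time R x / mean_return_time walk w)%E])
    @[u --> +oo%R] --> (expR (- t))%:E.
Proof.
have close eps := @joint_prob_close R h nu d Omega P K B KB q Q c t eps walk
  mh_gt0 mh_lt1 c_gt0 h_tail q_gt1 qQ nu_supp walkP t_gt0.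
apply/fine_cvgP; split.
  have [u0 hu0] := close 1 ltr01.
  near=> u; have [|r -> _ //] := hu0 u.
  by near: u; apply: nbhs_pinfty_ge; exact: num_real.
apply/cvgrPdist_le => eps eps0; have [u0 hu0] := close eps eps0.
near=> u; have [|r /= -> rt] := hu0 u; last by rewrite distrC.
by near: u; apply: nbhs_pinfty_ge; exact: num_real.
Unshelve. all: by end_near.
Qed.
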